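(* Let $S=\Omega/\Gamma$ be a strictly convex projective surface of finite volume with $k\ge1$ cusps, and let $B\subset\mathcal{L}$ be the $\Gamma$-invariant set of light-cone representatives associated with a choice of one light-cone representative for each cusp. Then the Edge Flipping Algorithm (described in the context), started from an arbitrary straight ideal triangulation of $S$, terminates in finitely many iterations.
   Context: A strictly convex domain $\Omega\subset\mathbb{R}P^2$ is an open set whose closure lies in an affine patch, is convex there, and whose boundary contains no non-degenerate line segment. $S=\Omega/\Gamma$ is the quotient of $\Omega$ by a discrete, finitely generated group $\Gamma<\mathrm{SL}(3,\mathbb{R})$ preserving $\Omega$ and acting freely on it; $S$ has finite volume and is homeomorphic to a closed orientable surface of genus $g$ with $k\ge1$ points removed, of negative Euler characteristic. Fix a lift $\Omega^+\subset\mathbb{S}^2\subset\mathbb{R}^3$ of $\Omega$ to the unit sphere, preserved by $\Gamma$. The light-cone is $\mathcal{L}=\mathbb{R}^+\cdot\partial\Omega^+$. Each cusp $c$ of $S$ corresponds to a $\Gamma$-orbit of parabolic fixed points on $\partial\Omega$; choose an orbit representative $p_c\in\partial\Omega$ and a lift $v_c\in\mathcal{L}$ of $p_c$ (a light-cone representative). The set $B=\{\gamma v_c\mid \gamma\in\Gamma,\ c\text{ a cusp of }S\}$ is discrete (in particular $0$ is not an accumulation point), and contains exactly one lift of each parabolic fixed point. An ideal triangulation of $S$ is a decomposition of $S$ into ideal triangles by pairwise disjoint, pairwise non-homotopic essential arcs running between cusps; it is straight if each ideal edge is the image of the intersection of $\Omega$ with a projective line. A straight ideal triangulation lifts to a $\Gamma$-invariant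 triangulation of $\Omega$ by ideal triangles with vertices at parabolic fixed points; the induced $\Gamma$-invariant polyhedron $P$ is the polyhedral surface in $\mathbb{R}^3$ whose faces are the Euclidean triangles $\tilde a\tilde b\tilde c$, one for each ideal triangle $abc$ of this triangulation of $\Omega$, where $\tilde a,\tilde b,\tilde c\in B$ are the lifts of $a,b,c$. The face class of a face $F$ is $\Gamma\cdot F$; there are finitely many face classes. For a face $F$, let $X_F$ be the plane through $F$ (it does not contain the origin). A point $v$ is below $F$ if $v$ and the origin lie in the same component of $\mathbb{R}^3\setminus X_F$. The neighbouring faces of $F$ are the faces sharing an edge with $F$; a neighbouring vertex of $F$ is the vertex of a neighbouring face not on the shared edge. If $F$ has vertices $a,b,c$ and $v$ is the neighbouring vertex across the edge $ab$, the edge flip on $\{v,F\}$ replaces the faces $\{a,b,c\}$ and $\{a,b,v\}$ by $\{c,v,a\}$ and $\{c,b,v\}$, performed $\Gamma$-equivariantly (so two face classes are replaced by two other face classes); it is admissible if $v$ is below $F$. Edge Flipping Algorithm. Input: a straight ideal triangulation of $S$; let $P$ be the induced $\Gamma$-invariant polyhedron. (1) Go through the face classes of $P$ and, for each, the neighbouring vertices $v$ of a representative $F$; if some $v$ is below $F$, perform the edge flip on $\{v,F\}$, replacing $P$ by the resulting $\Gamma$-invariant polyhedron, and restart step (1). If there are no admissible edge flips for any face class, go to step (2). (2) Cleanup: for each edge class $e$ of $P$, if the two faces sharing $e$ are coplanar, remove $e$ ($\Gamma$-equivariantly) and merge the two faces. Return $P$. *)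

(* Defs.v *)
(* R^3 is 'cV[R]_3, on which matrices act on the left, for an arbitrary
   R : realType. *)
From HB Require Import structures.
From Stdlib Require Export Relation_Operators.
From mathcomp Require Export all_boot all_order all_algebra.
From mathcomp Require Export all_classical all_reals all_analysis.
Export Order.TTheory GRing.Theory Num.Theory numFieldNormedType.Exports.

Set Implicit Arguments.
Unset Strict Implicit.
Unset Printing Implicit Defensive.

Local Open Scope classical_set_scope.
Local Open Scope ring_scope.

Section Quotient.
Context {T : topologicalType} (E : T -> T -> Prop).

Definition glue_rel : rel T := fun x y => `[< clos_refl_sym_trans T E x y >].

Lemma glue_refl : reflexive glue_rel.
Proof. by move=> x; apply/asboolP; apply: rst_refl. Qed.

Lemma glue_sym : symmetric glue_rel.
Proof.
by move=> x y; apply/asboolP/asboolP => h; apply: rst_sym.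
Qed.

Lemma glue_trans : transitive glue_rel.
Proof.
move=> y x z /asboolP xy /asboolP yz; apply/asboolP.
exact: (rst_trans _ _ _ _ _ xy yz).
Qed.

Definition glue : equiv_rel T := EquivRel glue_rel glue_refl glue_sym glue_trans.

(* T modulo the equivalence relation generated by E, with the quotient
   topology *)
Definition quotient_space : Type := quotient_topology {eq_quot glue}%qT.

HB.instance Definition _ :=
  Topological.copy quotient_space (quotient_topology {eq_quot glue}%qT).

Definition quotient_map (x : T) : quotient_space := (\pi_({eq_quot glue}) x)%qT.

End Quotient.

Definition homeomorphic (X Y : topologicalType) : Prop :=
  exists (f : X -> Y) (g : Y -> X),
    [/\ cancel f g, cancel g f, continuous f & continuous g].

Section ClosedSurface.
Variable R : realType.

Definition disc : set (R * R)%type := [set z | z.1 ^+ 2 + z.2 ^+ 2 <= 1].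

(* The side j of a polygon with n sides inscribed (with curved sides) in the
   unit circle, parametrised by 0 <= t <= 1. *)
Definition side (n j : nat) (t : R) : (R * R)%type :=
  let theta := 2 * pi * (j%:R + t) / n%:R in (cos theta, sin theta).

(* For g > 0 the boundary word of the 4g-gon is the product of the commutators
   [a_i, b_i]: the side 4i is glued to the side 4i+2, and the side 4i+1 to the
   side 4i+3, in both cases with opposite directions. For g = 0 the two sides
   of a bigon are glued so as to give a sphere. *)
Definition side_pairing (g : nat) (x y : set_type disc) : Prop :=
  exists2 t : R, 0 <= t <= 1 &
  if g is 0 then
    val x = side 2 0 t /\ val y = side 2 1 (1 - t)
  else
    exists2 i : nat, (i < g)%N &
      (val x = side (4 * g) (4 * i) t
         /\ val y = side (4 * g) (4 * i + 2) (1 - t))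
      \/ (val x = side (4 * g) (4 * i + 1) t
         /\ val y = side (4 * g) (4 * i + 3) (1 - t)).

Definition closed_surface (g : nat) : topologicalType :=
  quotient_space (@side_pairing g).

Definition homeomorphic_to_punctured_surface (X : topologicalType)
    (g k : nat) : Prop :=
  exists D : set (closed_surface g), (D #= `I_k)%card /\ homeomorphic X (set_type (~` D)).

End ClosedSurface.

Section Hausdorff.
Variables (R : realType) (X : Type) (dist : X -> X -> R).
Local Open Scope ereal_scope.

Definition diameter (U : set X) : \bar R :=
  ereal_sup [set r | r = 0 \/ exists x y, [/\ U x, U y & r = (dist x y)%:E]].

(* The 2-dimensional Hausdorff (outer) measure, without normalising constant;
   each set of a cover contributes the square of its diameter, 0 if empty. *)
Definition hausdorff2 (A : set X) : \bar R :=
  ereal_sup [set ereal_inf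
    [set \sum_(0 <= n <oo) diameter (U n) ^+ 2 | U in
      [set U : nat -> set X |
         A `<=` \bigcup_n U n /\ forall n, diameter (U n) <= delta%:E]]
    | delta in [set delta : R | (0 < delta)%R]].

End Hausdorff.

Section Projective.
Variable R : realType.
Notation V := 'cV[R]_3.

Definition proportional (u v : set_type [set w : V | w != 0]) : Prop :=
  exists2 t : R, t != 0 & val v = t *: val u.

Definition RP2 : topologicalType := quotient_space proportional.

(* v is a (nonzero) vector of homogeneous coordinates of p *)
Definition hcoord (p : RP2) (v : V) : Prop :=
  exists2 w : set_type [set w : V | w != 0], val w = v & quotient_map proportional w = p.

Definition preimage_cone (A : set RP2) : set V :=
  [set v | exists2 p, A p & hcoord p v].

Definition pairing (f : 'rV[R]_3) (v : V) : R := (f *m v) 0 0.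

(* the part of A in the affine patch f <> 0, seen in the affine plane f = 1 *)
Definition chart (f : 'rV[R]_3) (A : set RP2) : set V :=
  [set v | preimage_cone A v /\ pairing f v = 1].

Definition boundary (T : topologicalType) (A : set T) : set T :=
  closure A `\` A°.

Definition segment (u v : V) : set V :=
  [set t *: u + (1 - t) *: v | t in [set t : R | 0 <= t <= 1]].

Definition strictly_convex_domain (Omega : set RP2) : Prop :=
  [/\ open Omega, Omega !=set0 &
    exists f : 'rV[R]_3,
    [/\ forall v, preimage_cone (closure Omega) v -> pairing f v != 0,
        convex_set (chart f Omega : set (convex_lmodType V)),
        convex_set (chart f (closure Omega) : set (convex_lmodType V)) &
        forall u v, u != v -> ~ segment u v `<=` chart f (boundary Omega)]].

Definition sqnorm (v : V) : R := \sum_i v i 0 ^+ 2.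
Definition sphere : set V := [set v | sqnorm v = 1].
Definition radial (v : V) : V := (Num.sqrt (sqnorm v))^-1 *: v.

(* Omp is one of the two components of the preimage of Omega in the sphere *)
Definition is_lift (Omega : set RP2) (Omp : set V) : Prop :=
  [/\ Omp `<=` sphere, Omp `<=` preimage_cone Omega, connected Omp &
      forall p, Omega p -> exists! v, Omp v /\ hcoord p v].

(* As Omp is open in the sphere, which is closed in R^3, the boundary of Omp in
   the sphere is closure Omp `\` Omp. *)
Definition lightcone (Omp : set V) : set V :=
  [set v | exists t u, [/\ 0 < t, (closure Omp `\` Omp) u & v = t *: u]].

Notation M3 := 'M[R]_3.

Definition subgroup_SL3 (G : set M3) : Prop :=
  [/\ forall a, G a -> \det a = 1, G 1%:M,
      forall a b, G a -> G b -> G (a *m b) &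
      forall a, G a -> G (invmx a)].

Definition discrete_subset (G : set M3) : Prop := G `<=` isolated G.

Definition finitely_generated (G : set M3) : Prop :=
  exists s : seq M3, [set` s] `<=` G /\
    forall H, subgroup_SL3 H -> [set` s] `<=` H -> G `<=` H.

(* q is the image of p under the projective transformation induced by a *)
Definition moves (a : M3) (p q : RP2) : Prop :=
  exists2 v, hcoord p v & hcoord q (a *m v).

Definition preserves (G : set M3) (Omega : set RP2) : Prop :=
  forall a p q, G a -> moves a p q -> Omega p -> Omega q.

Definition preserves_lift (G : set M3) (Omp : set V) : Prop :=
  forall a v, G a -> Omp v -> Omp (radial (a *m v)).

Definition acts_freely (G : set M3) (Omega : set RP2) : Prop :=
  forall a p, G a -> Omega p -> moves a p p -> a = 1%:M.

(* the parabolic automorphisms of a strictly convex domain of the plane are the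
   conjugates of a unipotent Jordan block of size 3 *)
Definition standard_parabolic : M3 :=
  \matrix_(i, j) (((j == i) || (j == i.+1 :> nat)) %:R).

Definition parabolic (a : M3) : Prop :=
  exists2 h, h \in unitmx & a = h *m standard_parabolic *m invmx h.

Definition parabolic_point (G : set M3) (Omega : set RP2) : set RP2 :=
  [set p | boundary Omega p /\ exists a, [/\ G a, parabolic a & moves a p p]].

Definition orbit (G : set M3) (p : RP2) : set RP2 :=
  [set q | exists2 a, G a & moves a p q].

(* a cusp is identified with the corresponding orbit of parabolic points *)
Definition cusps (G : set M3) (Omega : set RP2) : set (set RP2) :=
  [set orbit G p | p in parabolic_point G Omega].

Section Surface.
Variables (G : set M3) (Omega : set RP2).

Definition same_orbit (x y : set_type Omega) : Prop :=
  exists2 a, G a & moves a (val x) (val y).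

Definition surface : topologicalType := quotient_space same_orbit.

Definition image_in_surface (A : set RP2) : set surface :=
  [set quotient_map same_orbit x | x in [set x : set_type Omega | A (val x)]].

Definition embeds_in_surface (A : set RP2) : Prop :=
  {in [set x : set_type Omega | A (val x)] &,
    injective (quotient_map same_orbit)}.

(* If the line through x and y meets the boundary of Omega in [u] and [v], and
   if x = [x1 u + x2 v] and y = [y1 u + y2 v], then the cross-ratio of the four
   points is (x1 y2) / (x2 y1) or its inverse, and the Hilbert distance is half
   of the absolute value of its logarithm. *)
Definition hilbert_dist (Omp : set V) (x y : RP2) : R :=
  xget 0 [set r | exists u v x1 x2 y1 y2,
    [/\ lightcone Omp u /\ lightcone Omp v,
        [/\ 0 < x1, 0 < x2, 0 < y1 & 0 < y2],
        hcoord x (x1 *: u + x2 *: v), hcoord y (y1 *: u + y2 *: v) &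
        r = `| ln ((x1 * y2) / (x2 * y1)) | / 2]].

Definition surface_dist (Omp : set V) (a b : surface) : R :=
  inf [set r | exists x y : set_type Omega,
    [/\ quotient_map same_orbit x = a, quotient_map same_orbit y = b &
        r = hilbert_dist Omp (val x) (val y)]].

(* The Busemann volume of S is, up to a constant factor, the Hausdorff measure of
   the metric induced on S by the Hilbert metric. *)
Definition finite_volume (Omp : set V) : Prop :=
  (hausdorff2 (surface_dist Omp) [set: surface] < +oo)%E.

Definition line (p q : RP2) : set RP2 :=
  [set x | exists u v s t,
    [/\ hcoord p u, hcoord q v & hcoord x (s *: u + t *: v)]].

(* the open triangle with vertices p, q, r on the boundary, contained in Omega;
   the vectors of the light-cone are used to select it among the four
   triangles of the projective plane with these vertices *)
Definition open_triangle (Omp : set V) (p q r : RP2) : set RP2 :=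
  [set x | exists u v w s t z,
    [/\ [/\ lightcone Omp u, lightcone Omp v & lightcone Omp w],
        [/\ hcoord p u, hcoord q v & hcoord r w],
        [/\ 0 < s, 0 < t & 0 < z] &
        hcoord x (s *: u + t *: v + z *: w)]].

Definition straight_arc (e : set surface) : Prop :=
  exists p q, [/\ parabolic_point G Omega p, parabolic_point G Omega q, p <> q,
    embeds_in_surface (line p q) & e = image_in_surface (line p q)].

(* p q r is an ideal triangle of Omega whose sides are lifts of arcs in A and
   whose interior is a lift of a part of S that meets no arc in A *)
Definition lifted_triangle (Omp : set V) (A : set (set surface))
    (p q r : RP2) : Prop :=
  [/\ [/\ parabolic_point G Omega p, parabolic_point G Omega q
        & parabolic_point G Omega r],
      [/\ p <> q, q <> r & r <> p],
      [/\ A (image_in_surface (line p q)), A (image_in_surface (line q r))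
        & A (image_in_surface (line r p))] &
      image_in_surface (open_triangle Omp p q r) `&` \bigcup_(e in A) e = set0].

(* The triangulation is given by its set A of ideal edges. Straight arcs are
   essential, and homotopic straight arcs coincide, because a lift is
   determined by its two distinct endpoints on the boundary of Omega. *)
Definition straight_ideal_triangulation (Omp : set V)
    (A : set (set surface)) : Prop :=
  [/\ finite_set A, A `<=` straight_arc, trivIset A id &
      forall x, ~ (\bigcup_(e in A) e) x ->
        exists p q r, [/\ lifted_triangle Omp A p q r,
          embeds_in_surface (open_triangle Omp p q r) &
          connected_component (~` \bigcup_(e in A) e) x
            = image_in_surface (open_triangle Omp p q r)]].

End Surface.

Definition lightcone_choice (G : set M3) (Omega : set RP2) (Omp : set V)
    (v : set RP2 -> V) : Prop :=
  forall c, cusps G Omega c ->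
    lightcone Omp (v c) /\ exists2 p, c p & hcoord p (v c).

Definition lightcone_orbit (G : set M3) (Omega : set RP2)
    (v : set RP2 -> V) : set V :=
  [set w | exists a c, [/\ G a, cusps G Omega c & w = a *m v c]].

(* A face (or an edge) is represented by the set of its vertices, and a
   polyhedron by the set of its faces. *)
Definition face := set V.
Definition polyhedron := set face.

Definition induced_polyhedron (G : set M3) (Omega : set RP2) (Omp : set V)
    (B : set V) (A : set (set (surface G Omega))) : polyhedron :=
  [set F | exists p q r a b c,
    [/\ lifted_triangle Omp A p q r, [/\ B a, B b & B c],
        [/\ hcoord p a, hcoord q b & hcoord r c] & F = [set a; b; c]]].

Definition plane (X : set V) : Prop :=
  exists (f : 'rV[R]_3) (d : R), f != 0 /\ X = [set v | pairing f v = d].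

Definition below (F : face) (v : V) : Prop :=
  exists X, [/\ plane X, F `<=` X & connected_component (~` X) 0 v].

Definition coplanar (F F' : face) : Prop :=
  exists X, [/\ plane X, F `<=` X & F' `<=` X].

(* v is the neighbouring vertex of the face a b c across the edge a b *)
Definition neighbouring_vertex (P : polyhedron) (a b c v : V) : Prop :=
  [/\ uniq [:: a; b; c; v], P [set a; b; c] & P [set a; b; v]].

Section Algorithm.
Variable G : set M3.

Definition class_of (F : face) : set face :=
  [set [set a *m v | v in F] | a in G].

Definition edge_flip (P : polyhedron) (a b c v : V) : polyhedron :=
  (P `\` (class_of [set a; b; c] `|` class_of [set a; b; v]))
  `|` (class_of [set c; v; a] `|` class_of [set c; b; v]).

Definition is_edge (P : polyhedron) (e : face) : Prop :=
  exists a b F, [/\ a != b, e = [set a; b], P F & e `<=` F].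

Definition share_edge (P : polyhedron) (e F F' : face) : Prop :=
  [/\ is_edge P e, P F, P F', F <> F' & e `<=` F `&` F'].

(* The polyhedron obtained from P by removing the edges whose class is in
   removed, merging the faces on both sides of each of them. *)
Definition merge (P : polyhedron) (removed : set (set face)) : polyhedron :=
  [set \bigcup_(F' in [set F' | clos_refl_trans face
       (fun F1 F2 => exists2 e, removed (class_of e) & share_edge P e F1 F2)
       F F']) F'
   | F in P].

(* Scan P seen: in step (1), with current polyhedron P; seen is the set of face
   classes that have been gone through since the last (re)start.
   Cleanup P seen removed: in step (2); seen is the set of edge classes that
   have been gone through, removed the set of those that have been removed.
   The current polyhedron is merge P removed; as the merged faces are coplanar,
   the two faces sharing an edge are coplanar in it if and only if they are so
   in P.
   Return Q: the algorithm has returned Q. *)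
Inductive state :=
  | Scan of polyhedron & set (set face)
  | Cleanup of polyhedron & set (set face) & set (set face)
  | Return of polyhedron.

(* The orders in which classes, their representatives and the neighbouring
   vertices are gone through are left unspecified. *)
Inductive step : state -> state -> Prop :=
  | step_flip P seen a b c v :
      neighbouring_vertex P a b c v -> ~ seen (class_of [set a; b; c]) ->
      below [set a; b; c] v ->
      step (Scan P seen) (Scan (edge_flip P a b c v) set0)
  | step_no_flip P seen F :
      P F -> ~ seen (class_of F) ->
      (forall a b c v, F = [set a; b; c] -> neighbouring_vertex P a b c v ->
         ~ below F v) ->
      step (Scan P seen) (Scan P (class_of F |` seen))
  | step_to_cleanup P seen :
      (forall F, P F -> seen (class_of F)) ->
      step (Scan P seen) (Cleanup P set0 set0)
  | step_remove P seen removed e F F' :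
      share_edge P e F F' -> ~ seen (class_of e) -> coplanar F F' ->
      step (Cleanup P seen removed)
           (Cleanup P (class_of e |` seen) (class_of e |` removed))
  | step_keep P seen removed e :
      is_edge P e -> ~ seen (class_of e) ->
      (forall F F', share_edge P e F F' -> ~ coplanar F F') ->
      step (Cleanup P seen removed) (Cleanup P (class_of e |` seen) removed)
  | step_return P seen removed :
      (forall e, is_edge P e -> seen (class_of e)) ->
      step (Cleanup P seen removed) (Return (merge P removed)).

Definition returned (s : state) : Prop := exists Q, s = Return Q.

Lemma step_progress (s : state) : returned s \/ exists s', step s s'.
Proof.
case: s => [P seen|P seen removed|Q]; last by left; exists Q.
- right; have [allseen|] := pselect (forall F, P F -> seen (class_of F)).
    by exists (Cleanup P set0 set0); exact: step_to_cleanup.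
  move=> /existsNP[F] /not_implyP[PF nF].
  have [[a [b [c [v [eF nv bv]]]]]|noflip] := pselect (exists a b c v,
    [/\ F = [set a; b; c], neighbouring_vertex P a b c v & below F v]).
    subst F.
    by exists (Scan (edge_flip P a b c v) set0); apply: step_flip.
  exists (Scan P (class_of F |` seen)); apply: step_no_flip => // a b c v eF nv bv.
  by apply: noflip; exists a, b, c, v.
- right; have [allseen|] := pselect (forall e, is_edge P e -> seen (class_of e)).
    by exists (Return (merge P removed)); exact: step_return.
  move=> /existsNP[e] /not_implyP[Pe ne].
  have [[F [F' [sF cF]]]|noc] := pselect (exists F F',
    share_edge P e F F' /\ coplanar F F').
    exists (Cleanup P (class_of e |` seen) (class_of e |` removed)).
    exact: (step_remove removed sF ne cF).
  exists (Cleanup P (class_of e |` seen) removed).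
  by apply: step_keep => // F F' sF cF; apply: noc; exists F, F'.
Qed.

Definition terminates (s : state) : Prop :=
  forall run : nat -> state, run 0%N = s ->
    (forall n, step (run n) (run n.+1)
               \/ (returned (run n) /\ run n.+1 = run n)) ->
    exists n, returned (run n).

Definition edge_flipping_algorithm_terminates (P : polyhedron) : Prop :=
  terminates (Scan P set0).

End Algorithm.

End Projective.

(* Main.v *)
(* Let C be the open convex cone over the lift of Omega. All polyhedra that occur have
   faces projecting to triangles with disjoint interiors: at the start because a side of
   an ideal triangle cannot enter another one, and later because flips preserve this.
   So if a, b, c and a, b, v are adjacent faces, then c and v lie on different sides of
   the plane spanned by a and b, and strict convexity gives v + y c = z a + x b with
   x, y, z > 0; the flip is admissible if and only if z + x < 1 + y. This has two
   consequences.

   The set of points lying under the polyhedron (in the union of the tetrahedra spanned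
   by the origin and the faces) decreases. The centroid of each face therefore remains
   under the initial polyhedron, hence up to the action of Gamma in one of finitely many
   tetrahedra. Its three vertices are then bounded, and as the set of light-cone
   representatives is discrete, only finitely many classes of faces can ever occur.

   The sum over all face classes of the volumes of these tetrahedra decreases strictly,
   once one knows that the two faces are not equivalent under Gamma: an element mapping
   one to the other would act like a rotation about one of their common vertices, which
   is impossible. Hence there are only finitely many flips.

   Discreteness of the orbit of a light-cone vector v follows from discreteness of Gamma
   and from the parabolic element fixing v: if M v is bounded and M moves the interior
   points deep towards v, then too many conjugates by M of powers of the parabolic
   element move a given interior point by a bounded amount. *)

Require Import Defs.
From mathcomp Require Import all_boot all_order all_algebra perm.
From mathcomp Require Import all_classical all_reals all_analysis.
From mathcomp Require Import ring lra.

Set Implicit Arguments.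
Unset Strict Implicit.
Unset Printing Implicit Defensive.

Local Open Scope classical_set_scope.
Local Open Scope ring_scope.

(** Termination is proved for an abstract [cone_system]: a cone [C], a set [B] of vectors on its
    boundary, and a functional [f], positive on both, that plays the role of a norm. Apart from the
    meaning of [below], topology enters this part only as openness along lines, and overlap of faces
    only as a common ray of the open cones over them. Two obstacles shape the argument. Volumes are
    arbitrary reals, so a strict decrease alone does not bound the number of flips; but among
    finitely many possible face classes the volume depends only on which ones are present, so no set
    of classes can come back. And a flip replaces classes rather than single faces: if the two old
    faces were equivalent, the total could fail to drop and translates of the new faces could
    overlap; [flip_class_neq] excludes both. Discreteness is used for interior points, through
    bounded matrices, and for light-cone vectors, through parabolic elements. The latter also shows
    that [B] has a single vector on each of its rays: an element rescaling such a vector would give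
    a sequence in its orbit that tends to 0. *)

Section Det3.
Variable R : realType.
Notation V := 'cV[R]_3.
Implicit Types (a b c x y : V) (f : 'rV[R]_3).

Definition i0 : 'I_3 := @Ordinal 3 0 isT.
Definition i1 : 'I_3 := @Ordinal 3 1 isT.
Definition i2 : 'I_3 := @Ordinal 3 2 isT.

Lemma ord3P (P : 'I_3 -> Prop) : P i0 -> P i1 -> P i2 -> forall i, P i.
Proof.
move=> P0 P1 P2 [[|[|[|//]]] h].
- by rewrite (_ : Ordinal h = i0) //; apply: val_inj.
- by rewrite (_ : Ordinal h = i1) //; apply: val_inj.
- by rewrite (_ : Ordinal h = i2) //; apply: val_inj.
Qed.

Lemma vec3P x y :
  x i0 0 = y i0 0 -> x i1 0 = y i1 0 -> x i2 0 = y i2 0 -> x = y.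
Proof.
by move=> h0 h1 h2; apply/matrixP => i j; rewrite ord1; move: i; apply: ord3P.
Qed.

Lemma sum3E (F : 'I_3 -> R) : \sum_i F i = F i0 + F i1 + F i2.
Proof.
rewrite !big_ord_recl big_ord0 addr0 addrA.
by congr (F _ + F _ + F _); apply: val_inj.
Qed.

Lemma pairingD f x y : pairing f (x + y) = pairing f x + pairing f y.
Proof. by rewrite /pairing mulmxDr mxE. Qed.

Lemma pairingZ f s x : pairing f (s *: x) = s * pairing f x.
Proof. by rewrite /pairing -scalemxAr mxE. Qed.

Lemma pairingN f x : pairing f (- x) = - pairing f x.
Proof. by rewrite /pairing mulmxN mxE. Qed.

Lemma pairingE f x : pairing f x = f 0 i0 * x i0 0 + f 0 i1 * x i1 0 + f 0 i2 * x i2 0.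
Proof. by rewrite /pairing mxE sum3E. Qed.

Definition det3 a b c : R :=
  a i0 0 * (b i1 0 * c i2 0 - b i2 0 * c i1 0)
  - a i1 0 * (b i0 0 * c i2 0 - b i2 0 * c i0 0)
  + a i2 0 * (b i0 0 * c i1 0 - b i1 0 * c i0 0).

Definition cols a b c : 'M[R]_3 :=
  \matrix_(i, j) (if j == i0 then a else if j == i1 then b else c) i 0.

Lemma det3E (A : 'M[R]_3) : \det A =
  A i0 i0 * (A i1 i1 * A i2 i2 - A i2 i1 * A i1 i2)
  - A i1 i0 * (A i0 i1 * A i2 i2 - A i2 i1 * A i0 i2)
  + A i2 i0 * (A i0 i1 * A i1 i2 - A i1 i1 * A i0 i2).
Proof.
rewrite (expand_det_col _ i0) sum3E /cofactor.
rewrite !(expand_det_col _ 0) !big_ord_recl !big_ord0 /cofactor !det_mx11 !mxE.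
have e01 : lift i0 (0 : 'I_2) = i1 by exact: val_inj.
have e02 : lift i0 (lift (0 : 'I_2) (0 : 'I_1)) = i2 by exact: val_inj.
have e10 : lift i1 (0 : 'I_2) = i0 by exact: val_inj.
have e12 : lift i1 (lift (0 : 'I_2) (0 : 'I_1)) = i2 by exact: val_inj.
have e20 : lift i2 (0 : 'I_2) = i0 by exact: val_inj.
have e21 : lift i2 (lift (0 : 'I_2) (0 : 'I_1)) = i1 by exact: val_inj.
have l1 : lift (lift (0 : 'I_2) (0 : 'I_1)) (0 : 'I_1) = 0 by exact: val_inj.
rewrite ?l1 ?e01 ?e02 ?e10 ?e12 ?e20 ?e21.
rewrite /= /bump /= ?(addn0, add0n, addn1) !expr0 !exprS !expr0; ring.
Qed.

Lemma det_cols a b c : \det (cols a b c) = det3 a b c.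
Proof. by rewrite det3E /det3 !mxE /=; ring. Qed.

Lemma mulmx_cols (A : 'M[R]_3) a b c :
  A *m cols a b c = cols (A *m a) (A *m b) (A *m c).
Proof.
apply/matrixP => i j; rewrite !mxE; case: ifP => [/eqP->|j0].
  by rewrite mxE; apply: eq_bigr => k _; rewrite mxE.
case: ifP => [/eqP->|j1].
  by rewrite mxE; apply: eq_bigr => k _; rewrite mxE.
by rewrite mxE; apply: eq_bigr => k _; rewrite mxE j0 j1.
Qed.

Lemma det3_mulmx (A : 'M[R]_3) a b c :
  det3 (A *m a) (A *m b) (A *m c) = \det A * det3 a b c.
Proof. by rewrite -!det_cols -mulmx_cols det_mulmx. Qed.

Lemma det3_comb a b c s t u : det3 a b (s *: a + t *: b + u *: c) = u * det3 a b c.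
Proof. by rewrite /det3 !mxE; ring. Qed.

Lemma det3_acb a b c : det3 a c b = - det3 a b c.
Proof. by rewrite /det3; ring. Qed.

Lemma det3_bac a b c : det3 b a c = - det3 a b c.
Proof. by rewrite /det3; ring. Qed.

Lemma det3_bca a b c : det3 b c a = det3 a b c.
Proof. by rewrite /det3; ring. Qed.

Lemma cramer a b c x : det3 a b c != 0 ->
  exists s t u, x = s *: a + t *: b + u *: c.
Proof.
move=> d0; exists (det3 x b c / det3 a b c), (det3 a x c / det3 a b c),
  (det3 a b x / det3 a b c).
by apply: vec3P; rewrite !mxE; move: d0; rewrite /det3 => d0; field.
Qed.

Lemma coord_inj a b c s t u s' t' u' : det3 a b c != 0 ->
  s *: a + t *: b + u *: c = s' *: a + t' *: b + u' *: c ->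
  [/\ s = s', t = t' & u = u'].
Proof.
move=> d0 h; split; apply: (mulIf d0).
- transitivity (det3 (s *: a + t *: b + u *: c) b c).
    by rewrite /det3 !mxE; ring.
  by rewrite h /det3 !mxE; ring.
- transitivity (det3 a (s *: a + t *: b + u *: c) c).
    by rewrite /det3 !mxE; ring.
  by rewrite h /det3 !mxE; ring.
- by rewrite -(det3_comb a b c s t) h det3_comb.
Qed.

Lemma det3_eq0 a b c : det3 a b c = 0 ->
  exists s t u, (s != 0) || (t != 0) || (u != 0) /\ s *: a + t *: b + u *: c = 0.
Proof.
rewrite -det_cols -det_tr => /eqP/det0P[w w0 h].
exists (w 0 i0), (w 0 i1), (w 0 i2); split.
  apply: contraNT w0; rewrite !negb_or !negbK => /andP[/andP[/eqP e0 /eqP e1] /eqP e2].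
  by apply/eqP/matrixP => i j; rewrite ord1 mxE; move: j; apply: ord3P.
apply/matrixP => i j; rewrite ord1 !mxE.
have := congr1 (fun M : 'rV_3 => M 0 i) h; rewrite !mxE sum3E !mxE /=; move=> <-.
ring.
Qed.

End Det3.

Ltac vring := apply: vec3P; rewrite !mxE; ring.
Ltac vfield := apply: vec3P; rewrite !mxE; field.

(** Faces are vertex sets, so facts about ordered triples have to be carried through the six
    orderings. *)
Lemma set3P (T : Type) (a b c a' b' c' : T) : a <> b -> b <> c -> a <> c ->
  [set a; b; c] = [set a'; b'; c'] ->
  [\/ [/\ a = a', b = b' & c = c'], [/\ a = a', b = c' & c = b'],
      [/\ a = b', b = a' & c = c'] |
   [\/ [/\ a = b', b = c' & c = a'], [/\ a = c', b = a' & c = b'] |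
      [/\ a = c', b = b' & c = a']]].
Proof.
move=> ab bc ac e.
have : [set a'; b'; c'] a by rewrite -e; left; left.
have : [set a'; b'; c'] b by rewrite -e; left; right.
have : [set a'; b'; c'] c by rewrite -e; right.
move=> [[]|] /= hc [[]|] /= hb [[]|] /= ha; subst; try by exfalso.
- by apply: Or44; apply: Or33.
- by apply: Or44; apply: Or31.
- by apply: Or44; apply: Or32.
- by apply: Or42.
- by apply: Or43.
- by apply: Or41.
Qed.

(** * Open triangular cones *)

Section OpenCones.
Variable R : realType.
Notation V := 'cV[R]_3.
Implicit Types (a b c x y w : V) (F : set V).

Definition ocone a b c w : Prop :=
  exists s t u, [/\ 0 < s, 0 < t, 0 < u & w = s *: a + t *: b + u *: c].

Lemma ocone_bac a b c w : ocone a b c w -> ocone b a c w.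
Proof. by move=> [s [t [u [? ? ? ->]]]]; exists t, s, u; split=> //; vring. Qed.

Lemma ocone_acb a b c w : ocone a b c w -> ocone a c b w.
Proof. by move=> [s [t [u [? ? ? ->]]]]; exists s, u, t; split=> //; vring. Qed.

(** The quantifier over orderings makes the open cone a function of the vertex set; by [fcone3] any
    ordering of distinct vertices serves. *)
Definition fcone F w : Prop := exists a b c, F = [set a; b; c] /\ ocone a b c w.

Lemma fcone3 a b c w : a <> b -> b <> c -> a <> c ->
  fcone [set a; b; c] w <-> ocone a b c w.
Proof.
move=> ab bc ac; split=> [[a' [b' [c' [e h]]]]|h]; last by exists a, b, c.
case: (set3P ab bc ac e) => [[-> -> ->]|[-> -> ->]|[-> -> ->]|] //.
- exact: ocone_acb.
- exact: ocone_bac.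
- case=> [[-> -> ->]|[-> -> ->]|[-> -> ->]].
  + exact/ocone_acb/ocone_bac.
  + exact/ocone_bac/ocone_acb.
  + exact/ocone_bac/ocone_acb/ocone_bac.
Qed.

(* Openness along lines is all the topology needed for open cones. *)
Definition line_open (W : set V) : Prop :=
  forall x, W x -> forall y, exists2 e, 0 < e & forall s, `|s| <= e -> W (x + s *: y).

Lemma line_openI (W W' : set V) : line_open W -> line_open W' -> line_open (W `&` W').
Proof.
move=> h h' x [Wx W'x] y.
have [e e0 he] := h x Wx y; have [e' e'0 he'] := h' x W'x y.
exists (Num.min e e') => [|s]; first by rewrite lt_min e0.
by rewrite le_min => /andP[s1 s2]; split; [exact: he|exact: he'].
Qed.

Lemma line_open_preimage (M : 'M[R]_3) (W : set V) :
  line_open W -> line_open [set y | W (M *m y)].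
Proof.
move=> h x Wx y; have [e e0 he] := h _ Wx (M *m y).
by exists e => // s /he; rewrite /= mulmxDr -scalemxAr.
Qed.

Lemma ocone_open a b c : det3 a b c != 0 -> line_open (ocone a b c).
Proof.
move=> d0 _ [s [t [u [s0 t0 u0 ->]]]] y.
have [p [q [r ->]]] := cramer y d0.
(* [m] is the least coordinate of the point and [n] exceeds the coordinates of the direction, so a
   step of length at most [m / n / 2] changes each coordinate by at most [m / 2]. *)
pose m := Num.min s (Num.min t u); pose n := 1 + `|p| + `|q| + `|r|.
have n0 : 0 < n by rewrite /n; have := normr_ge0 p; have := normr_ge0 q; have := normr_ge0 r; lra.
have m0 : 0 < m by rewrite /m !lt_min s0 t0.
have key (z k : R) : `|z| <= m / n / 2 -> `|k| <= n -> `|z * k| < m.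
  move=> hz hk; rewrite normrM.
  have : `|z| * `|k| <= m / n / 2 * n by apply: ler_pM.
  suff -> : m / n / 2 * n = m / 2 by lra.
  by field; rewrite gt_eqF.
exists (m / n / 2); first by rewrite !divr_gt0.
move=> z hz; exists (s + z * p), (t + z * q), (u + z * r).
have ms : m <= s by rewrite /m ge_min lexx.
have mt : m <= t by rewrite /m !ge_min lexx orbT.
have mu : m <= u by rewrite /m !ge_min lexx !orbT.
have hp : `|p| <= n by rewrite /n; have := normr_ge0 q; have := normr_ge0 r; lra.
have hq : `|q| <= n by rewrite /n; have := normr_ge0 p; have := normr_ge0 r; lra.
have hr : `|r| <= n by rewrite /n; have := normr_ge0 p; have := normr_ge0 q; lra.
have := key _ _ hz hp; have := key _ _ hz hq; have := key _ _ hz hr.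
rewrite !ltr_norml => /andP[k1 _] /andP[k2 _] /andP[k3 _].
by split; [lra|lra|lra|vring].
Qed.

Definition act (M : 'M[R]_3) F : set V := [set M *m x | x in F].

Lemma act_set3 M a b c : act M [set a; b; c] = [set M *m a; M *m b; M *m c].
Proof. by rewrite /act !image_setU !image_set1. Qed.

Lemma act1 F : act 1%:M F = F.
Proof.
rewrite eqEsubset; split=> [_ [x Fx <-]|x Fx]; first by rewrite mul1mx.
by exists x => //; rewrite mul1mx.
Qed.

Lemma act_act M N F : act M (act N F) = act (M *m N) F.
Proof.
rewrite eqEsubset; split=> [_ [_ [x Fx <-] <-]|_ [x Fx <-]].
  by exists x => //; rewrite mulmxA.
by exists (N *m x); [exists x|rewrite mulmxA].
Qed.

Lemma ocone_act (M : 'M[R]_3) a b c w :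
  ocone a b c w -> ocone (M *m a) (M *m b) (M *m c) (M *m w).
Proof.
move=> [s [t [u [? ? ? ->]]]]; exists s, t, u; split=> //.
by rewrite !mulmxDr -!scalemxAr.
Qed.

Lemma fcone_act M F w : fcone F w -> fcone (act M F) (M *m w).
Proof.
move=> [a [b [c [-> h]]]]; exists (M *m a), (M *m b), (M *m c).
by split; [exact: act_set3|exact: ocone_act].
Qed.

(* Six times the volume of the tetrahedron spanned by the origin and a triangle. *)
Definition vol F : R :=
  xget 0 [set d | exists a b c, F = [set a; b; c] /\ d = `|det3 a b c| ].

Lemma vol3 a b c : a <> b -> b <> c -> a <> c ->
  vol [set a; b; c] = `|det3 a b c|.
Proof.
move=> ab bc ac; rewrite /vol; case: xgetP => [d dE [a' [b' [c' [e ->]]]]|/(_ `|det3 a b c|)].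
  case: (set3P ab bc ac e) => [[-> -> ->]|[-> -> ->]|[-> -> ->]|] //.
  - by rewrite [in RHS]det3_acb normrN.
  - by rewrite [in RHS]det3_bac normrN.
  - case=> [[-> -> ->]|[-> -> ->]|[-> -> ->]].
    + by rewrite [in RHS]det3_bca.
    + by rewrite [in LHS]det3_bca.
    + by rewrite [in RHS]det3_bca [in RHS]det3_acb normrN.
by case; exists a, b, c.
Qed.

Lemma vol_ge0 F : 0 <= vol F.
Proof.
by rewrite /vol; case: xgetP => [d dE [a [b [c [_ ->]]]]|] //; rewrite dE.
Qed.

End OpenCones.

(** * Classes of faces under the group *)

Section ClassOf.
Variables (R : realType) (G : set 'M[R]_3).
Hypothesis G_sub : subgroup_SL3 G.
Implicit Types F : set 'cV[R]_3.

Lemma Gdet M : G M -> \det M = 1. Proof. by case: G_sub => h _ _ _ /h. Qed.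
Lemma G1 : G 1%:M. Proof. by case: G_sub. Qed.
Lemma GM M N : G M -> G N -> G (M *m N). Proof. by case: G_sub => _ _ h _; exact: h. Qed.
Lemma GV M : G M -> G (invmx M). Proof. by case: G_sub => _ _ _ h; exact: h. Qed.

Lemma Gunit M : G M -> M \in unitmx.
Proof. by move=> /Gdet d; rewrite unitmxE d unitr1. Qed.

Lemma GK M : G M -> invmx M *m M = 1%:M. Proof. by move=> /Gunit; exact: mulVmx. Qed.
Lemma GVK M : G M -> M *m invmx M = 1%:M. Proof. by move=> /Gunit; exact: mulmxV. Qed.

Lemma GVKv M (x : 'cV_3) : G M -> M *m (invmx M *m x) = x.
Proof. by move=> MG; rewrite mulmxA GVK // mul1mx. Qed.

Lemma GKv M (x : 'cV_3) : G M -> invmx M *m (M *m x) = x.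
Proof. by move=> MG; rewrite mulmxA GK // mul1mx. Qed.

Lemma G_neq M (x y : 'cV_3) : G M -> x <> y -> M *m x <> M *m y.
Proof. by move=> hM n e; apply: n; rewrite -(GKv x hM) e GKv. Qed.

Lemma class_ofP F F' : class_of G F F' <-> exists2 M, G M & F' = act M F.
Proof. by split=> [[M MG <-]|[M MG ->]]; exists M. Qed.

Lemma class_of_refl F : class_of G F F.
Proof. by apply/class_ofP; exists 1%:M; [exact: G1|rewrite act1]. Qed.

Lemma class_of_act M F : G M -> class_of G (act M F) = class_of G F.
Proof.
move=> hM; rewrite eqEsubset; split=> F' /class_ofP[N hN ->]; apply/class_ofP.
  by exists (N *m M); [exact: GM|rewrite act_act].
exists (N *m invmx M); first exact: GM _ (GV _).
by rewrite act_act -mulmxA GK // mulmx1.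
Qed.

Lemma class_of_eqP F F' : class_of G F = class_of G F' <-> class_of G F F'.
Proof.
split=> [->|/class_ofP[M hM ->]]; first exact: class_of_refl.
by rewrite class_of_act.
Qed.

Lemma parabolic_conj (M N : 'M[R]_3) : G M -> parabolic N -> parabolic (M *m N *m invmx M).
Proof.
move=> MG [h hu ->]; exists (M *m h); first by rewrite unitmx_mul hu Gunit.
have e : (M *m h) *m (invmx h *m invmx M) = 1%:M.
  by rewrite mulmxA mulmxK // mulmxV // Gunit.
have -> : invmx (M *m h) = invmx h *m invmx M.
  have u : M *m h \in unitmx by rewrite unitmx_mul hu Gunit.
  by rewrite -[RHS](mulKmx u) e mulmx1.
by rewrite !mulmxA.
Qed.

End ClassOf.

(** * Cones with extreme vectors *)

(** The interface between the geometry of the domain and the combinatorics of flips. [cs_Bext] and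
    [cs_BB] are convexity and strict convexity read on vectors; with [cs_BnC], [cs_BB] also keeps
    two vectors of [B] from lying on one ray. [cs_support] is a supporting line at each parabolic
    point. *)
Record cone_system (R : realType) (G : set 'M[R]_3) (C : set 'cV[R]_3)
    (f : 'rV[R]_3) (B : set 'cV[R]_3) : Prop := ConeSystem {
  cs_sub : subgroup_SL3 G;
  cs_add : forall x y, C x -> C y -> C (x + y);
  cs_scale : forall s x, 0 < s -> C x -> C (s *: x);
  cs_pos : forall x, C x -> 0 < pairing f x;
  cs_act : forall M x, G M -> C x -> C (M *m x);
  cs_free : forall M x, G M -> C x -> M *m x = x -> M = 1%:M;
  cs_Bpos : forall b, B b -> 0 < pairing f b;
  cs_BnC : forall b, B b -> ~ C b;
  cs_Bext : forall x b, C x -> B b -> C (x + b);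
  cs_BB : forall a b, B a -> B b -> a <> b -> C (a + b);
  cs_Bact : forall M b, G M -> B b -> B (M *m b);
  cs_support : forall b, B b ->
    exists h : 'rV[R]_3, pairing h b = 0 /\ forall x, C x -> 0 < pairing h x
}.

(** Allows [B] to be cut down to the vertices of the initial polyhedron, which form finitely many
    orbits. *)
Lemma cone_system_sub (R : realType) (G : set 'M[R]_3) C f (B B' : set 'cV[R]_3) :
  B' `<=` B -> (forall M b, G M -> B' b -> B' (M *m b)) ->
  cone_system G C f B -> cone_system G C f B'.
Proof.
move=> sB aB' [h1 h2 h3 h4 h5 h6 h7 h8 h9 h10 h11 h12]; split=> //.
- by move=> b /sB; exact: h7.
- by move=> b /sB; exact: h8.
- by move=> x b Cx /sB; exact: h9.
- by move=> a b /sB Ba /sB; exact: h10.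
- by move=> b /sB; exact: h12.
Qed.

Section ConeSystem.
Variables (R : realType) (G : set 'M[R]_3) (C : set 'cV[R]_3) (f : 'rV[R]_3).
Variable B : set 'cV[R]_3.
Hypothesis CS : cone_system G C f B.
Notation V := 'cV[R]_3.
Implicit Types (a b c v w x y : V) (F : set V) (P : polyhedron R) (s t u : R).

Let Gs := cs_sub CS.

Lemma C_ext x b s : C x -> B b -> 0 <= s -> C (x + s *: b).
Proof.
move=> Cx Bb; rewrite le_eqVlt => /orP[/eqP <-|s0]; first by rewrite scale0r addr0.
have -> : x + s *: b = s *: (s^-1 *: x + b).
  by rewrite scalerDr scalerA divff ?scale1r// gt_eqF.
by apply: (cs_scale CS) => //; apply: (cs_Bext CS) => //; apply: (cs_scale CS) => //; rewrite invr_gt0.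
Qed.

Lemma C_pair a b s t : B a -> B b -> a <> b -> 0 < s -> 0 < t -> C (s *: a + t *: b).
Proof.
move=> Ba Bb ab s0 t0; have Cab := cs_BB CS Ba Bb ab.
have [st|ts] := lerP s t.
  have -> : s *: a + t *: b = s *: (a + b) + (t - s) *: b by vring.
  by apply: C_ext; [exact: (cs_scale CS)|by []|lra].
have -> : s *: a + t *: b = t *: (a + b) + (s - t) *: a by vring.
by apply: C_ext; [exact: (cs_scale CS)|by []|lra].
Qed.

Lemma B_notC b s : B b -> 0 < s -> ~ C (s *: b).
Proof.
move=> Bb s0 Cb; apply: (cs_BnC CS Bb).
have -> : b = s^-1 *: (s *: b) by rewrite scalerA mulVf ?scale1r// gt_eqF.
by apply: (cs_scale CS) => //; rewrite invr_gt0.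
Qed.

Lemma B_ray_notC b s : B b -> C (s *: b) -> False.
Proof.
move=> Bb Csb; apply: (B_notC Bb _ Csb).
have := cs_pos CS Csb; rewrite pairingZ => h.
by move: h; rewrite pmulr_lgt0 //; exact: (cs_Bpos CS).
Qed.

Lemma B_noprop a b t : B a -> B b -> a <> b -> b <> t *: a.
Proof.
move=> Ba Bb ab e; apply: (B_ray_notC (s := 1 + t) Ba).
by rewrite scalerDl scale1r -e; exact: (cs_BB CS).
Qed.

Lemma B_norel a b c s t u : B a -> B b -> B c -> a <> b -> b <> c -> a <> c ->
  0 < s -> 0 <= t -> 0 <= u -> s *: a = t *: b + u *: c -> False.
Proof.
move=> Ba Bb Bc ab bc ac s0 t0 u0 e.
have sV : s != 0 by rewrite gt_eqF.
have [t1|t1] : t = 0 \/ 0 < t by move: t0; rewrite le_eqVlt => /orP[/eqP|]; auto.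
  move: e; rewrite t1 scale0r add0r => e.
  apply: (B_noprop (t := s^-1 * u) Bc Ba); first by auto.
  by rewrite -scalerA -e scalerA mulVf // scale1r.
have [u1|u1] : u = 0 \/ 0 < u by move: u0; rewrite le_eqVlt => /orP[/eqP|]; auto.
  move: e; rewrite u1 scale0r addr0 => e.
  apply: (B_noprop (t := s^-1 * t) Bb Ba); first by auto.
  by rewrite -scalerA -e scalerA mulVf // scale1r.
by apply: (B_ray_notC (s := s) Ba); rewrite e; exact: C_pair.
Qed.

(** Up to a global sign, a linear relation has at most one negative coefficient. With none, [f] is
    positive on the combination; with one, a vector of [B] is a nonnegative combination of the other
    two, against [B_norel]. Geometrically, no three parabolic points are collinear. *)
Lemma B_indep a b c : B a -> B b -> B c -> a <> b -> b <> c -> a <> c ->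
  det3 a b c != 0.
Proof.
move=> Ba Bb Bc ab bc ac; apply/eqP => /det3_eq0[s [t [u [n0 e]]]].
have ga := cs_Bpos CS Ba; have gb := cs_Bpos CS Bb; have gc := cs_Bpos CS Bc.
have nonneg s' t' u' : (s' != 0) || (t' != 0) || (u' != 0) ->
    s' *: a + t' *: b + u' *: c = 0 -> 0 <= s' -> 0 <= t' -> 0 <= u' -> False.
  move=> n0' e' s0 t0 u0.
  have h : s' * pairing f a + t' * pairing f b + u' * pairing f c = 0.
    by rewrite -!pairingZ -!pairingD e' pairingE !mxE; ring.
  have h1 := mulr_ge0 s0 (ltW ga); have h2 := mulr_ge0 t0 (ltW gb).
  have h3 := mulr_ge0 u0 (ltW gc).
  have /eqP : s' * pairing f a = 0 by lra.
  have /eqP : t' * pairing f b = 0 by lra.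
  have /eqP : u' * pairing f c = 0 by lra.
  rewrite !mulf_eq0 !(gt_eqF ga, gt_eqF gb, gt_eqF gc) !orbF => /eqP u1 /eqP t1 /eqP s1.
  by move: n0'; rewrite u1 t1 s1 eqxx.
have oneneg s' t' u' : (s' != 0) || (t' != 0) || (u' != 0) ->
    s' *: a + t' *: b + u' *: c = 0 ->
    [\/ 0 <= s' /\ 0 <= t', 0 <= t' /\ 0 <= u' | 0 <= s' /\ 0 <= u'] -> False.
  move=> n0' e' [] [h1 h2].
  - have [u0|u0] := lerP 0 u'; first exact: nonneg e' _ _ _.
    apply: (@B_norel c a b (- u') s' t') => //; [by auto|by auto|by rewrite oppr_gt0|].
    by rewrite scaleNr; apply/eqP; rewrite eq_sym -subr_eq0 opprK e'.
  - have [s0|s0] := lerP 0 s'; first exact: nonneg e' _ _ _.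
    apply: (@B_norel a b c (- s') t' u') => //; [by rewrite oppr_gt0|].
    by rewrite scaleNr; apply/eqP; rewrite eq_sym -subr_eq0 opprK addrC addrA e'.
  - have [t0|t0] := lerP 0 t'; first exact: nonneg e' _ _ _.
    apply: (@B_norel b a c (- t') s' u') => //; [by auto|by rewrite oppr_gt0|].
    by rewrite scaleNr; apply/eqP; rewrite eq_sym -subr_eq0 opprK addrAC e'.
have n0N : (- s != 0) || (- t != 0) || (- u != 0) by rewrite !oppr_eq0.
have eN : (- s) *: a + (- t) *: b + (- u) *: c = 0.
  by rewrite !scaleNr -!opprD e oppr0.
have [s0|s0] := lerP 0 s; have [t0|t0] := lerP 0 t; have [u0|u0] := lerP 0 u.
- by apply: (oneneg _ _ _ n0 e); apply: Or31.
- by apply: (oneneg _ _ _ n0 e); apply: Or31.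
- by apply: (oneneg _ _ _ n0 e); apply: Or33.
- by apply: (oneneg _ _ _ n0N eN); apply: Or32; rewrite !oppr_ge0 !ltW.
- by apply: (oneneg _ _ _ n0 e); apply: Or32.
- by apply: (oneneg _ _ _ n0N eN); apply: Or33; rewrite !oppr_ge0 !ltW.
- by apply: (oneneg _ _ _ n0N eN); apply: Or31; rewrite !oppr_ge0 !ltW.
- by apply: (oneneg _ _ _ n0N eN); apply: Or31; rewrite !oppr_ge0 !ltW.
Qed.

Lemma ocone_C a b c w : B a -> B b -> B c -> a <> b -> ocone a b c w -> C w.
Proof.
move=> Ba Bb Bc ab [s [t [u [s0 t0 u0 ->]]]].
by apply: C_ext => //; [exact: C_pair|exact: ltW].
Qed.

(** The invariant of the run. [tr_disj] expresses disjointness of interiors after radial projection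
    through a common ray, the form in which flips are shown to preserve it. *)
Record triangulation P : Prop := Triangulation {
  tr_face : forall F, P F -> exists a b c,
    [/\ [/\ B a, B b & B c], [/\ a <> b, b <> c & a <> c] & F = [set a; b; c]];
  tr_act : forall M F, G M -> P F -> P (act M F);
  tr_disj : forall F F' w, P F -> P F' -> fcone F w -> fcone F' w -> F = F'
}.

Lemma vertices_perm a b c a' b' c' : B a' -> B b' -> B c' ->
  a' <> b' -> b' <> c' -> a' <> c' -> [set a'; b'; c'] = [set a; b; c] ->
  [/\ B a, B b & B c] /\ [/\ a <> b, b <> c & a <> c].
Proof.
move=> Ba Bb Bc ab bc ac e.
by case: (set3P ab bc ac e) => [[<- <- <-]|[<- <- <-]|[<- <- <-]|[]] //;
  do ?(by split; split; auto); case=> <- <- <-; split; split; auto.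
Qed.

Lemma faceP P a b c : triangulation P -> P [set a; b; c] ->
  [/\ B a, B b & B c] /\ [/\ a <> b, b <> c & a <> c].
Proof.
move=> tP /(tr_face tP)[a' [b' [c' [[Ba Bb Bc] [ab bc ac] e]]]].
by apply: (vertices_perm Ba Bb Bc ab bc ac); rewrite e.
Qed.

Lemma fcone_open P F : triangulation P -> P F -> line_open (fcone F).
Proof.
move=> tP /(tr_face tP)[a [b [c [[Ba Bb Bc] [ab bc ac] ->]]]] x.
rewrite fcone3 // => /(ocone_open (B_indep Ba Bb Bc ab bc ac)) h y.
by have [e e0 he] := h y; exists e => // s /he; rewrite fcone3.
Qed.

(** An element permuting the vertices fixes their sum, which lies in [C], where the action is
    free. *)
Lemma stab_face M a b c : G M -> B a -> B b -> B c -> a <> b -> b <> c -> a <> c ->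
  act M [set a; b; c] = [set a; b; c] -> M = 1%:M.
Proof.
move=> MG Ba Bb Bc ab bc ac; rewrite act_set3 => e.
apply: (@cs_free _ _ _ _ _ CS M (a + b + c)) => //.
  by apply: (cs_Bext CS) => //; exact: (cs_BB CS).
rewrite !mulmxDr.
have := set3P ab bc ac (esym e).
by case=> [[<- <- <-]|[<- <- <-]|[<- <- <-]|[[<- <- <-]|[<- <- <-]|[<- <- <-]]];
  vring.
Qed.

End ConeSystem.

(** * Edge flips *)

Lemma continuous_pairing (R : realType) (h : 'rV[R]_3) : continuous (@pairing R h).
Proof.
have -> : @pairing R h = (fun x => h 0 i0 * x i0 0 + h 0 i1 * x i1 0 + h 0 i2 * x i2 0).
  by apply/funext => x; rewrite pairingE.
have cc i : continuous (fun x : 'cV[R]_3 => x i 0) by exact: coord_continuous.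
have ccZ (k : R) i : continuous (fun x : 'cV[R]_3 => k * x i 0).
  by move=> x; exact: (cvgM (@cvg_cst _ k _ (nbhs x) _) (cc i x)).
by move=> x; apply: (cvgD (cvgD (ccZ _ _ x) (ccZ _ _ x)) (ccZ _ _ x)).
Qed.

(** Write the plane as [h = d]. The function [h / d] is 0 at the origin and [s + t + u] at [v]; on a
    connected set that joins them and avoids the plane it cannot pass the value 1. *)
Lemma below_lt1 (R : realType) (a b c v : 'cV[R]_3) s t u :
  det3 a b c != 0 -> v = s *: a + t *: b + u *: c ->
  below [set a; b; c] v -> s + t + u < 1.
Proof.
move=> d0 vE [X [[h [d [h0 XE]]] sX]]; rewrite /connected_component.
case=> S [S0 SX cS] Sv.
have ha : pairing h a = d by have : X a by [apply: sX; left; left]; rewrite XE.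
have hb : pairing h b = d by have : X b by [apply: sX; left; right]; rewrite XE.
have hc : pairing h c = d by have : X c by [apply: sX; right]; rewrite XE.
have h00 : pairing h 0 = 0 by rewrite pairingE !mxE; ring.
have dn0 : d != 0.
  apply/eqP => d00; have := SX _ S0; rewrite XE /= h00 d00; exact.
have hv : pairing h v = (s + t + u) * d.
  by rewrite vE !pairingD !pairingZ ha hb hc; ring.
rewrite ltNge; apply/negP => h1.
have cI : connected ([set pairing h x / d | x in S]).
  apply: connected_continuous_connected => //.
  apply: continuous_subspaceT => x.
  exact: (cvgM (@continuous_pairing _ h x) (@cvg_cst _ d^-1 _ (nbhs x) _)).
have : [set pairing h x / d | x in S] 1.
  move/connected_intervalP: cI => /(_ 0 (s + t + u)); apply.
  - by exists 0 => //; rewrite h00 mul0r.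
  - by exists v => //; rewrite hv mulfK.
  - by rewrite ler01.
case=> x Sx /(congr1 (fun z => z * d)); rewrite divfK // mul1r => hx.
by have := SX _ Sx; rewrite XE /= hx; exact.
Qed.

Section Flip.
Variables (R : realType) (G : set 'M[R]_3) (C : set 'cV[R]_3) (f : 'rV[R]_3).
Variable B : set 'cV[R]_3.
Hypothesis CS : cone_system G C f B.
Notation V := 'cV[R]_3.
Implicit Types (a b c v w x y : V) (F : set V) (P : polyhedron R) (s t u : R).

Let Gs := cs_sub CS.

Definition under P : set V := [set x | exists a b c s t u,
  [/\ P [set a; b; c], [/\ 0 <= s, 0 <= t & 0 <= u], s + t + u <= 1 &
      x = s *: a + t *: b + u *: c]].

Lemma under_act M P w : triangulation G B P -> G M -> under P w -> under P (M *m w).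
Proof.
move=> tP MG [a1 [b1 [c1 [s [t [u [PF s0 st ->]]]]]]].
exists (M *m a1), (M *m b1), (M *m c1), s, t, u; split=> //.
  by rewrite -act_set3; exact: (tr_act tP).
by rewrite !mulmxDr -!scalemxAr.
Qed.

(* a, b, c and a, b, v are adjacent faces, and the segment between c and v
   crosses the one between a and b, at (v + y c) / (1 + y). *)
Record flippable P a b c v (x y z : R) : Prop := Flippable {
  fl_tr : triangulation G B P;
  fl_c : P [set a; b; c];
  fl_v : P [set a; b; v];
  fl_cv : c <> v;
  fl_x : 0 < x; fl_y : 0 < y; fl_z : 0 < z;
  fl_lt : z + x < 1 + y;
  fl_E : v = z *: a + x *: b - y *: c
}.

(** The coordinate of [v] along [c] is negative, since otherwise the two faces would overlap or
    [a, b, v] would be dependent. Then [z a + x b = v + y c] lies in [C], and if [z] or [x] were not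
    positive, adding a multiple of [a] or [b] would put a ray of [B] into [C]. *)
Lemma flippableP P a b c v : triangulation G B P ->
  neighbouring_vertex P a b c v -> below [set a; b; c] v ->
  exists x y z : R, flippable P a b c v x y z.
Proof.
move=> tP [uq Pc Pv] bel.
have [[Ba Bb Bc] [ab bc ac]] := faceP tP Pc.
have [[_ _ Bv] [_ bv av]] := faceP tP Pv.
have cv : c <> v by move: uq; rewrite /= !inE !negb_or => /and4P[_ _ /eqP].
have d0 := B_indep CS Ba Bb Bc ab bc ac.
have [z [x [w vE]]] := cramer v d0.
have lt1 := below_lt1 d0 vE bel.
have wlt : w < 0.
  rewrite ltNge; apply/negP; rewrite le_eqVlt => /orP[/eqP w0|w0].
    have /eqP := B_indep CS Ba Bb Bv ab bv av; apply.
    by rewrite vE -w0 det3_comb mul0r.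
  (* Adding large multiples of [a] and [b] to [v] gives a point close to the common edge, which has
     positive coordinates with respect to both faces. *)
  pose n := `|z| + `|x| + 1.
  have nz : 0 < n + z by have := ler_norm (- z); rewrite normrN /n; have := normr_ge0 x; lra.
  have nx : 0 < n + x by have := ler_norm (- x); rewrite normrN /n; have := normr_ge0 z; lra.
  have n0 : 0 < n by rewrite /n; have := normr_ge0 x; have := normr_ge0 z; lra.
  have e : [set a; b; c] = [set a; b; v].
    apply: (tr_disj tP (w := n *: a + n *: b + 1 *: v)) => //.
      apply/fcone3 => //; exists (n + z), (n + x), w; split=> //.
      by rewrite vE; vring.
    by apply/fcone3 => //; exists n, n, 1.
  have : [set a; b; v] c by rewrite -e; right.
  by move=> [[]|] /= h; [apply: ac|apply: bc|apply: cv].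
pose y := - w.
have y0 : 0 < y by rewrite oppr_gt0.
have vE' : v = z *: a + x *: b - y *: c by rewrite vE /y; vring.
have Cm : C (z *: a + x *: b).
  have -> : z *: a + x *: b = 1 *: v + y *: c by rewrite vE'; vring.
  by apply: (C_pair CS) => //; auto.
have z0 : 0 < z.
  rewrite ltNge; apply/negP => z0; apply: (B_ray_notC CS (b := b) (s := x)) => //.
  have -> : x *: b = (z *: a + x *: b) + (- z) *: a by vring.
  by apply: (C_ext CS) => //; rewrite oppr_ge0.
have x0 : 0 < x.
  rewrite ltNge; apply/negP => x0; apply: (B_ray_notC CS (b := a) (s := z)) => //.
  have -> : z *: a = (z *: a + x *: b) + (- x) *: b by vring.
  by apply: (C_ext CS) => //; rewrite oppr_ge0.
by exists x, y, z; split=> //; rewrite /y; lra.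
Qed.

Section Flippable.
Variables (P : polyhedron R) (a b c v : V) (x y z : R).
Hypothesis FL : flippable P a b c v x y z.

Let tP := fl_tr FL.
Let x0 := fl_x FL.
Let y0 := fl_y FL.
Let z0 := fl_z FL.
Let xN : x != 0. Proof. by rewrite gt_eqF. Qed.
Let yN : y != 0. Proof. by rewrite gt_eqF. Qed.
Let vE := fl_E FL.
Let Pc := fl_c FL.
Let Pv := fl_v FL.
Let Ba : B a. Proof. by have [[]] := faceP tP Pc. Qed.
Let Bb : B b. Proof. by have [[]] := faceP tP Pc. Qed.
Let Bc : B c. Proof. by have [[]] := faceP tP Pc. Qed.
Let Bv : B v. Proof. by have [[]] := faceP tP Pv. Qed.
Let ab : a <> b. Proof. by have [_ []] := faceP tP Pc. Qed.
Let bc : b <> c. Proof. by have [_ []] := faceP tP Pc. Qed.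
Let ac : a <> c. Proof. by have [_ []] := faceP tP Pc. Qed.
Let av : a <> v. Proof. by have [_ []] := faceP tP Pv. Qed.
Let bv : b <> v. Proof. by have [_ []] := faceP tP Pv. Qed.
Let cv := fl_cv FL.
Let ca : c <> a := nesym ac.
Let cb : c <> b := nesym bc.
Let va : v <> a := nesym av.
Let vb : v <> b := nesym bv.

(** In units of the tetrahedron over [a, b, c], the old volumes are 1 and [y], the new ones [x] and
    [z]; hence [fl_lt] is exactly the decrease of volume. *)
Lemma flip_vol_v : vol [set a; b; v] = y * vol [set a; b; c].
Proof.
rewrite !vol3 // -(gtr0_norm y0) -normrM -normrN; congr `| _ |.
by rewrite vE /det3 !mxE; ring.
Qed.

Lemma flip_vol_cva : vol [set c; v; a] = x * vol [set a; b; c].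
Proof.
rewrite !vol3 // -{1}(gtr0_norm x0) -normrM -normrN; congr `| _ |.
by rewrite vE /det3 !mxE; ring.
Qed.

Lemma flip_vol_cbv : vol [set c; b; v] = z * vol [set a; b; c].
Proof.
rewrite !vol3 // -{1}(gtr0_norm z0) -normrM -normrN; congr `| _ |.
by rewrite vE /det3 !mxE; ring.
Qed.

Lemma flip_vol_gt0 : 0 < vol [set a; b; c].
Proof. by rewrite vol3 // normr_gt0; exact: (B_indep CS). Qed.

(* If M maps the first face to the second one, then M fixes b (say) and moves c to
   a and a to v; the values of a support functional at b along the orbit of c
   under M then form a positive sequence with u (n+2) = z u (n+1) - u n and
   0 < z < 2, but such a sequence is concave with increments tending to -oo. *)
Lemma no_positive_oscillation (q : R) (w : nat -> R) : q < 2 ->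
  (forall n, 0 < w n) -> (forall n, w n.+2 = q * w n.+1 - w n) -> False.
Proof.
move=> q2 w0 wE.
pose d n := w n.+1 - w n.
have dE n : d n.+1 = d n - (2 - q) * w n.+1 by rewrite /d wE; ring.
have dS n : d n.+1 <= d n.
  rewrite dE; have := mulr_ge0 (_ : 0 <= 2 - q) (ltW (w0 n.+1)).
  by move=> /(_ (ltW _)); rewrite subr_gt0 => /(_ q2); lra.
have dmono n m : d (n + m)%N <= d n.
  by elim: m => [|m IH]; rewrite ?addn0 // addnS; exact: le_trans (dS _) IH.
have d_ge0 n : 0 <= d n.
  rewrite leNgt; apply/negP => dn.
  have wn m : w (n + m)%N <= w n + m%:R * d n.
    elim: m => [|m IH]; first by rewrite addn0 mul0r addr0.
    have h : w (n + m).+1 - w (n + m)%N <= d n := dmono n m.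
    by rewrite addnS -natr1 mulrDl mul1r; lra.
  have [m hm] : exists m : nat, w n / - d n < m%:R.
    exists (Num.truncn (w n / - d n)).+1; exact: Num.Theory.truncnS_gt.
  move: hm; rewrite ltr_pdivrMr ?oppr_gt0 // => hm.
  by have := wn m; have := w0 (n + m)%N; lra.
have w_ge n : w 0%N <= w n.
  elim: n => // n IH; apply: le_trans IH _.
  by have := d_ge0 n; rewrite /d subr_ge0.
have dn n : d n <= d 0%N - n%:R * ((2 - q) * w 0%N).
  elim: n => [|n IH]; first by rewrite mul0r subr0.
  rewrite dE -[n.+1%:R]natr1 (mulrDl n%:R) mul1r.
  have : (2 - q) * w 0%N <= (2 - q) * w n.+1 by rewrite ler_pM2l // subr_gt0.
  lra.
have k0 : 0 < (2 - q) * w 0%N by rewrite mulr_gt0 // subr_gt0.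
have [m hm] : exists m : nat, d 0%N / ((2 - q) * w 0%N) < m%:R.
  exists (Num.truncn (d 0%N / ((2 - q) * w 0%N))).+1; exact: Num.Theory.truncnS_gt.
move: hm; rewrite ltr_pdivrMr // => hm.
by have := dn m; have := d_ge0 m; lra.
Qed.

Lemma support_pos_B (h : 'rV[R]_3) e e' : B e -> B e' -> e <> e' -> pairing h e = 0 ->
  (forall w, C w -> 0 < pairing h w) -> 0 < pairing h e'.
Proof.
move=> Be Be' ee' he hC.
by have := hC _ (cs_BB CS Be Be' ee'); rewrite pairingD he add0r.
Qed.

Lemma no_rotation M e e' e'' (p q : R) : G M -> B e -> B e' -> e <> e' ->
  M *m e = e -> M *m e' = e'' ->
  M *m e'' = q *: e'' + p *: e - e' -> q < 2 -> False.
Proof.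
move=> MG Be Be' ee' Me Me' Me'' q2.
have [h [he hC]] := cs_support CS Be.
pose o := fix o n := if n is n'.+1 then M *m (o n') else e'.
have Bo n : B (o n).
  by elim: n => //= n IH; exact: (cs_Bact CS).
have oe n : e <> o n.
  elim: n => //= n IH en; apply: IH.
  by rewrite -(GKv Gs e MG) Me en (GKv Gs _ MG).
apply: (@no_positive_oscillation q (fun n => pairing h (o n)) q2) => n.
  exact: (support_pos_B Be _ _ he hC).
have -> : o n.+2 = q *: o n.+1 + p *: e - o n.
  elim: n => [|n IH]; first by rewrite /= Me' Me''.
  have -> : o n.+3 = M *m o n.+2 by [].
  rewrite [in LHS]IH mulmxBr mulmxDr -!scalemxAr Me.
  by [].
by rewrite !pairingD pairingN !pairingZ he; ring.
Qed.

(** An element [M] identifying the faces matches their vertices in one of six ways. It preserves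
    determinants, and those of the two faces have opposite signs, so the matching is odd. Exchanging
    [a] and [b] would fix [a + b], in [C]. The other two fix [a] or [b] and force [y = 1]; then
    [fl_lt] makes [x] and [z] smaller than 2, as [no_rotation] requires. *)
Lemma flip_class_neq : class_of G [set a; b; c] <> class_of G [set a; b; v].
Proof.
move=> /(class_of_eqP Gs)/class_ofP[M MG]; rewrite act_set3 => e.
have d0 := B_indep CS Ba Bb Bc ab bc ac.
have dv : det3 a b v = - y * det3 a b c by rewrite vE /det3 !mxE; ring.
have dM : det3 (M *m a) (M *m b) (M *m c) = det3 a b c.
  by rewrite det3_mulmx (Gdet Gs MG) mul1r.
have yp (k : R) : k * det3 a b c = det3 a b c -> k = 1.
  by move=> h; apply: (mulIf d0); rewrite mul1r.
have lt := fl_lt FL; have px := x0; have pz := z0.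
case: (set3P ab bv av e) => [[h1 h2 h3]|[h1 h2 h3]|[h1 h2 h3]|[[h1 h2 h3]|[h1 h2 h3]|[h1 h2 h3]]];
  rewrite -h1 -h2 -h3 in dM.
- have /yp : - y * det3 a b c = det3 a b c by rewrite -[RHS]dM vE /det3 !mxE; ring.
  by have := y0; lra.
- have /yp y1 : y * det3 a b c = det3 a b c by rewrite -[RHS]dM vE /det3 !mxE; ring.
  apply: (@no_rotation M a c b z x) => //; rewrite -?h1 -?h2 -?h3 //.
  + by rewrite vE y1; vring.
  + by rewrite y1 in lt; lra.
- have M1 : M = 1%:M.
    apply: (cs_free CS MG (cs_BB CS Ba Bb ab)).
    by rewrite mulmxDr -h1 -h2 addrC.
  by apply: ab; rewrite h1 M1 mul1mx.
- have /yp : - y * det3 a b c = det3 a b c by rewrite -[RHS]dM vE /det3 !mxE; ring.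
  by have := y0; lra.
- have /yp : - y * det3 a b c = det3 a b c by rewrite -[RHS]dM vE /det3 !mxE; ring.
  by have := y0; lra.
- have /yp y1 : y * det3 a b c = det3 a b c by rewrite -[RHS]dM vE /det3 !mxE; ring.
  apply: (@no_rotation M b c a x z) => //; rewrite -?h1 -?h2 -?h3 //.
  + by rewrite vE y1; vring.
  + by rewrite y1 in lt; lra.
Qed.

Let P' := edge_flip G P a b c v.

(** A point under a new face is rewritten over an old one by eliminating [v] or [c] through [fl_E];
    the sign of [s - t y] tells on which side of the plane of [a, b] it lies, hence which. By
    [fl_lt] the sum of the coordinates does not grow. *)
Lemma flip_under w : under P' w -> under P w.
Proof.
have lt := fl_lt FL.
have flip1 s t u : 0 <= s -> 0 <= t -> 0 <= u -> s + t + u <= 1 ->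
    under P (s *: c + t *: v + u *: a).
  move=> s1 t1 u1 st; have [le|le] := lerP (t * y) s.
    exists a, b, c, (u + t * z), (t * x), (s - t * y); split=> //.
    - by split; rewrite ?subr_ge0 // ?addr_ge0 // ?mulr_ge0 // ltW.
    - have : t * (z + x) <= t * (1 + y) by rewrite ler_wpM2l // ltW.
      lra.
    - by rewrite vE; vring.
  have sy : 0 <= s / y by rewrite divr_ge0 // ltW.
  exists a, b, v, (u + s / y * z), (s / y * x), (t - s / y); split=> //.
  - split; first by rewrite addr_ge0 // mulr_ge0 // ltW.
      by rewrite mulr_ge0 // ltW.
    by rewrite subr_ge0 ler_pdivrMr // ltW.
  - have h : s / y * (z + x) <= s / y * (1 + y) by rewrite ler_wpM2l // ltW.
    have e : s / y * y = s by rewrite divfK.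
    lra.
  - rewrite vE; move: yN => yN'; vfield; exact: yN'.
have flip2 s t u : 0 <= s -> 0 <= t -> 0 <= u -> s + t + u <= 1 ->
    under P (s *: c + t *: v + u *: b).
  move=> s1 t1 u1 st; have [le|le] := lerP (t * y) s.
    exists a, b, c, (t * z), (u + t * x), (s - t * y); split=> //.
    - by split; rewrite ?subr_ge0 // ?addr_ge0 // ?mulr_ge0 // ltW.
    - have : t * (z + x) <= t * (1 + y) by rewrite ler_wpM2l // ltW.
      lra.
    - by rewrite vE; vring.
  have sy : 0 <= s / y by rewrite divr_ge0 // ltW.
  exists a, b, v, (s / y * z), (u + s / y * x), (t - s / y); split=> //.
  - split; first by rewrite mulr_ge0 // ltW.
      by rewrite addr_ge0 // mulr_ge0 // ltW.
    by rewrite subr_ge0 ler_pdivrMr // ltW.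
  - have h : s / y * (z + x) <= s / y * (1 + y) by rewrite ler_wpM2l // ltW.
    have e : s / y * y = s by rewrite divfK.
    lra.
  - rewrite vE; move: yN => yN'; vfield; exact: yN'.
have perm a1 b1 c1 a2 b2 c2 s t u : a1 <> b1 -> b1 <> c1 -> a1 <> c1 ->
    [set a1; b1; c1] = [set a2; b2; c2] ->
    (forall s t u, 0 <= s -> 0 <= t -> 0 <= u -> s + t + u <= 1 ->
      under P (s *: a1 + t *: b1 + u *: c1)) ->
    0 <= s -> 0 <= t -> 0 <= u -> s + t + u <= 1 ->
    under P (s *: a2 + t *: b2 + u *: c2).
  move=> n1 n2 n3 e H s1 t1 u1 st.
  case: (set3P n1 n2 n3 e) => [[<- <- <-]|[<- <- <-]|[<- <- <-]|[[<- <- <-]|[<- <- <-]|[<- <- <-]]].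
  - exact: H.
  - have -> : s *: a1 + t *: c1 + u *: b1 = s *: a1 + u *: b1 + t *: c1 by vring.
    by apply: H => //; lra.
  - have -> : s *: b1 + t *: a1 + u *: c1 = t *: a1 + s *: b1 + u *: c1 by vring.
    by apply: H => //; lra.
  - have -> : s *: c1 + t *: a1 + u *: b1 = t *: a1 + u *: b1 + s *: c1 by vring.
    by apply: H => //; lra.
  - have -> : s *: b1 + t *: c1 + u *: a1 = u *: a1 + s *: b1 + t *: c1 by vring.
    by apply: H => //; lra.
  - have -> : s *: c1 + t *: b1 + u *: a1 = u *: a1 + t *: b1 + s *: c1 by vring.
    by apply: H => //; lra.
case=> a1 [b1 [c1 [s [t [u [PF [s0 t0 u0] st ->]]]]]].
case: PF => [[PF _]|]; first by exists a1, b1, c1, s, t, u.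
have back M : G M -> under P (s *: (invmx M *m a1) + t *: (invmx M *m b1) + u *: (invmx M *m c1)) ->
    under P (s *: a1 + t *: b1 + u *: c1).
  move=> MG /(under_act tP MG); rewrite !mulmxDr -!scalemxAr.
  by rewrite !(GVKv Gs).
case=> /class_ofP[M MG e]; apply: (back M MG).
  have e' : [set c; v; a] = [set invmx M *m a1; invmx M *m b1; invmx M *m c1].
    by rewrite -act_set3 e act_act (GK Gs) // act1.
  exact: (perm _ _ _ _ _ _ _ _ _ cv va ca e' flip1).
have e' : [set c; b; v] = [set invmx M *m a1; invmx M *m b1; invmx M *m c1].
  by rewrite -act_set3 e act_act (GK Gs) // act1.
apply: (perm _ _ _ _ _ _ _ _ _ cb bv cv e') => // s' t' u' s1 t1 u1 st1.
have -> : s' *: c + t' *: b + u' *: v = s' *: c + u' *: v + t' *: b by vring.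
by apply: flip2 => //; lra.
Qed.

(** The open cone over the quadrilateral with diagonals [a b] and [c v], cut along the first one. *)
Let quad w := [\/ ocone a b c w, ocone a b v w |
  exists s t, [/\ 0 < s, 0 < t & w = s *: a + t *: b]].

Let quad_cva w : ocone c v a w -> quad w.
Proof.
move=> [s [t [u [s0 t0 u0 ->]]]]; have [lt|lt|eq] := ltrgtP (t * y) s.
- apply: Or31; exists (u + t * z), (t * x), (s - t * y); split.
  + by rewrite addr_gt0 // mulr_gt0.
  + by rewrite mulr_gt0.
  + by rewrite subr_gt0.
  + by rewrite vE; vring.
- apply: Or32; exists (u + s / y * z), (s / y * x), (t - s / y); split.
  + by rewrite addr_gt0 // mulr_gt0 // divr_gt0.
  + by rewrite mulr_gt0 // divr_gt0.
  + by rewrite subr_gt0 ltr_pdivrMr.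
  + rewrite vE; move: yN => yN'; vfield; exact: yN'.
- apply: Or33; exists (u + t * z), (t * x); split.
  + by rewrite addr_gt0 // mulr_gt0.
  + by rewrite mulr_gt0.
  + by rewrite vE -eq; vring.
Qed.

Let quad_cbv w : ocone c b v w -> quad w.
Proof.
move=> [s [u [t [s0 u0 t0 ->]]]]; have [lt|lt|eq] := ltrgtP (t * y) s.
- apply: Or31; exists (t * z), (u + t * x), (s - t * y); split.
  + by rewrite mulr_gt0.
  + by rewrite addr_gt0 // mulr_gt0.
  + by rewrite subr_gt0.
  + by rewrite vE; vring.
- apply: Or32; exists (s / y * z), (u + s / y * x), (t - s / y); split.
  + by rewrite mulr_gt0 // divr_gt0.
  + by rewrite addr_gt0 // mulr_gt0 // divr_gt0.
  + by rewrite subr_gt0 ltr_pdivrMr.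
  + rewrite vE; move: yN => yN'; vfield; exact: yN'.
- apply: Or33; exists (t * z), (u + t * x); split.
  + by rewrite mulr_gt0.
  + by rewrite addr_gt0 // mulr_gt0.
  + by rewrite vE -eq; vring.
Qed.

(** A point over the diagonal is pushed towards [c], into the open cone over an old face. So an
    overlap involving a new face always yields one involving an old face. *)
Let quad_open (W : set V) w : line_open W -> quad w -> W w ->
  exists w', W w' /\ (ocone a b c w' \/ ocone a b v w').
Proof.
move=> oW [h|h|[s [t [s0 t0 wE]]]] Ww; first by exists w; auto.
  by exists w; auto.
have [e e0 he] := oW w Ww c.
exists (w + e *: c); split; first by apply: he; rewrite ger0_norm // ltW.
by left; exists s, t, e; rewrite wE.
Qed.

Let newface F := F = [set c; v; a] \/ F = [set c; b; v].

Let newface_quad F w : newface F -> fcone F w -> quad w.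
Proof. by case=> -> /fcone3 h; [apply: quad_cva|apply: quad_cbv]; apply: h. Qed.

Let oldface F := F = [set a; b; c] \/ F = [set a; b; v].

Let quad_oldface (W : set V) w : line_open W -> quad w -> W w ->
  exists w' F, [/\ W w', oldface F & fcone F w'].
Proof.
move=> oW Qw Ww; have [w' [Ww' [h|h]]] := quad_open oW Qw Ww.
  by exists w', [set a; b; c]; split=> //; [left|apply/fcone3].
by exists w', [set a; b; v]; split=> //; [right|apply/fcone3].
Qed.

Let oldface_P F : oldface F -> P F. Proof. by case=> ->. Qed.

Let newface_open F M : G M -> newface F -> line_open (fcone (act M F)).
Proof.
move=> MG nF; have h : exists a b c,
    [/\ [/\ B a, B b & B c], [/\ a <> b, b <> c & a <> c] & F = [set a; b; c]].
  by case: nF => ->; [exists c, v, a|exists c, b, v].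
have [a1 [b1 [c1 [[B1 B2 B3] [n1 n2 n3] ->]]]] := h.
have inj := G_neq Gs MG.
rewrite act_set3 => w; rewrite fcone3; [|exact: inj..].
have Bm := cs_Bact CS MG.
move/(ocone_open (B_indep CS (Bm _ B1) (Bm _ B2) (Bm _ B3) (inj _ _ n1) (inj _ _ n2) (inj _ _ n3))).
by move=> ho u; have [e e0 he] := ho u; exists e => // s /he; rewrite fcone3 //; exact: inj.
Qed.

(** Pulled back by [M], the overlap becomes one with an old face, so the surviving face would belong
    to a removed class. *)
Let old_new F N M w : P F -> ~ class_of G [set a; b; c] F ->
  ~ class_of G [set a; b; v] F -> G M -> newface N ->
  fcone F w -> fcone (act M N) w -> False.
Proof.
move=> PF nc nv MG nN Fw Nw.
have GMi := GV Gs MG.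
have F1 : P (act (invmx M) F) by exact: (tr_act tP).
have := fcone_act (invmx M) Nw; rewrite act_act (GK Gs) // act1.
move=> /(newface_quad nN) qw.
have [w' [F' [W' oF' F'w']]] := quad_oldface (fcone_open CS tP F1) qw (fcone_act (invmx M) Fw).
have e := tr_disj tP F1 (oldface_P oF') W' F'w'.
have {}e : F = act M F' by rewrite -e act_act (GVK Gs) // act1.
by case: oF' => h; rewrite h in e; [apply: nc|apply: nv]; apply/class_ofP; exists M.
Qed.

Let cva_cbv w : ocone c v a w -> ocone c b v w -> False.
Proof.
move=> [s [t [u [s0 t0 u0 ->]]]] [s' [t' [u' [s'0 t'0 u'0 e]]]].
have d0 := B_indep CS Bc Bv Ba cv va ca.
have {}e : s *: c + t *: v + u *: a =
    (s' + t' * y / x) *: c + (u' + t' / x) *: v + (- (t' * z / x)) *: a.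
  by rewrite e vE; move: xN => xN'; vfield; exact: xN'.
have [_ _ ue] := coord_inj d0 e.
have : 0 < t' * z / x by rewrite divr_gt0 // mulr_gt0.
lra.
Qed.

(** Two successive perturbations produce a common ray of an old face and of the image by [K] of an
    old face. Since the two old classes differ, [K] stabilises one face and is the identity; what
    remains is that the two new faces themselves do not overlap. *)
Let new_new N N' M M' w : G M -> G M' -> newface N -> newface N' ->
  fcone (act M N) w -> fcone (act M' N') w -> act M N = act M' N'.
Proof.
move=> MG GM' nN nN' Nw N'w.
pose K := invmx M' *m M.
have KG : G K by apply: (GM Gs) => //; exact: (GV Gs).
pose w1 := invmx M' *m w.
have N1 : fcone (act K N) w1.
  by have := fcone_act (invmx M') Nw; rewrite act_act.
have N2 : fcone N' w1.
  by have := fcone_act (invmx M') N'w; rewrite act_act (GK Gs) // act1.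
have oW : line_open (fcone (act K N) `&` fcone N').
  apply: line_openI; first exact: newface_open.
  by have := newface_open (G1 Gs) nN'; rewrite act1.
have [w2 [F [[W2 W2'] oF Fw2]]] := quad_oldface oW (newface_quad nN' N2) (conj N1 N2).
have q2 : quad (invmx K *m w2).
  apply: (newface_quad nN).
  by have := fcone_act (invmx K) W2; rewrite act_act (GK Gs) // act1.
have oW2 : line_open [set y | fcone F (K *m y)].
  exact: line_open_preimage (fcone_open CS tP (oldface_P oF)).
have Fw2' : fcone F (K *m (invmx K *m w2)) by rewrite (GVKv Gs).
have [w3 [F' [W3 oF' F'w3]]] := quad_oldface oW2 q2 Fw2'.
have e : act K F' = F.
  apply: (tr_disj tP _ (oldface_P oF) (fcone_act K F'w3) W3).
  by apply: (tr_act tP) => //; exact: oldface_P.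
have FF' : F' = F.
  have cE : class_of G F' = class_of G F by rewrite -e (class_of_act Gs).
  by case: oF oF' cE => -> [] -> // /esym cE; exfalso; apply: flip_class_neq.
have K1 : K = 1%:M.
  move: e; rewrite FF'.
  by case: oF => ->; apply: (stab_face CS).
have MM : M = M'.
  by rewrite -[M]mul1mx -(GVK Gs GM') -mulmxA -/K K1 mulmx1.
rewrite MM; congr act.
rewrite K1 act1 in N1.
case: nN nN' N1 N2 => -> [] -> // /fcone3 h1 /fcone3 h2; exfalso.
  by apply: (@cva_cbv w1); [apply: h1|apply: h2].
by apply: (@cva_cbv w1); [apply: h2|apply: h1].
Qed.

Lemma flip_triangulation : triangulation G B P'.
Proof.
have newP F : P' F -> (P F /\ ~ class_of G [set a; b; c] F /\ ~ class_of G [set a; b; v] F)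
    \/ exists M N, [/\ G M, newface N & F = act M N].
  case=> [[PF nF]|[|] /class_ofP[M MG ->]].
  - by left; split=> //; split=> h; apply: nF; [left|right].
  - by right; exists M, [set c; v; a]; split=> //; left.
  - by right; exists M, [set c; b; v]; split=> //; right.
split.
- move=> F /newP[[PF _]|[M [N [MG nN ->]]]]; first exact: (tr_face tP).
  have Bm := cs_Bact CS MG.
  have inj := G_neq Gs MG.
  case: nN => ->; rewrite act_set3.
    by exists (M *m c), (M *m v), (M *m a); split=> //; split; auto.
  by exists (M *m c), (M *m b), (M *m v); split=> //; split; auto.
- move=> M F MG [[PF nF]|nF].
    left; split; first exact: (tr_act tP).
    move=> [|] /(class_of_eqP Gs); rewrite (class_of_act Gs) // => /(class_of_eqP Gs) h;
      by apply: nF; first [by left|by right].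
  right; case: nF => /(class_of_eqP Gs) h; [left|right]; apply/(class_of_eqP Gs);
    by rewrite (class_of_act Gs).
- move=> F F' w /newP[[PF [n1 n2]]|[M [N [MG nN ->]]]] /newP[[PF' [n1' n2']]|[M' [N' [GM' nN' ->]]]].
  + exact: (tr_disj tP).
  + by move=> h1 h2; exfalso; exact: (old_new PF n1 n2 GM' nN' h1 h2).
  + by move=> h1 h2; exfalso; exact: (old_new PF' n1' n2' MG nN h2 h1).
  + exact: new_new.
Qed.

End Flippable.
End Flip.

(** * Termination *)

Lemma terminates_Acc (R : realType) (G : set 'M[R]_3) (s : state R) :
  Acc (fun s' s => step G s s') s -> terminates G s.
Proof.
elim=> {}s _ IH run run0 runS.
have [stp|[ret _]] := runS 0%N; last by exists 0%N.
rewrite run0 in stp.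
by have [n rn] := IH _ stp (fun n => run n.+1) erefl (fun n => runS n.+1); exists n.+1.
Qed.

Section Unseen.
Variable T : Type.
Implicit Types (s : seq (set T)) (seen : set (set T)).

(** Counting along a fixed list of classes gives the measure for a scan between two flips and for
    the cleanup. *)
Definition unseen s seen : nat := count (fun k => `[< ~ seen k >]) s.

Lemma unseen_lt s seen k : k \in s -> ~ seen k -> (unseen s (k |` seen) < unseen s seen)%N.
Proof.
rewrite /unseen; elim: s => //= k' s IH; rewrite in_cons => /orP[/eqP <-|ks] nk.
  have -> : `[< ~ (k |` seen) k >] = false by apply/asboolPn; apply; left.
  have -> : `[< ~ seen k >] by apply/asboolP.
  rewrite add0n add1n ltnS; apply: sub_count => z /asboolP nz; apply/asboolP => sz.
  by apply: nz; right.
have h : (`[< ~ (k |` seen) k' >] <= `[< ~ seen k' >])%N.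
  case: (asboolP (~ (k |` seen) k')) => // nz.
  by rewrite (_ : `[< ~ seen k' >]) //; apply/asboolP => sz; apply: nz; right.
by rewrite -addnS leq_add // IH.
Qed.

End Unseen.

Lemma finite_set_bound (R : realType) (T : eqType) (K : set T) (Q : T -> R -> Prop) :
  finite_set K -> (forall k, K k -> exists M, Q k M) ->
  (forall k M M', M <= M' -> Q k M -> Q k M') ->
  exists M, forall k, K k -> Q k M.
Proof.
move=> /finite_seqP[s ->] + mono; elim: s => [|k s IH] ex; first by exists 0.
have [|M hM] := IH; first by move=> k' /= k's; apply: ex; rewrite /= in_cons k's orbT.
have [|M' hM'] := ex k; first by rewrite /= in_cons eqxx.
exists (Num.max M M') => k'; rewrite /= in_cons => /orP[/eqP ->|k's].
  by apply: mono hM'; rewrite le_max lexx orbT.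
by apply: mono (hM _ k's); rewrite le_max lexx.
Qed.

Section Termination.
Variables (R : realType) (G : set 'M[R]_3) (C : set 'cV[R]_3) (f : 'rV[R]_3).
Variable B : set 'cV[R]_3.
Hypothesis CS : cone_system G C f B.
Notation V := 'cV[R]_3.
Implicit Types (a b c v w x y : V) (F : set V) (P : polyhedron R).

Let Gs := cs_sub CS.

Definition face_classes P : set (set (set V)) := [set class_of G F | F in P].

(** Every edge class has a member whose ends are vertices of the representative that [get] picks in
    some face class. *)
Lemma edge_classes_finite P : triangulation G B P -> finite_set (face_classes P) ->
  finite_set [set class_of G e | e in is_edge P].
Proof.
move=> tP fin.
apply: (sub_finite_set (B := \bigcup_(k in face_classes P)
  [set class_of G [set a; b] | a in get k & b in get k])).
  move=> _ [e [a [b [F [ab -> PF sF]]]] <-].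
  exists (class_of G F); first by exists F.
  have : class_of G F (get (class_of G F)).
    by apply: getPex; exists F; exact: (class_of_refl Gs).
  move=> /class_ofP[M MG ->].
  exists (M *m a); first by exists a => //; apply: sF; left.
  exists (M *m b); first by exists b => //; apply: sF; right.
  rewrite -(class_of_act Gs [set a; b] MG).
  by rewrite /act image_setU !image_set1.
apply: bigcup_finite => // _ [F PF <-].
have [M [MG ->]] : exists M, G M /\ get (class_of G F) = act M F.
  have : class_of G F (get (class_of G F)).
    by apply: getPex; exists F; exact: (class_of_refl Gs).
  by move=> /class_ofP[M MG ->]; exists M.
have [a [b [c [_ _ ->]]]] := tr_face tP PF.
by rewrite act_set3; apply: finite_image2; exact: finite_set3.
Qed.

Lemma Acc_return Q : Acc (fun s' s => step G s s') (Return Q).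
Proof. by constructor=> s' st; inversion st. Qed.

(** The cleanup leaves [P] unchanged; each step marks one more of finitely many edge classes or
    returns. *)
Lemma Acc_cleanup P seen removed : triangulation G B P -> finite_set (face_classes P) ->
  Acc (fun s' s => step G s s') (Cleanup P seen removed).
Proof.
move=> tP fin; have /finite_seqP[s sE] := edge_classes_finite tP fin.
have sP e : is_edge P e -> class_of G e \in s.
  by move=> Pe; have : [set` s] (class_of G e) by rewrite -sE; exists e.
have [n] := ubnP (unseen s seen); elim: n seen removed => [|n IH] seen removed; first by rewrite ltn0.
rewrite ltnS => le; constructor=> s' st.
inversion st as [| | |? ? ? e F F' sh ns cp|? ? ? e ie ns h|]; subst; last exact: Acc_return.
- apply: IH; apply: leq_trans le; apply: unseen_lt => //; apply: sP.
  by case: sh.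
- by apply: IH; apply: leq_trans le; apply: unseen_lt => //; apply: sP.
Qed.

Variable P0 : polyhedron R.
Hypothesis tP0 : triangulation G B P0.
Hypothesis finP0 : finite_set (face_classes P0).
Hypothesis finB : forall M : R, finite_set [set b | B b /\ pairing f b <= M].

(** A condition on a single face, satisfied by the faces of every reachable polyhedron; finiteness
    can thus be settled once, before the run. *)
Definition low F : Prop := exists a b c,
  [/\ [/\ B a, B b & B c], [/\ a <> b, b <> c & a <> c],
      F = [set a; b; c] & under P0 (3^-1 *: a + 3^-1 *: b + 3^-1 *: c)].

(* Up to the action of G the centroid of a low face lies in one of finitely many
   tetrahedra; as f is positive on the vertices, they are then bounded too. *)
Lemma low_classes_finite : finite_set (face_classes low).
Proof.
have [M hM] : exists M : R, forall k, face_classes P0 k ->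
    exists2 F, k = class_of G F & forall b, F b -> pairing f b <= M.
  apply: (@finite_set_bound R _ _ (fun k M => exists2 F, k = class_of G F &
    forall b, F b -> pairing f b <= M) finP0).
    move=> _ [F PF <-]; have [a [b [c [_ _ ->]]]] := tr_face tP0 PF.
    exists (Num.max (pairing f a) (Num.max (pairing f b) (pairing f c))).
    exists [set a; b; c] => // e [[]|] -> /=; rewrite !le_max lexx ?orbT //.
  move=> k M M' le [F kE h]; exists F => // b /h; move/le_trans; exact.
(* The functional is at most [M] at the translated centroid, so its values at the three vertices add
   up to at most [3 * M]; being positive, each of them is bounded by it. *)
pose BM := [set b | B b /\ pairing f b <= 3 * M].
have finBM : finite_set BM := finB _.
apply: (sub_finite_set (B := [set class_of G F | F in
  [set [set p.1; p.2.1; p.2.2] | p in BM `*` (BM `*` BM)]])); last first.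
  by apply: finite_image; apply: finite_image; do ?apply: finite_setX.
move=> _ [_ [a [b [c [[Ba Bb Bc] [ab bc ac] -> un]]]] <-].
have [a1 [b1 [c1 [s [t [u [PF [s0 t0 u0] st e]]]]]]] := un.
have [F kE FM] := hM (class_of G [set a1; b1; c1]) (ex_intro2 _ _ _ PF erefl).
have /class_ofP[N GN FE] : class_of G [set a1; b1; c1] F.
  by rewrite kE; exact: (class_of_refl Gs).
exists [set N *m a; N *m b; N *m c]; last first.
  by rewrite -act_set3 (class_of_act Gs).
have fN x : [set a1; b1; c1] x -> pairing f (N *m x) <= M.
  by move=> Fx; apply: FM; rewrite FE; exists x.
have sum : pairing f (N *m a) + pairing f (N *m b) + pairing f (N *m c) <= 3 * M.
  have := congr1 (fun x => pairing f (N *m x)) e.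
  rewrite !mulmxDr -!scalemxAr !pairingD !pairingZ => e'.
  have h1 := fN a1 (or_introl (or_introl erefl)).
  have h2 := fN b1 (or_introl (or_intror erefl)).
  have h3 := fN c1 (or_intror erefl).
  have [[Ba1 _ _] _] := faceP tP0 PF.
  have M0 : 0 <= M by apply: le_trans h1; apply: ltW; apply: (cs_Bpos CS); exact: (cs_Bact CS).
  have k1 := ler_wpM2l s0 h1; have k2 := ler_wpM2l t0 h2; have k3 := ler_wpM2l u0 h3.
  have := ler_wpM2r M0 st; lra.
have pos x : B x -> 0 < pairing f (N *m x).
  by move=> Bx; apply: (cs_Bpos CS); exact: (cs_Bact CS).
have pa := pos _ Ba; have pb := pos _ Bb; have pc := pos _ Bc.
by exists (N *m a, (N *m b, N *m c)) => //=; split; [|split]; (split; [exact: (cs_Bact CS)|lra]).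
Qed.

Definition admissible P := triangulation G B P /\ under P `<=` under P0.

Lemma admissible_low P : admissible P -> P `<=` low.
Proof.
move=> [tP uP] F PF; have [a [b [c [BB nn FE]]]] := tr_face tP PF.
exists a, b, c; split=> //; apply: uP.
exists a, b, c, 3^-1, 3^-1, 3^-1; rewrite -FE.
by split=> //; lra.
Qed.

Lemma admissible_fin P : admissible P -> finite_set (face_classes P).
Proof.
move=> /admissible_low sP; apply: sub_finite_set low_classes_finite.
by move=> _ [F PF <-]; exists F => //; exact: sP.
Qed.

Lemma vol_act M a b c : G M -> a <> b -> b <> c -> a <> c ->
  vol (act M [set a; b; c]) = vol [set a; b; c].
Proof.
move=> MG ab bc ac; rewrite act_set3 !vol3 //; try exact: (G_neq Gs).
by rewrite det3_mulmx (Gdet Gs MG) mul1r.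
Qed.

Lemma vol_class a b c : a <> b -> b <> c -> a <> c ->
  vol (get (class_of G [set a; b; c])) = vol [set a; b; c].
Proof.
move=> ab bc ac; have : class_of G [set a; b; c] (get (class_of G [set a; b; c])).
  by apply: getPex; exists [set a; b; c]; exact: (class_of_refl Gs).
by move=> /class_ofP[M MG ->]; exact: vol_act.
Qed.

Section Scan.
Variable s : seq (set (set V)).
Hypothesis sE : face_classes low = [set` s].
Hypothesis s_uniq : uniq s.
Let n := size s.
Let cls (i : 'I_n) : set (set V) := tnth (in_tuple s) i.
Let wt (i : 'I_n) : R := vol (get (cls i)).

Let code P : {ffun 'I_n -> bool} := [ffun i => `[< face_classes P (cls i) >]].
Let volume (p : {ffun 'I_n -> bool}) : R := \sum_i (p i)%:R * wt i.
(** A natural number replacing the real volume: the number of sets of classes of smaller volume. It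
    drops whenever the volume does. *)
Let rank P : nat := #|[set p | volume p < volume (code P)]%SET|.

Let rank_lt P P' : volume (code P') < volume (code P) -> (rank P' < rank P)%N.
Proof.
move=> lt; apply: proper_card; apply/properP; split.
  by apply/fintype.subsetP => p; rewrite !inE => /lt_trans; apply.
by exists (code P'); rewrite !inE // ltxx.
Qed.

Let cls_ex P F : admissible P -> P F -> exists i, cls i = class_of G F.
Proof.
move=> aP PF; have : [set` s] (class_of G F).
  by rewrite -sE; exists F => //; exact: (admissible_low aP).
by rewrite /= => /(tnthP (in_tuple s))[i ->]; exists i.
Qed.

Let cls_inj : injective cls.
Proof. by apply/tuple_uniqP. Qed.

Let sum_delta (j : 'I_n) : \sum_i (i == j)%:R * wt i = wt j.
Proof.
rewrite (bigD1 j) //= eqxx mul1r big1 ?addr0 // => i /negPf ->.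
by rewrite mul0r.
Qed.

Lemma admissible_flip P a b c v : admissible P ->
  neighbouring_vertex P a b c v -> below [set a; b; c] v ->
  admissible (edge_flip G P a b c v).
Proof.
move=> [tP uP] nv bv; have [x [y [z fl]]] := flippableP CS tP nv bv.
split; first exact: (flip_triangulation CS fl).
by move=> w /(flip_under CS fl); exact: uP.
Qed.

Let volume_flip P a b c v : admissible P ->
  neighbouring_vertex P a b c v -> below [set a; b; c] v ->
  volume (code (edge_flip G P a b c v)) < volume (code P).
Proof.
move=> aP nv bv; have aP' := admissible_flip aP nv bv.
have tP := aP.1.
have [x [y [z fl]]] := flippableP CS tP nv bv.
have [BBc [ab bc ac]] := faceP tP (fl_c fl).
have [BBv [_ bv' av]] := faceP tP (fl_v fl).
have cv := fl_cv fl.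
have P'3 : edge_flip G P a b c v [set c; v; a].
  by right; left; exact: (class_of_refl Gs).
have P'4 : edge_flip G P a b c v [set c; b; v].
  by right; right; exact: (class_of_refl Gs).
have [i1 e1] := cls_ex aP (fl_c fl); have [i2 e2] := cls_ex aP (fl_v fl).
have [i3 e3] := cls_ex aP' P'3; have [i4 e4] := cls_ex aP' P'4.
(* If the two old faces were equivalent, the volume of only one of them would be lost. *)
have i12 : i1 != i2.
  by apply/eqP => e; apply: (flip_class_neq CS fl); rewrite -e1 -e2 e.
have w1 : wt i1 = vol [set a; b; c] by rewrite /wt e1 vol_class.
have w2 : wt i2 = y * vol [set a; b; c].
  by rewrite /wt e2 vol_class // (flip_vol_v fl).
have w3 : wt i3 = x * vol [set a; b; c].
  by rewrite /wt e3 vol_class ?(flip_vol_cva fl) //; auto.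
have w4 : wt i4 = z * vol [set a; b; c].
  by rewrite /wt e4 vol_class ?(flip_vol_cbv fl) //; auto.
have p1 : code P i1 by rewrite ffunE; apply/asboolP; exists [set a; b; c]; [exact: (fl_c fl)|].
have p2 : code P i2 by rewrite ffunE; apply/asboolP; exists [set a; b; v]; [exact: (fl_v fl)|].
have wt0 i : 0 <= wt i by exact: vol_ge0.
(* Only an inequality: the two new classes may coincide with each other or with a class already
   present, and then count once on the left but more than once on the right. *)
have pt i : (code (edge_flip G P a b c v) i)%:R * wt i <=
    (code P i)%:R * wt i - (i == i1)%:R * wt i - (i == i2)%:R * wt i
    + (i == i3)%:R * wt i + (i == i4)%:R * wt i.
  have h := wt0 i.
  have F1 : code (edge_flip G P a b c v) i ->
      [|| i == i3, i == i4 | [&& code P i, i != i1 & i != i2]].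
    rewrite !ffunE => /asboolP[F P'F FE]; case: P'F => [[PF nF]|[] /(class_of_eqP Gs) cF].
    - apply/or3P; apply: Or33; apply/and3P; split.
      + by apply/asboolP; exists F.
      + apply/eqP => ii; apply: nF; left; apply/(class_of_eqP Gs).
        by rewrite -e1 -ii FE.
      + apply/eqP => ii; apply: nF; right; apply/(class_of_eqP Gs).
        by rewrite -e2 -ii FE.
    - by rewrite (_ : i == i3) //; apply/eqP/cls_inj; rewrite e3 cF FE.
    - by rewrite (_ : i == i4) ?orbT //; apply/eqP/cls_inj; rewrite e4 cF FE.
  case: (eqVneq i i1) F1 => [->|n1] F1.
    rewrite p1 (negPf i12); move: F1; rewrite ?eqxx /= ?andbF orbF.
    have := wt0 i1.
    by case: (i1 == i3); case: (i1 == i4); case: (code _ _) => //= h' hh; rewrite ?mul1r ?mul0r; try lra; move: (hh erefl).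
  case: (eqVneq i i2) F1 => [->|n2] F1.
    rewrite p2; move: F1; rewrite ?eqxx /= ?andbF orbF.
    have := wt0 i2.
    by case: (i2 == i3); case: (i2 == i4); case: (code _ _) => //= h' hh; rewrite ?mul1r ?mul0r; try lra; move: (hh erefl).
  move: F1; rewrite ?(negPf n1) ?(negPf n2) /= ?andbT.
  by case: (i == i3); case: (i == i4); case: (code P _); case: (code _ _) => //= hh; rewrite ?mul1r ?mul0r; try lra; move: (hh erefl).
have : volume (code (edge_flip G P a b c v)) <=
    volume (code P) - wt i1 - wt i2 + wt i3 + wt i4.
  rewrite -(sum_delta i1) -(sum_delta i2) -(sum_delta i3) -(sum_delta i4).
  rewrite -!sumrB -!big_split; apply: ler_sum => i _; exact: pt.
have := flip_vol_gt0 CS fl; have := fl_lt fl; rewrite w1 w2 w3 w4.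
set D := vol _ => lt D0.
have : D * (z + x) < D * (1 + y) by rewrite ltr_pM2l.
lra.
Qed.

(** Lexicographic descent: a flip lowers [rank] and resets [seen], while passing over a class lowers
    [unseen]. *)
Lemma Acc_scan P seen : admissible P -> Acc (fun s' s => step G s s') (Scan P seen).
Proof.
have [k] := ubnP (rank P); elim: k P seen => [|k IHk] P seen; first by rewrite ltn0.
rewrite ltnS => rk aP.
have [j] := ubnP (unseen s seen); elim: j seen => [|j IHj] seen; first by rewrite ltn0.
rewrite ltnS => uk.
constructor=> s' st; inversion st as [P1 s1 a b c v nv ns bel|P1 s1 F PF ns nf|P1 s1 all| | |]; subst.
- apply: IHk; last exact: admissible_flip.
  apply: leq_trans rk; apply: rank_lt; exact: volume_flip.
- apply: IHj; apply: leq_trans uk; apply: unseen_lt => //.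
  have : [set` s] (class_of G F); last by [].
  by rewrite -sE; exists F => //; exact: (admissible_low aP).
- apply: Acc_cleanup; [exact: aP.1|exact: admissible_fin].
Qed.

End Scan.

Theorem edge_flipping_terminates : edge_flipping_algorithm_terminates G P0.
Proof.
apply: terminates_Acc.
have /finite_seqP[s sE] := low_classes_finite.
apply: (@Acc_scan (undup s)); last by split.
- by rewrite sE; apply/seteqP; split=> k; rewrite /= mem_undup.
- exact: undup_uniq.
Qed.

End Termination.

(** * The induced polyhedron *)

Section QuotientMap.
Variables (T : topologicalType) (E : T -> T -> Prop).

Lemma quotient_mapP x y :
  quotient_map E x = quotient_map E y <-> clos_refl_sym_trans T E x y.
Proof.
rewrite /quotient_map; split=> [/eqquotP/asboolP //|h].
by apply/eqquotP/asboolP.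
Qed.

Lemma quotient_map_surj (z : quotient_space E) : exists x, quotient_map E x = z.
Proof. by exists (repr z); rewrite /quotient_map reprK. Qed.

Lemma quotient_map_continuous : continuous (quotient_map E).
Proof. exact: pi_continuous. Qed.

End QuotientMap.

Section HomogeneousCoordinates.
Variable R : realType.
Notation V := 'cV[R]_3.
Implicit Types (p q : RP2 R) (u v : V) (s t : R).

Lemma proportionalP (u v : set_type [set w : V | w != 0]) :
  clos_refl_sym_trans _ (@proportional R) u v <-> proportional u v.
Proof.
split=> [h|]; last exact: rst_step.
elim: h => {u v} [u v //|u|u v _ [t t0 e]|u v w _ [s s0 e1] _ [t t0 e2]].
- by exists 1; rewrite ?oner_eq0 // scale1r.
- by exists t^-1; rewrite ?invr_eq0 // e scalerA mulVf // scale1r.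
- by exists (t * s); rewrite ?mulf_neq0 // e2 e1 scalerA.
Qed.

Lemma hcoord_neq0 p v : hcoord p v -> v != 0.
Proof. by case=> w <- _; have := set_valP w. Qed.

Lemma hcoord_ex v : v != 0 -> exists p, hcoord p v.
Proof.
move=> v0; have v0' : v \in [set w : V | w != 0] by rewrite inE.
pose w : set_type [set w : V | w != 0] := exist _ v v0'.
by exists (quotient_map (@proportional R) w), w.
Qed.

Lemma hcoord_surj p : exists v, hcoord p v.
Proof. by have [w <-] := quotient_map_surj p; exists (val w), w. Qed.

Lemma hcoord_prop p u v : hcoord p u -> hcoord p v -> exists2 t, t != 0 & v = t *: u.
Proof.
case=> w <- <- [w' <-] /esym/quotient_mapP/proportionalP[t t0 e].
by exists t.
Qed.

Lemma hcoord_scale p v t : t != 0 -> hcoord p v -> hcoord p (t *: v).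
Proof.
move=> t0 hv; have tv0 : t *: v != 0 by rewrite scaler_eq0 negb_or t0 (hcoord_neq0 hv).
have [q [w wE qE]] := hcoord_ex tv0; exists w => //.
case: hv => w' w'E <-; apply/quotient_mapP/proportionalP.
exists t^-1; rewrite ?invr_eq0 //.
by rewrite wE w'E scalerA mulVf // scale1r.
Qed.

Lemma hcoord_inj p q v : hcoord p v -> hcoord q v -> p = q.
Proof.
case=> w wE <- [w' w'E <-]; congr quotient_map.
by apply: val_inj; rewrite /= wE w'E.
Qed.

End HomogeneousCoordinates.

Lemma subset1_finite (T : Type) (K : set T) :
  (forall i j : T, K i -> K j -> i = j) -> finite_set K.
Proof.
move=> h; have [[i Ki]|n] := pselect (exists i, K i).
  by apply: (sub_finite_set (B := [set i])) (finite_set1 i) => j Kj; exact: h.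
exact: (@sub_finite_set _ K set0 (fun j Kj => n (ex_intro _ j Kj)) (finite_set0 T)).
Qed.

Section InducedPolyhedron.
Variables (R : realType) (G : set 'M[R]_3) (Omega : set (RP2 R)).
Variables (Omp C B : set 'cV[R]_3) (f : 'rV[R]_3).
Variable A : set (set (surface G Omega)).
Hypothesis CS : cone_system G C f B.
Hypothesis G_Omega : preserves G Omega.
Hypothesis C_Omega : forall x, C x -> exists2 p, Omega p & hcoord p x.
Hypothesis B_lightcone : forall b, B b -> lightcone Omp b.
Hypothesis B_boundary : forall p b, B b -> hcoord p b -> boundary Omega p.
Hypothesis lightcone_pos : forall u, lightcone Omp u -> 0 < pairing f u.
Hypothesis A_fin : finite_set A.
Notation V := 'cV[R]_3.
Implicit Types (a b c v w x y : V) (F : set V) (p q r : RP2 R).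
Implicit Types (e : set (surface G Omega)) (X Y : set_type Omega).

Let Gs := cs_sub CS.
Let orb := @same_orbit R G Omega.

Lemma same_orbitP X Y : clos_refl_sym_trans _ orb X Y <->
  exists2 M, G M & exists2 u, hcoord (val X) u & hcoord (val Y) (M *m u).
Proof.
split=> [h|[M MG [u Xu Yu]]]; last by apply: rst_step; exists M => //; exists u.
elim: h => {X Y} [X Y [M MG [u Xu Yu]]|X|X Y _ [M MG [u Xu Yu]]|
    X Y Z _ [M MG [u Xu Yu]] _ [N GN [v Yv Zv]]].
- by exists M => //; exists u.
- exists 1%:M; first exact: (G1 Gs).
  by have [u Xu] := hcoord_surj (val X); exists u => //; rewrite mul1mx.
- exists (invmx M); first exact: (GV Gs).
  by exists (M *m u) => //; rewrite (GKv Gs).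
- exists (N *m M); first exact: (GM Gs).
  exists u => //; have [t t0 vE] := hcoord_prop Yu Yv.
  have -> : N *m M *m u = t^-1 *: (N *m v).
    by rewrite vE -scalemxAr scalerA mulVf // scale1r mulmxA.
  by apply: hcoord_scale => //; rewrite invr_eq0.
Qed.

Definition meets e x : Prop := exists2 X, hcoord (val X) x & e (quotient_map orb X).

Definition in_span a b x : Prop := exists s t, x = s *: a + t *: b.

Lemma meets_line p q a b x : hcoord p a -> hcoord q b -> C x -> in_span a b x ->
  meets (@image_in_surface R G Omega (line p q)) x.
Proof.
move=> pa qb Cx [s [t xE]]; have [r Or rx] := C_Omega Cx.
have Or' : r \in Omega by rewrite inE.
exists (exist _ r Or' : set_type Omega) => //.
exists (exist _ r Or' : set_type Omega) => //=.
by exists a, b, s, t; rewrite -xE.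
Qed.

Lemma line_meets p q a b x : hcoord p a -> hcoord q b ->
  meets (@image_in_surface R G Omega (line p q)) x ->
  exists2 M, G M & in_span a b (M *m x).
Proof.
move=> pa qb [X Xx [Y [u [v [s [t [pu qv Yl]]]]] YX]].
have /quotient_mapP/same_orbitP[M MG [w Xw Yw]] := esym YX; exists M => //.
have [k k0 wE] := hcoord_prop Xw Xx; have [l l0 e] := hcoord_prop Yl Yw.
have [i i0 uE] := hcoord_prop pa pu; have [j j0 vE] := hcoord_prop qb qv.
exists (k * l * s * i), (k * l * t * j).
by rewrite wE -scalemxAr e uE vE; vring.
Qed.

Lemma triangle_meets p q r a b c x e : B a -> B b -> B c -> a <> b ->
  hcoord p a -> hcoord q b -> hcoord r c ->
  @image_in_surface R G Omega (open_triangle Omp p q r) `&` \bigcup_(e in A) e = set0 ->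
  A e -> ocone a b c x -> ~ meets e x.
Proof.
move=> Ba Bb Bc ab pa qb rc disj Ae oc [X Xx eX].
suff : (set0 : set (surface G Omega)) (quotient_map orb X) by [].
rewrite -disj; split; last by exists e.
exists X => //=; case: oc => [s [t [u [s0 t0 u0 xE]]]].
exists a, b, c, s, t, u; split=> //; last by rewrite -xE.
by split; exact: B_lightcone.
Qed.

(** The plane of [a] and [b] lies over the arc [e] within [C] and, up to the group, contains
    everything over [e]. This captures the arc without reference to its points in the surface. *)
Definition side a b e : Prop := (forall x, C x -> in_span a b x -> meets e x) /\
  (forall x, meets e x -> exists2 M, G M & in_span a b (M *m x)).

Record lifted_face a b c : Prop := LiftedFace {
  lf_B : [/\ B a, B b & B c];
  lf_neq : [/\ a <> b, b <> c & a <> c];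
  lf_ab : exists2 e, A e & side a b e;
  lf_bc : exists2 e, A e & side b c e;
  lf_ca : exists2 e, A e & side c a e;
  lf_int : forall x e, A e -> ocone a b c x -> ~ meets e x
}.

Let P := induced_polyhedron Omp B A.

Lemma side_line p q a b : hcoord p a -> hcoord q b ->
  side a b (@image_in_surface R G Omega (line p q)).
Proof.
by move=> pa qb; split=> x; [exact: meets_line|exact: line_meets].
Qed.

Lemma induced_lifted F : P F -> exists a b c, F = [set a; b; c] /\ lifted_face a b c.
Proof.
move=> [p [q [r [a [b [c [[_ [pq qr rp] [A1 A2 A3] disj] [Ba Bb Bc] [pa qb rc] ->]]]]]]].
have ab : a <> b by move=> e; apply: pq; rewrite -e in qb; exact: (hcoord_inj pa qb).
have bc : b <> c by move=> e; apply: qr; rewrite -e in rc; exact: (hcoord_inj qb rc).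
have ac : a <> c by move=> e; apply: rp; rewrite -e in rc; exact: (hcoord_inj rc pa).
exists a, b, c; split=> //; split=> //.
- by eexists; [exact: A1|exact: side_line].
- by eexists; [exact: A2|exact: side_line].
- by eexists; [exact: A3|exact: side_line].
- by move=> x e Ae; exact: (triangle_meets Ba Bb Bc ab pa qb rc disj Ae).
Qed.

Lemma surface_image_moves M (L L' : set (RP2 R)) : G M ->
  (forall p q x, hcoord p x -> hcoord q (M *m x) -> L p <-> L' q) ->
  @image_in_surface R G Omega L = @image_in_surface R G Omega L'.
Proof.
move=> MG LL'; rewrite eqEsubset; split=> _ [X LX <-].
  have [x Xx] := hcoord_surj (val X).
  have Mx0 : M *m x != 0.
    apply/eqP => e; have /eqP := hcoord_neq0 Xx; apply.
    by rewrite -(GKv Gs x MG) e mulmx0.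
  have [q qMx] := hcoord_ex Mx0.
  have Oq : Omega q by apply: (G_Omega MG _ (set_valP X)); exists x.
  have Oq' : q \in Omega by rewrite inE.
  exists (exist _ q Oq' : set_type Omega); first exact/(LL' _ _ _ Xx qMx).
  by apply/esym/quotient_mapP/same_orbitP; exists M => //; exists x.
have [x Xx] := hcoord_surj (val X).
pose y := invmx M *m x.
have y0 : y != 0.
  apply/eqP => e; have /eqP := hcoord_neq0 Xx; apply.
  by rewrite -(GVKv Gs x MG) -/y e mulmx0.
have [q qy] := hcoord_ex y0.
have Oq : Omega q by apply: (G_Omega (GV Gs MG) _ (set_valP X)); exists x.
have Oq' : q \in Omega by rewrite inE.
have Xy : hcoord (val X) (M *m y) by rewrite (GVKv Gs).
exists (exist _ q Oq' : set_type Omega); first exact/(LL' _ _ _ qy Xy).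
by apply/quotient_mapP/same_orbitP; exists M => //; exists y.
Qed.

Lemma line_moves M p q p' q' a b : G M -> hcoord p a -> hcoord q b ->
  hcoord p' (M *m a) -> hcoord q' (M *m b) ->
  @image_in_surface R G Omega (line p q) = @image_in_surface R G Omega (line p' q').
Proof.
move=> MG pa qb pa' qb'; apply: (surface_image_moves MG) => y y' x yx y'x.
split=> [] [u [v [s [t [pu qv yl]]]]].
  have [i i0 uE] := hcoord_prop pa pu; have [j j0 vE] := hcoord_prop qb qv.
  have [k k0 e] := hcoord_prop yl yx.
  exists (M *m a), (M *m b), (k * s * i), (k * t * j); split=> //.
  suff -> : (k * s * i) *: (M *m a) + (k * t * j) *: (M *m b) = M *m x by [].
  by rewrite e uE vE !scalerDr !scalerA mulmxDr -!scalemxAr ?mulrA.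
have [i i0 uE] := hcoord_prop pa' pu; have [j j0 vE] := hcoord_prop qb' qv.
have [k k0 e] := hcoord_prop yl y'x.
exists a, b, (k * s * i), (k * t * j); split=> //.
suff -> : (k * s * i) *: a + (k * t * j) *: b = x by [].
rewrite -[x](GKv Gs _ MG) e uE vE !scalerDr !scalerA mulmxDr -!scalemxAr.
by rewrite !(GKv Gs) // ?mulrA.
Qed.

(** By [lightcone_pos], light-cone vectors over one vertex differ by a positive factor, so only the
    sign of the representative [y] is left undetermined. *)
Lemma open_triangleE p q r a b c (x : RP2 R) y : B a -> B b -> B c ->
  hcoord p a -> hcoord q b -> hcoord r c -> hcoord x y ->
  open_triangle Omp p q r x <-> ocone a b c y \/ ocone a b c (- y).
Proof.
move=> Ba Bb Bc pa qb rc xy.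
have pos u v t : B v -> lightcone Omp u -> u = t *: v -> 0 < t.
  move=> Bv /lightcone_pos + uE; rewrite uE pairingZ pmulr_lgt0 //.
  exact: (cs_Bpos CS).
split=> [[u [v [w [s [t [z [[lu lv lw] [pu qv rw] [s0 t0 z0] xE]]]]]]]|oc].
  have [i _ uE] := hcoord_prop pa pu; have [j _ vE] := hcoord_prop qb qv.
  have [l _ wE] := hcoord_prop rc rw; have [k k0 yE] := hcoord_prop xE xy.
  have i0 := pos _ _ _ Ba lu uE; have j0 := pos _ _ _ Bb lv vE.
  have l0 := pos _ _ _ Bc lw wE.
  move: k0; rewrite neq_lt => /orP[k0|k0]; [right|left].
    exists (- k * s * i), (- k * t * j), (- k * z * l); split; rewrite ?mulr_gt0 ?oppr_gt0 //.
    by rewrite yE uE vE wE; vring.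
  exists (k * s * i), (k * t * j), (k * z * l); split; rewrite ?mulr_gt0 //.
  by rewrite yE uE vE wE; vring.
have {oc} [k [k0 [s [t [u [s0 t0 u0 e]]]]]] : exists k, k != 0 /\ ocone a b c (k *: y).
  case: oc => oc; first by exists 1; rewrite oner_eq0 scale1r.
  by exists (-1); rewrite oppr_eq0 oner_eq0 scaleN1r.
exists a, b, c, s, t, u; split=> //; first by split; exact: B_lightcone.
by rewrite -e; exact: hcoord_scale.
Qed.

Lemma triangle_moves M p q r p' q' r' a b c : G M -> B a -> B b -> B c ->
  hcoord p a -> hcoord q b -> hcoord r c ->
  hcoord p' (M *m a) -> hcoord q' (M *m b) -> hcoord r' (M *m c) ->
  @image_in_surface R G Omega (open_triangle Omp p q r) =
  @image_in_surface R G Omega (open_triangle Omp p' q' r').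
Proof.
move=> MG Ba Bb Bc pa qb rc pa' qb' rc'; apply: (surface_image_moves MG) => y y' x yx y'x.
have Bm := cs_Bact CS MG.
rewrite (open_triangleE Ba Bb Bc pa qb rc yx).
rewrite (open_triangleE (Bm _ Ba) (Bm _ Bb) (Bm _ Bc) pa' qb' rc' y'x).
have mv w : ocone a b c w <-> ocone (M *m a) (M *m b) (M *m c) (M *m w).
  split; first exact: ocone_act.
  by move/(ocone_act (invmx M)); rewrite !(GKv Gs).
by rewrite mv (mv (- x)) mulmxN.
Qed.

Lemma parabolic_point_moves M p p' a : G M -> B a -> hcoord p a ->
  hcoord p' (M *m a) -> parabolic_point G Omega p -> parabolic_point G Omega p'.
Proof.
move=> MG Ba pa pa' [_ [N [GN pN [v pv pNv]]]]; split.
  by apply: B_boundary pa'; exact: (cs_Bact CS).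
exists (M *m N *m invmx M); split.
- by apply: (GM Gs); [exact: (GM Gs)|exact: (GV Gs)].
- exact: (parabolic_conj Gs).
have [i i0 vE] := hcoord_prop pa pv; have [j j0 NvE] := hcoord_prop pa pNv.
exists (M *m a) => //; rewrite -mulmxA (GKv Gs) // -mulmxA.
have -> : N *m a = (i^-1 * j) *: a.
  by rewrite -scalerA -NvE vE -scalemxAr scalerA mulVf // scale1r.
by rewrite -scalemxAr; apply: hcoord_scale; rewrite // mulf_neq0 // invr_eq0.
Qed.

Lemma induced_act M F : G M -> P F -> P (act M F).
Proof.
move=> MG [p [q [r [a [b [c [[[pp qp rp'] [pq qr rp] [A1 A2 A3] disj] [Ba Bb Bc] [pa qb rc] ->]]]]]]].
have nz p1 v : hcoord p1 v -> M *m v != 0.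
  move=> h; apply/eqP => e; have /eqP := hcoord_neq0 h; apply.
  by rewrite -(GKv Gs v MG) e mulmx0.
have [p' pa'] := hcoord_ex (nz _ _ pa); have [q' qb'] := hcoord_ex (nz _ _ qb).
have [r' rc'] := hcoord_ex (nz _ _ rc).
have neq p1 q1 p1' q1' u v : hcoord p1 u -> hcoord q1 v -> hcoord p1' (M *m u) ->
    hcoord q1' (M *m v) -> p1 <> q1 -> p1' <> q1'.
  move=> h1 h2 h1' h2' n e; apply: n; rewrite e in h1'.
  have [t t0 vE] := hcoord_prop h1' h2'.
  apply: (hcoord_inj (v := v)) => //.
  rewrite -(GKv Gs v MG) vE -scalemxAr (GKv Gs) //.
  exact: hcoord_scale.
exists p', q', r', (M *m a), (M *m b), (M *m c); split; last exact: act_set3.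
- split.
  + by split; [exact: (parabolic_point_moves MG Ba pa)|exact: (parabolic_point_moves MG Bb qb)|exact: (parabolic_point_moves MG Bc rc)].
  + by split; [exact: (neq _ _ _ _ _ _ pa qb)|exact: (neq _ _ _ _ _ _ qb rc)|exact: (neq _ _ _ _ _ _ rc pa)].
  + rewrite -(line_moves MG pa qb pa' qb') -(line_moves MG qb rc qb' rc').
    by rewrite -(line_moves MG rc pa rc' pa').
  + by rewrite -(triangle_moves MG Ba Bb Bc pa qb rc pa' qb' rc').
- by split; exact: (cs_Bact CS).
- by split.
Qed.

(* If a vertex v of the second triangle lay strictly beyond a side of the first one,
   then the ray w + t v of the second triangle would cross that side. *)
Lemma lifted_coord a b c a' b' c' w (s t u : R) :
  lifted_face a b c -> lifted_face a' b' c' -> ocone a b c w -> ocone a' b' c' w ->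
  a' = s *: a + t *: b + u *: c -> [/\ 0 <= s, 0 <= t & 0 <= u].
Proof.
move=> L L' [i [j [k [i0 j0 k0 wE]]]] W' a'E.
have [Ba Bb Bc] := lf_B L'; have [ab bc ac] := lf_neq L'.
have cross m : 0 < m -> ocone a' b' c' (w + m *: a').
  move=> m0; case: W' => [i' [j' [k' [i'0 j'0 k'0 ->]]]].
  by exists (i' + m), j', k'; split=> //; [rewrite addr_gt0|vring].
have bad m e x y : 0 < m -> A e -> side x y e -> ~ in_span x y (w + m *: a').
  move=> m0 Ae [sd _] sp; apply: (lf_int L' Ae (cross _ m0)); apply: sd => //.
  exact: (ocone_C CS Ba Bb Bc ab (cross _ m0)).
(* When a coordinate of [a'] is negative, [i' / - s'] is the value of [m] at which the matching
   coordinate of [w + m a'] vanishes, that is, the crossing with the side. *)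
have gt0 (i' s' : R) : 0 < i' -> s' < 0 -> 0 < i' / - s' by move=> h1 h2; rewrite divr_gt0 ?oppr_gt0.
have eq0 (i' s' : R) : s' < 0 -> i' + i' / - s' * s' = 0.
  by move=> h; field; rewrite lt_eqF.
split; rewrite leNgt; apply/negP => neg.
- have [e Ae sd] := lf_bc L; apply: (bad _ _ _ _ (gt0 _ _ i0 neg) Ae sd).
  exists (j + i / - s * t), (k + i / - s * u).
  transitivity ((i + i / - s * s) *: a + (j + i / - s * t) *: b + (k + i / - s * u) *: c).
    by rewrite wE a'E; vring.
  by rewrite (eq0 _ _ neg) scale0r add0r.
- have [e Ae sd] := lf_ca L; apply: (bad _ _ _ _ (gt0 _ _ j0 neg) Ae sd).
  exists (k + j / - t * u), (i + j / - t * s).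
  transitivity ((i + j / - t * s) *: a + (j + j / - t * t) *: b + (k + j / - t * u) *: c).
    by rewrite wE a'E; vring.
  by rewrite (eq0 _ _ neg) scale0r addr0 addrC.
- have [e Ae sd] := lf_ab L; apply: (bad _ _ _ _ (gt0 _ _ k0 neg) Ae sd).
  exists (i + k / - u * s), (j + k / - u * t).
  transitivity ((i + k / - u * s) *: a + (j + k / - u * t) *: b + (k + k / - u * u) *: c).
    by rewrite wE a'E; vring.
  by rewrite (eq0 _ _ neg) scale0r addr0.
Qed.

(* Vertices are extreme, by strict convexity. *)
Lemma B_extreme a b c v (s t u : R) : B a -> B b -> B c -> B v ->
  a <> b -> b <> c -> a <> c -> 0 <= s -> 0 <= t -> 0 <= u ->
  v = s *: a + t *: b + u *: c -> [\/ v = a, v = b | v = c].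
Proof.
move=> Ba Bb Bc Bv ab bc ac s0 t0 u0 vE.
have [/eqP ->|va] := boolP (v == a); first exact: Or31.
have [/eqP ->|vb] := boolP (v == b); first exact: Or32.
have [/eqP ->|vc] := boolP (v == c); first exact: Or33.
exfalso; move/eqP in va; move/eqP in vb; move/eqP in vc.
have pos (i : R) : 0 <= i -> i = 0 \/ 0 < i by rewrite le_eqVlt => /orP[/eqP|]; auto.
case: (pos _ s0) => s1.
  apply: (@B_norel _ _ _ _ _ CS v b c 1 t u) => //.
  by rewrite scale1r vE s1 scale0r add0r.
case: (pos _ t0) => t1.
  apply: (@B_norel _ _ _ _ _ CS v a c 1 s u) => //.
  by rewrite scale1r vE t1 scale0r addr0.
apply: (cs_BnC CS Bv); rewrite vE; apply: (C_ext CS) => //.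
exact: (C_pair CS).
Qed.

Lemma lifted_vertex a b c a' b' c' w :
  lifted_face a b c -> lifted_face a' b' c' -> ocone a b c w -> ocone a' b' c' w ->
  [\/ a' = a, a' = b | a' = c].
Proof.
move=> L L' W W'; have [Ba Bb Bc] := lf_B L; have [ab bc ac] := lf_neq L.
have [Ba' _ _] := lf_B L'.
have [s [t [u a'E]]] := cramer a' (B_indep CS Ba Bb Bc ab bc ac).
have [s0 t0 u0] := lifted_coord L L' W W' a'E.
exact: (B_extreme Ba Bb Bc Ba' ab bc ac s0 t0 u0 a'E).
Qed.

Lemma lifted_face_rot a b c : lifted_face a b c -> lifted_face b c a.
Proof.
move=> [[Ba Bb Bc] [ab bc ac] h1 h2 h3 h4]; split=> //; first by split; auto.
by move=> x e Ae /ocone_acb/ocone_bac; exact: h4.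
Qed.

Lemma lifted_disj a b c a' b' c' w : lifted_face a b c -> lifted_face a' b' c' ->
  ocone a b c w -> ocone a' b' c' w -> [set a; b; c] = [set a'; b'; c'].
Proof.
move=> L L' W W'.
have rot x y z : ocone x y z w -> ocone y z x w by move=> /ocone_bac/ocone_acb.
have Lr := lifted_face_rot L'; have Lrr := lifted_face_rot Lr.
have va := lifted_vertex L L' W W'.
have vb := lifted_vertex L Lr W (rot _ _ _ W').
have vc := lifted_vertex L Lrr W (rot _ _ _ (rot _ _ _ W')).
have [ab bc ac] := lf_neq L'.
suff sub : [set a'; b'; c'] `<=` [set a; b; c].
  rewrite eqEsubset; split=> // x.
  case: va vb vc => -> [] -> [] -> in ab bc ac *; try by [];
  by case=> [[|]|] ->; do ?[by left; left|by left; right|by right].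
move=> x [[|]|] ->.
- by case: va => ->; [left; left|left; right|right].
- by case: vb => ->; [left; left|left; right|right].
- by case: vc => ->; [left; left|left; right|right].
Qed.

Lemma induced_triangulation : triangulation G B P.
Proof.
split; [|exact: induced_act|].
- move=> F /induced_lifted[a [b [c [-> L]]]].
  by exists a, b, c; split; [exact: (lf_B L)|exact: (lf_neq L)|].
- move=> F F' w /induced_lifted[a [b [c [-> L]]]] /induced_lifted[a' [b' [c' [-> L']]]].
  have [ab bc ac] := lf_neq L; have [ab' bc' ac'] := lf_neq L'.
  by move=> /(fcone3 _ ab bc ac) W /(fcone3 _ ab' bc' ac') W'; exact: (lifted_disj L L' W W').
Qed.

Lemma meets_act M e x : G M -> meets e x -> meets e (M *m x).
Proof.
move=> MG [X Xx eX].
have Mx0 : M *m x != 0.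
  apply/eqP => e0; have /eqP := hcoord_neq0 Xx; apply.
  by rewrite -(GKv Gs x MG) e0 mulmx0.
have [q qMx] := hcoord_ex Mx0.
have Oq : Omega q by apply: (G_Omega MG _ (set_valP X)); exists x.
have Oq' : q \in Omega by rewrite inE.
exists (exist _ q Oq' : set_type Omega) => //.
suff <- : quotient_map orb X = quotient_map orb (exist _ q Oq' : set_type Omega) by [].
by apply/quotient_mapP/same_orbitP; exists M => //; exists x.
Qed.

Lemma side_act M a b e : G M -> side a b e -> side (M *m a) (M *m b) e.
Proof.
move=> MG [h1 h2]; split=> [x Cx [s [t xE]]|x /h2[N GN [s [t NxE]]]].
  rewrite -(GVKv Gs x MG); apply: (meets_act MG); apply: h1.
    by apply: (cs_act CS) => //; exact: (GV Gs).
  by exists s, t; rewrite xE mulmxDr -!scalemxAr !(GKv Gs).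
exists (M *m N); first exact: (GM Gs).
by exists s, t; rewrite -mulmxA NxE mulmxDr -!scalemxAr.
Qed.

Lemma side_sym a b e : side a b e -> side b a e.
Proof.
move=> [h1 h2]; split=> [x Cx [s [t xE]]|x /h2[N GN [s [t NxE]]]].
  by apply: h1 => //; exists t, s; rewrite xE addrC.
by exists N => //; exists t, s; rewrite NxE addrC.
Qed.

Lemma lifted_face_act M a b c : G M -> lifted_face a b c ->
  lifted_face (M *m a) (M *m b) (M *m c).
Proof.
move=> MG [[Ba Bb Bc] [ab bc ac] [e1 A1 h1] [e2 A2 h2] [e3 A3 h3] h4].
have sd := side_act MG; split.
- by split; exact: (cs_Bact CS).
- by split; exact: (G_neq Gs).
- by exists e1 => //; exact: sd.
- by exists e2 => //; exact: sd.
- by exists e3 => //; exact: sd.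
- move=> x e Ae /(ocone_act (invmx M)); rewrite !(GKv Gs) // => oc /(meets_act (GV Gs MG)).
  exact: h4.
Qed.

Lemma lifted_face_swap a b c : lifted_face a b c -> lifted_face b a c.
Proof.
move=> [[Ba Bb Bc] [ab bc ac] [e1 A1 h1] [e2 A2 h2] [e3 A3 h3] h4]; split.
- by split.
- by split; auto.
- by exists e1 => //; exact: side_sym.
- by exists e3 => //; exact: side_sym.
- by exists e2 => //; exact: side_sym.
- by move=> x e Ae /ocone_bac; exact: h4.
Qed.

(* Two lifts through the same point of an arc coincide, as otherwise one of them
   would enter a triangle adjacent to the other. *)
Lemma side_unique a b c a1 b1 e : lifted_face a b c -> A e -> side a1 b1 e ->
  B a1 -> B b1 -> a1 <> b1 -> in_span a b (a1 + b1) ->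
  a1 = a /\ b1 = b \/ a1 = b /\ b1 = a.
Proof.
move=> L Ae [sd _] Ba1 Bb1 ab1 [i [j xE]].
have [Ba Bb Bc] := lf_B L; have [ab bc ac] := lf_neq L.
have d0 := B_indep CS Ba Bb Bc ab bc ac.
have Cx := cs_BB CS Ba1 Bb1 ab1.
have i0 : 0 < i.
  rewrite ltNge; apply/negP => i0; apply: (B_ray_notC CS (b := b) (s := j) Bb).
  have -> : j *: b = (a1 + b1) + (- i) *: a by rewrite xE; vring.
  by apply: (C_ext CS) => //; rewrite oppr_ge0.
have j0 : 0 < j.
  rewrite ltNge; apply/negP => j0; apply: (B_ray_notC CS (b := a) (s := i) Ba).
  have -> : i *: a = (a1 + b1) + (- j) *: b by rewrite xE; vring.
  by apply: (C_ext CS) => //; rewrite oppr_ge0.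
have iN : i != 0 by rewrite gt_eqF.
have jN : j != 0 by rewrite gt_eqF.
have key v (k l s t u : R) : v = k *: a1 + l *: b1 -> B v -> v = s *: a + t *: b + u *: c -> u <= 0.
  move=> vE Bv vE'; rewrite leNgt; apply/negP => u0.
  (* Large enough for the first two coordinates of [n (a1 + b1) + v] to be positive; this vector is
     still over [e], yet would be inside the triangle. *)
  pose n := (`|s| + 1) / i + (`|t| + 1) / j.
  have s1 : 0 < `|s| + 1 by rewrite ltr_wpDl.
  have t1 : 0 < `|t| + 1 by rewrite ltr_wpDl.
  have n0 : 0 < n by rewrite addr_gt0 // divr_gt0.
  have ni : `|s| + 1 <= n * i.
    have : 0 <= (`|t| + 1) / j * i by rewrite mulr_ge0 ?divr_ge0 // ltW.
    by move=> h; rewrite /n mulrDl (divfK iN); lra.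
  have nj : `|t| + 1 <= n * j.
    have : 0 <= (`|s| + 1) / i * j by rewrite mulr_ge0 ?divr_ge0 // ltW.
    by move=> h; rewrite /n mulrDl (divfK jN); lra.
  apply: (@lf_int _ _ _ L (n *: (a1 + b1) + 1 *: v) e Ae).
    exists (n * i + s), (n * j + t), u; split=> //.
    - by have := ler_norm (- s); rewrite normrN; lra.
    - by have := ler_norm (- t); rewrite normrN; lra.
    - by rewrite xE vE'; vring.
  apply: sd; first by apply: (C_ext CS) => //; apply: (cs_scale CS).
  by exists (n + k), (n + l); rewrite vE; vring.
have [s [t [u aE]]] := cramer a1 d0; have [s' [t' [u' bE]]] := cramer b1 d0.
have u0 := key a1 1 0 _ _ _ (_ : a1 = 1 *: a1 + 0 *: b1) Ba1 aE.
have u'0 := key b1 0 1 _ _ _ (_ : b1 = 0 *: a1 + 1 *: b1) Bb1 bE.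
have {}u0 : u <= 0 by apply: u0; vring.
have {}u'0 : u' <= 0 by apply: u'0; vring.
have xE' : (s + s') *: a + (t + t') *: b + (u + u') *: c = i *: a + j *: b + 0 *: c.
  transitivity (a1 + b1); first by rewrite aE bE; vring.
  by rewrite xE; vring.
have [_ _ uu] := coord_inj d0 xE'.
have uz : u = 0 by lra.
have u'z : u' = 0 by lra.
have ends v (k l : R) : B v -> v = k *: a + l *: b + 0 *: c -> v = a \/ v = b.
  move=> Bv vE; have [/eqP ->|va] := boolP (v == a); first by left.
  have [/eqP ->|vb] := boolP (v == b); first by right.
  exfalso; move/eqP in va; move/eqP in vb.
  have /eqP := B_indep CS Ba Bb Bv ab (nesym vb) (nesym va); apply.
  by rewrite vE det3_comb mul0r.
rewrite uz in aE; rewrite u'z in bE.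
have [ha|ha] := ends _ _ _ Ba1 aE; have [hb|hb] := ends _ _ _ Bb1 bE; auto;
  by case: ab1; rewrite ha hb.
Qed.

(** Two triangles on the same side of a common edge overlap close to that edge. *)
Lemma lifted_opposite a b c c' : lifted_face a b c -> lifted_face a b c' ->
  0 < det3 a b c * det3 a b c' -> c = c'.
Proof.
move=> L L' dd; have [Ba Bb Bc] := lf_B L; have [ab bc ac] := lf_neq L.
have [_ bc' ac'] := lf_neq L'.
have d0 := B_indep CS Ba Bb Bc ab bc ac.
have [s [t [u cE]]] := cramer c' d0.
have u0 : 0 < u.
  move: dd; rewrite cE det3_comb mulrCA pmulr_lgt0 //.
  by rewrite lt0r mulf_neq0 //= -expr2 sqr_ge0.
pose n := `|s| + `|t| + 1.
have ns : 0 < n + s by have := ler_norm (- s); rewrite normrN /n; have := normr_ge0 t; lra.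
have nt : 0 < n + t by have := ler_norm (- t); rewrite normrN /n; have := normr_ge0 s; lra.
have n0 : 0 < n by rewrite /n; have := normr_ge0 s; have := normr_ge0 t; lra.
have e : [set a; b; c] = [set a; b; c'].
  apply: (lifted_disj L L' (w := n *: a + n *: b + 1 *: c')).
    by exists (n + s), (n + t), u; split=> //; rewrite cE; vring.
  by exists n, n, 1.
have : [set a; b; c'] c by rewrite -e; right.
by move=> [[]|] //= h; [case: ac|case: bc].
Qed.

Lemma lifted_third_finite a b : finite_set [set c | lifted_face a b c].
Proof.
apply: (sub_finite_set (B := [set c | lifted_face a b c /\ 0 < det3 a b c] `|`
    [set c | lifted_face a b c /\ det3 a b c < 0])).
  move=> c /= L; have [Ba Bb Bc] := lf_B L; have [ab bc ac] := lf_neq L.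
  have := B_indep CS Ba Bb Bc ab bc ac; rewrite neq_lt => /orP[]; by [right|left].
rewrite finite_setU; split; apply: subset1_finite => c c' [L d] [L' d'];
  apply: (lifted_opposite L L'); first exact: mulr_gt0.
by rewrite nmulr_rgt0.
Qed.

(** For each of the finitely many arcs, fix one face with a side over it. Any other such face has a
    translate whose side passes through [a1 + b1]; by [side_unique] the sides coincide, and the
    third vertex has at most one position on each side. *)
Lemma induced_classes_finite : finite_set (face_classes G P).
Proof.
pose S e := [set k | exists a b c, [/\ k = class_of G [set a; b; c], lifted_face a b c & side a b e]].
apply: (sub_finite_set (B := \bigcup_(e in A) S e)).
  move=> _ [F /induced_lifted[a [b [c [-> L]]]] <-].
  by have [e Ae sd] := lf_ab L; exists e => //; exists a, b, c.
apply: bigcup_finite => // e Ae.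
have [[k1 [a1 [b1 [c1 [_ L1 sd1]]]]]|n] := pselect (exists k, S e k); last first.
  exact: (@sub_finite_set _ (S e) set0 (fun k Sk => n (ex_intro _ k Sk)) (finite_set0 _)).
have [Ba1 Bb1 _] := lf_B L1; have [ab1 _ _] := lf_neq L1.
apply: (sub_finite_set (B := [set class_of G [set a1; b1; c] | c in lifted_face a1 b1]));
  last exact/finite_image/lifted_third_finite.
move=> _ [a [b [c [-> L sd]]]].
have : meets e (a1 + b1).
  by apply: sd1.1; [exact: (cs_BB CS)|exists 1, 1; rewrite !scale1r].
move/sd.2 => [M MG [s [t xE]]].
have L' := lifted_face_act (GV Gs MG) L.
have cE : class_of G [set a; b; c] =
    class_of G [set invmx M *m a; invmx M *m b; invmx M *m c].
  by rewrite -act_set3 (class_of_act Gs) //; exact: (GV Gs).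
have sp : in_span (invmx M *m a) (invmx M *m b) (a1 + b1).
  by exists s, t; rewrite -[LHS](GKv Gs _ MG) xE mulmxDr -!scalemxAr.
exists (invmx M *m c).
  case: (side_unique L' Ae sd1 Ba1 Bb1 ab1 sp) => [] [-> ->] //.
  exact: lifted_face_swap.
rewrite cE; case: (side_unique L' Ae sd1 Ba1 Bb1 ab1 sp) => [] [-> ->] //.
by congr class_of; rewrite (setUC [set invmx M *m b]).
Qed.

End InducedPolyhedron.

(** * Discreteness of orbits of parabolic vectors *)

(** The bound [m] is chosen before the sequence [g]; this is what makes the lower bound on [psi] in
    [parabolic_orbit_finite] independent of [M]. *)
Lemma finite_pigeonhole (T : eqType) (S : set T) : finite_set S ->
  exists m : nat, forall g : nat -> T, (forall k, (k <= m)%N -> S (g k)) ->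
    exists k l, [/\ (k < l)%N, (l <= m)%N & g k = g l].
Proof.
move=> /finite_seqP[s ->]; exists (size s) => g gS.
have nu : ~~ uniq [seq g k | k <- iota 0 (size s).+1].
  apply/negP => u; suff : ((size s).+1 <= size s)%N by rewrite ltnn.
  rewrite -[X in (X <= _)%N](size_iota 0) -(size_map g).
  apply: uniq_leq_size => // z /mapP[k]; rewrite mem_iota add0n ltnS => /andP[_ ks] ->.
  exact: gS.
have [i [j []]] := uniqPn (g 0%N) nu.
rewrite size_map size_iota => ij js.
rewrite !(nth_map 0%N) ?size_iota // ?nth_iota // ?add0n //; last exact: ltn_trans js.
  by move=> e; exists i, j.
exact: ltn_trans js.
Qed.

(** * Bounded elements of a discrete group *)

Section BoundedMatrices.
Variable R : realType.

Definition entries_le m n (N : R) (M : 'M[R]_(m, n)) := forall i j, `|M i j| <= N.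

Lemma det_bound n (N : R) (M : 'M[R]_n) : entries_le N M ->
  `|\det M| <= \sum_(s : {perm 'I_n}) N ^+ n.
Proof.
move=> MN; apply: le_trans (ler_norm_sum _ _ _) _; apply: ler_sum => s _.
rewrite normrM normrX normrN1 expr1n mul1r normr_prod.
have : \prod_i `|M i (s i)| <= \prod_(i < n) N.
  by apply: ler_prod => i _; rewrite normr_ge0; exact: MN.
by rewrite prodr_const card_ord.
Qed.

(** For determinant 1 the inverse is the adjugate, whose entries are 2 by 2 minors up to sign. *)
Lemma invmx_bound (N : R) : exists N', forall M : 'M[R]_3, \det M = 1 ->
  entries_le N M -> entries_le N' (invmx M).
Proof.
exists (\sum_(s : {perm 'I_2}) N ^+ 2) => M d1 MN i j.
rewrite /invmx unitmxE d1 unitr1 invr1 scale1r mxE /cofactor.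
rewrite normrM normrX normrN1 expr1n mul1r; apply: det_bound => k l.
by rewrite !mxE; exact: MN.
Qed.

Lemma mulmx_bound (N d : R) m (L : 'M[R]_3) (M : 'M[R]_(3, m)) : 0 <= N -> 0 <= d ->
  entries_le N L -> entries_le d M -> entries_le (3 * (N * d)) (L *m M).
Proof.
move=> N0 d0 LN Md i j; rewrite mxE sum3E.
have h k : `|L i k * M k j| <= N * d by rewrite normrM ler_pM.
have h0 := h i0; have h1 := h i1; have h2 := h i2.
apply: le_trans (ler_normD _ _) _; have := ler_normD (L i i0 * M i0 j) (L i i1 * M i1 j).
lra.
Qed.

Variable G : set 'M[R]_3.
Hypothesis Gs : subgroup_SL3 G.
Hypothesis G_discrete : discrete_subset G.

Lemma discrete_unit : exists2 e : R, 0 < e &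
  forall M, G M -> entries_le e (M - 1%:M) -> M = 1%:M.
Proof.
have [_ [W nW WE]] := G_discrete (G1 Gs).
have /nbhs_ballP[e e0 he] := nW.
exists (e / 2); first by rewrite divr_gt0.
move=> M MG Me; suff : [set 1%:M] M by [].
rewrite -WE; split=> //; apply: he; split=> // i j.
rewrite -ball_normE /=; have := Me i j; rewrite !mxE distrC => h.
apply: le_lt_trans h _; move: e0 => /= e0; lra.
Qed.

(** Isolation of the identity is moved to [L] by left multiplication, uniformly because the inverses
    of bounded elements are bounded. The 3 in [d] is the number of terms in an entry of a
    product. *)
Lemma discrete_separated (N : R) : exists2 d : R, 0 < d &
  forall L M, G L -> G M -> entries_le N L -> entries_le d (M - L) -> M = L.
Proof.
have [e e0 he] := discrete_unit; have [N' hN'] := invmx_bound N.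
pose K := 1 + `|N'|; have K0 : 0 < K by rewrite ltr_wpDr.
exists (e / (3 * K)); first by rewrite divr_gt0 // mulr_gt0.
move=> L M GL MG LN ML.
have h : entries_le e (invmx L *m M - 1%:M).
  rewrite -(GK Gs GL) -mulmxBr => i j.
  have -> : e = 3 * (K * (e / (3 * K))) by field; rewrite gt_eqF.
  apply: mulmx_bound ML _ _ => //; [exact: ltW|by rewrite divr_ge0 // ltW // mulr_gt0|].
  move=> k l; apply: le_trans (hN' _ (Gdet Gs GL) LN k l) _.
  by apply: le_trans (ler_norm _) _; rewrite lerDr.
have := he _ (GM Gs (GV Gs GL) MG) h.
by move/(congr1 (mulmx L)); rewrite mulmxA (GVK Gs GL) mul1mx mulmx1.
Qed.

(** Rounding the entries to a grid of mesh [d] is injective on these elements by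
    [discrete_separated] and takes finitely many values. *)
Lemma bounded_finite (N : R) : finite_set [set M | G M /\ entries_le N M].
Proof.
have [d d0 hd] := discrete_separated N.
pose m := (Num.truncn ((N + N) / d)).
pose h (M : 'M[R]_3) : 'M['I_m.+1]_3 :=
  \matrix_(i, j) inord (Num.truncn ((M i j + N) / d)).
rewrite -(eq_finite_set (@inj_card_eq _ _ _ h _)); first exact: finite_finset.
move=> L M /set_mem[GL LN] /set_mem[MG MN] hLM.
apply/esym; apply: hd => // i j.
have pos (K : 'M[R]_3) : entries_le N K -> 0 <= (K i j + N) / d.
  by move=> KN; apply: divr_ge0; [|exact: ltW]; have := KN i j; rewrite ler_norml => /andP[]; lra.
have le (K : 'M[R]_3) : entries_le N K -> (Num.truncn ((K i j + N) / d) < m.+1)%N.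
  move=> KN; rewrite ltnS; apply: le_truncn.
  rewrite ler_pM2r ?invr_gt0 // lerD2r.
  by apply: le_trans (ler_norm _) (KN i j).
have := congr1 (fun K : 'M['I_m.+1]_3 => nat_of_ord (K i j)) hLM.
rewrite !mxE !inordK; [|exact: le..].
have /andP[] := truncn_itv (pos L LN); have /andP[] := truncn_itv (pos M MN).
move=> m1 m2 l1 l2 e; rewrite e in l1 l2; move: m1 m2 l1 l2.
set t := Num.truncn _; rewrite -natr1 => m1 m2 l1 l2.
have : (M i j + N) / d - (L i j + N) / d <= 1 by lra.
have : (L i j + N) / d - (M i j + N) / d <= 1 by lra.
rewrite -!mulrBl !ler_pdivrMr // mul1r => k1 k2.
by rewrite ler_norml; apply/andP; split; lra.
Qed.

Variables (C : set 'cV[R]_3) (f : 'rV[R]_3).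
Hypothesis C_open : line_open C.
Hypothesis C_pos : forall x, C x -> 0 < pairing f x.
Hypothesis C_act : forall M x, G M -> C x -> C (M *m x).
Hypothesis C_norm : exists K, forall x, C x -> entries_le (K * pairing f x) x.

(** As [o] is interior, [o + e e_j] and [o - e e_j] lie in [C] for each basis vector [e_j]. The
    values of [f] at their images are positive with sum [2 f (M o)], hence bounded, and then so are
    the columns of [M]. *)
Lemma interior_orbit_finite o (N : R) : C o -> finite_set [set M | G M /\ pairing f (M *m o) <= N].
Proof.
move=> Co; have [K hK] := C_norm.
have [e e0 he] : exists2 e, 0 < e & forall j, C (o + e *: delta_mx j 0) /\ C (o - e *: delta_mx j 0).
  have [s0 p0 h0] := C_open Co (delta_mx i0 0); have [s1 p1 h1] := C_open Co (delta_mx i1 0).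
  have [s2 p2 h2] := C_open Co (delta_mx i2 0).
  pose e := Num.min s0 (Num.min s1 s2).
  have e0 : 0 < e by rewrite !lt_min p0 p1.
  have le0 : e <= s0 by rewrite ge_min lexx.
  have le1 : e <= s1 by rewrite !ge_min lexx orbT.
  have le2 : e <= s2 by rewrite !ge_min lexx !orbT.
  exists e => //; apply: ord3P; rewrite -scaleNr; split;
    [apply: h0|apply: h0|apply: h1|apply: h1|apply: h2|apply: h2];
    by rewrite ?normrN gtr0_norm.
pose N' := (`|K| * (N + N) + `|K| * N) / e.
apply: (sub_finite_set (B := [set M | G M /\ entries_le N' M])); last exact: bounded_finite.
move=> M [MG MN]; split=> // i j.
have [Cp Cm] := he j.
have Kb x L : C x -> pairing f x <= L -> `|x i 0| <= `|K| * L.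
  move=> Cx xL; apply: le_trans (hK _ Cx i 0) _.
  apply: (@le_trans _ _ (`|K| * pairing f x)); last exact: ler_wpM2l.
  by apply: ler_wpM2r; [apply: ltW; exact: C_pos|exact: ler_norm].
have sum : pairing f (M *m (o + e *: delta_mx j 0)) + pairing f (M *m (o - e *: delta_mx j 0)) =
    pairing f (M *m o) + pairing f (M *m o).
  by rewrite -pairingD -mulmxDr addrACA subrr addr0 mulmxDr pairingD.
have := C_pos (C_act MG Cm) => pm.
have up : pairing f (M *m (o + e *: delta_mx j 0)) <= N + N by lra.
have b1 := Kb _ _ (C_act MG Cp) up.
have b2 := Kb _ _ (C_act MG Co) MN.
rewrite /N' ler_pdivlMr // -[X in `|_| * X](gtr0_norm e0) -normrM mulrC.
have -> : e * M i j = (M *m (o + e *: delta_mx j 0)) i 0 - (M *m o) i 0.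
  by rewrite mulmxDr -scalemxAr -colE !mxE; ring.
by apply: le_trans (ler_normB _ _) _; lra.
Qed.

End BoundedMatrices.

(** * The flow through a parabolic element and its fixed vector *)

Section Parabolic.
Variable R : realType.
Notation V := 'cV[R]_3.

(* The powers of the standard parabolic matrix, interpolated to real exponents. *)
Definition jordan_flow (k : R) : 'M[R]_3 := \matrix_(i, j)
  (if j == i then 1 else if j == i.+1 :> nat then k
   else if j == i.+2 :> nat then k * (k - 1) / 2 else 0).

Lemma jordan_flow1 : jordan_flow 1 = standard_parabolic R.
Proof.
apply/matrixP; apply: ord3P; apply: ord3P; rewrite !mxE //=.
by rewrite subrr mulr0 mul0r.
Qed.

Lemma jordan_flowE k (y : V) : jordan_flow k *m y = \col_i
  (if i == i0 then y i0 0 + k * y i1 0 + k * (k - 1) / 2 * y i2 0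
   else if i == i1 then y i1 0 + k * y i2 0 else y i2 0).
Proof. by apply: vec3P; rewrite !mxE sum3E !mxE /=; ring. Qed.

Lemma jordan_flowD k l : jordan_flow k *m jordan_flow l = jordan_flow (k + l).
Proof.
by apply/matrixP; apply: ord3P; apply: ord3P; rewrite !mxE sum3E !mxE /=; field.
Qed.

Lemma jordan_flow0 : jordan_flow 0 = 1%:M.
Proof. by apply/matrixP; apply: ord3P; apply: ord3P; rewrite !mxE //= !mul0r. Qed.

(* The one-parameter group through a parabolic element fixing v; psi vanishes on the
   tangent line at v, and chi is an affine coordinate that the flow translates. *)
Record parabolic_flow (G : set 'M[R]_3) (v : V) (T : R -> 'M[R]_3)
    (psi chi : 'rV[R]_3) : Prop := ParabolicFlow {
  pf_G : forall z : int, G (T z%:~R);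
  pf_D : forall k l, T k *m T l = T (k + l);
  pf_0 : T 0 = 1%:M;
  pf_v : forall k, T k *m v = v;
  pf_psiv : pairing psi v = 0;
  pf_chiv : pairing chi v = 0;
  pf_sym : forall k x, T k *m x + T (- k) *m x = 2 *: x + (k ^+ 2 * pairing psi x) *: v;
  pf_psi : forall k x, pairing psi (T k *m x) = pairing psi x;
  pf_chi : forall k x, pairing chi (T k *m x) = pairing chi x + k * pairing psi x;
  pf_ker : forall x, pairing psi x = 0 -> pairing chi x = 0 -> exists t, x = t *: v;
  pf_psi1 : exists y, pairing psi y = 1
}.

(** An eigenvector of the Jordan block is a multiple of the first basis vector. The forms [psi] and
    [chi] are the third and second coordinates, divided by the coordinate [eta] of [v] so that the
    coefficient in [pf_sym] is exactly [k ^+ 2 * psi]. *)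
Lemma parabolic_flow_ex (G : set 'M[R]_3) (N : 'M[R]_3) (v : V) (mu : R) :
  subgroup_SL3 G -> G N -> parabolic N -> v != 0 -> N *m v = mu *: v ->
  exists T psi chi, parabolic_flow G v T psi chi.
Proof.
move=> Gs GN [h hu NE] v0 Nv.
have [w wE] : exists w : V, w = invmx h *m v by exists (invmx h *m v).
have vE : v = h *m w by rewrite wE mulmxA mulmxV // mul1mx.
have Jw : jordan_flow 1 *m w = mu *: w.
  by rewrite jordan_flow1 wE scalemxAr -Nv NE !mulmxA mulVmx // mul1mx.
rewrite jordan_flowE in Jw.
have e0 := congr1 (fun y : V => y i0 0) Jw; have e1 := congr1 (fun y : V => y i1 0) Jw.
have e2 := congr1 (fun y : V => y i2 0) Jw.
rewrite !mxE /= in e0 e1 e2.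
have w2 : w i2 0 = 0.
  apply/eqP; apply/negPn/negP => n0.
  have m1 : mu = 1 by apply: (mulIf n0); rewrite mul1r -e2.
  by rewrite m1 in e1; move: n0; rewrite (_ : w i2 0 = 0) ?eqxx //; lra.
have w1 : w i1 0 = 0.
  apply/eqP; apply/negPn/negP => n0.
  have m1 : mu = 1 by apply: (mulIf n0); rewrite -e1 w2; ring.
  by rewrite m1 w2 in e0; move: n0; rewrite (_ : w i1 0 = 0) ?eqxx //; lra.
pose eta := w i0 0.
have eta0 : eta != 0.
  apply: contraNneq v0 => e; rewrite vE (_ : w = 0) ?mulmx0 //.
  by apply: vec3P; rewrite ?mxE // -/eta ?e.
pose T k := h *m jordan_flow k *m invmx h.
pose psi : 'rV[R]_3 := eta^-1 *: row i2 (invmx h).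
pose chi : 'rV[R]_3 := eta^-1 *: row i1 (invmx h).
have psiE x : pairing psi x = eta^-1 * (invmx h *m x) i2 0.
  by rewrite /pairing /psi -scalemxAl mxE -row_mul !mxE.
have chiE x : pairing chi x = eta^-1 * (invmx h *m x) i1 0.
  by rewrite /pairing /chi -scalemxAl mxE -row_mul !mxE.
have TE k x : invmx h *m (T k *m x) = jordan_flow k *m (invmx h *m x).
  by rewrite /T !mulmxA mulVmx // mul1mx.
have hinj (x y : V) : invmx h *m x = invmx h *m y -> x = y.
  by move=> e; rewrite -[x](mulKVmx hu) e mulKVmx.
have TD k l : T k *m T l = T (k + l).
  by rewrite /T -jordan_flowD !mulmxA mulmxKV.
have T0 : T 0 = 1%:M by rewrite /T jordan_flow0 mulmx1 mulmxV.
have T1 : T 1 = N by rewrite /T jordan_flow1 NE.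
have Tn (n : nat) : G (T n%:R).
  elim: n => [|n IH]; first by rewrite T0; exact: (G1 Gs).
  by rewrite -natr1 -TD T1; exact: (GM Gs).
have TV k : T (- k) = invmx (T k).
  have u : T k \in unitmx.
    rewrite unitmxE; apply/unitrP; exists (\det (T (- k))).
    by rewrite -!det_mulmx !TD subrr addNr T0 det1.
  by rewrite -[LHS](mulKmx u) TD subrr T0 mulmx1.
exists T, psi, chi; split=> //.
- elim/int_ind => [|n _|n _]; first by rewrite T0; exact: (G1 Gs).
    exact: Tn.
  by rewrite mulrNz TV; apply: (GV Gs); exact: Tn.
- move=> k; apply: hinj; rewrite TE -wE jordan_flowE.
  by apply: vec3P; rewrite !mxE /= ?w1 ?w2; ring.
- by rewrite psiE -wE w2 mulr0.
- by rewrite chiE -wE w1 mulr0.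
- move=> k x; apply: hinj; rewrite !mulmxDr !TE -!scalemxAr -wE !jordan_flowE psiE.
  move: (invmx h *m x) => y.
  apply: vec3P; rewrite !mxE /= ?w1 ?w2 -?/eta; last by ring.
    by field.
  by ring.
- by move=> k x; rewrite !psiE TE jordan_flowE mxE.
- by move=> k x; rewrite !chiE psiE TE jordan_flowE mxE /=; ring.
- move=> x; rewrite psiE chiE => /eqP; rewrite mulf_eq0 invr_eq0 (negPf eta0) /= => /eqP x2.
  move=> /eqP; rewrite mulf_eq0 invr_eq0 (negPf eta0) /= => /eqP x1.
  exists ((invmx h *m x) i0 0 / eta); apply: hinj; rewrite -scalemxAr -wE.
  apply: vec3P; rewrite [in RHS]mxE ?w1 ?w2 ?x1 ?x2 ?mulr0 //.
  by rewrite -/eta divfK.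
- exists (eta *: (h *m delta_mx i2 0)); rewrite pairingZ psiE mulmxA mulVmx // mul1mx mxE /=.
  by rewrite mulr1 mulfV.
Qed.

Section Orbit.
Variables (G : set 'M[R]_3) (C : set V) (f : 'rV[R]_3) (v : V).
Variables (T : R -> 'M[R]_3) (psi chi : 'rV[R]_3).
Hypothesis Gs : subgroup_SL3 G.
Hypothesis C_open : line_open C.
Hypothesis C_add : forall x y, C x -> C y -> C (x + y).
Hypothesis C_scale : forall s x, 0 < s -> C x -> C (s *: x).
Hypothesis C_pos : forall x, C x -> 0 < pairing f x.
Hypothesis C_act : forall M x, G M -> C x -> C (M *m x).
Hypothesis v_pos : forall M, G M -> 0 < pairing f (M *m v).
Hypothesis pf : parabolic_flow G v T psi chi.

Lemma fv_gt0 : 0 < pairing f v.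
Proof. by have := v_pos (G1 Gs); rewrite mul1mx. Qed.

Lemma flow_nat_G (n : nat) : G (T n%:R). Proof. exact: (pf_G pf n). Qed.

Lemma flow_natN_G (n : nat) : G (T (- n%:R)).
Proof. by have := pf_G pf (- n%:Z); rewrite mulrNz. Qed.

(** By [pf_sym], [2 x + k^2 psi(x) v] is a sum of two vectors of [C] for every natural [k]; a
    negative [psi(x)] would make [f] negative on it for large [k]. *)
Lemma psi_ge0 x : C x -> 0 <= pairing psi x.
Proof.
move=> Cx; rewrite leNgt; apply/negP => neg.
have fv := fv_gt0.
pose q := - pairing psi x * pairing f v.
have q0 : 0 < q by rewrite mulr_gt0 // oppr_gt0.
pose k := (Num.truncn (2 * pairing f x / q)).+1.
have hk : 2 * pairing f x / q < k%:R by exact: truncnS_gt.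
have := C_pos (C_add (C_act (flow_nat_G k) Cx) (C_act (flow_natN_G k) Cx)).
rewrite (pf_sym pf) pairingD !pairingZ.
have kk : k%:R <= k%:R ^+ 2 :> R by rewrite expr2 ler_peMl // ler1n.
have hk2 : 2 * pairing f x / q < k%:R ^+ 2 by exact: lt_le_trans hk kk.
rewrite ltr_pdivrMr // in hk2.
rewrite /q in hk2; nra.
Qed.

Lemma psi_gt0 x : C x -> 0 < pairing psi x.
Proof.
move=> Cx; rewrite lt0r psi_ge0 // andbT; apply/eqP => x0.
have [y y1] := pf_psi1 pf; have [e e0 he] := C_open Cx y.
have : C (x + (- e) *: y) by apply: he; rewrite normrN gtr0_norm.
by move/psi_ge0; rewrite pairingD pairingZ x0 y1; lra.
Qed.

Hypothesis orbits_finite : forall o (N : R), C o ->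
  finite_set [set M | G M /\ pairing f (M *m o) <= N].

(* Let o be an interior point, M v bounded and x the preimage of o under M. As long as
   k^2 psi(x) <= 1, the conjugates M T(k) M^-1 move o by a bounded amount; as there are
   only finitely many such elements, psi(x) is bounded below. Up to a power of the
   parabolic element, x / psi(x) then lies on a segment modulo multiples of v, and an
   end of that segment is moved by M by a bounded amount. *)
Lemma parabolic_orbit_finite (N : R) : C !=set0 ->
  finite_set [set w | exists M, [/\ G M, w = M *m v & pairing f w <= N]].
Proof.
case=> o Co; have fv := fv_gt0; have po := psi_gt0 Co.
have fo := C_pos Co.
pose o1 := (pairing psi o)^-1 *: o.
have Co1 : C o1 by apply: C_scale; rewrite ?invr_gt0.
have po1 : pairing psi o1 = 1 by rewrite pairingZ mulVf // gt_eqF.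
clearbody o1.
pose o2 := T 1 *m o1.
have Co2 : C o2 by apply: C_act => //; exact: (flow_nat_G 1).
have po2 : pairing psi o2 = 1 by rewrite (pf_psi pf).
have co2 : pairing chi o2 = pairing chi o1 + 1 by rewrite (pf_chi pf) po1 mul1r.
(* The image of [o] under a conjugate is one of two vectors of [C] whose sum is [2 o + k^2 t M v];
   while [k^2 t <= 1], [f] is at most [2 f(o) + N] on this sum. *)
have [m hm] := finite_pigeonhole (orbits_finite (2 * pairing f o + N) Co).
have f1 := C_pos Co1; have f2 := C_pos Co2.
pose L := (pairing f o1 + pairing f o2) / pairing f v.
pose N2 := pairing f o * m%:R ^+ 2 + L * N.
apply: (sub_finite_set (B := [set M *m v | M in
    [set M | G M /\ pairing f (M *m o1) <= 2 * N2] `|`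
    [set M | G M /\ pairing f (M *m o2) <= 2 * N2]])); last first.
  by apply: finite_image; rewrite finite_setU; split; exact: orbits_finite.
move=> _ [M [MG -> MN]].
have fM := v_pos MG.
pose x := invmx M *m o.
have Cx : C x by apply: C_act => //; exact: (GV Gs).
have Mx : M *m x = o by exact: (GVKv Gs).
pose t := pairing psi x.
have t0 : 0 < t by exact: psi_gt0.
have t_ge : 1 < m%:R ^+ 2 * t.
  rewrite ltNge; apply/negP => tm.
  pose g (k : nat) := M *m T k%:R *m invmx M.
  have [k km|k [l [kl lm gkl]]] := hm g.
    split; first by apply: (GM Gs); [apply: (GM Gs) => //; exact: flow_nat_G|exact: (GV Gs)].
    have sum : M *m (T k%:R *m x) + M *m (T (- k%:R) *m x) = 2 *: o + (k%:R ^+ 2 * t) *: (M *m v).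
      by rewrite -mulmxDr (pf_sym pf) mulmxDr -!scalemxAr Mx.
    have := congr1 (pairing f) sum; rewrite !pairingD !pairingZ => e.
    have c2 := C_pos (C_act MG (C_act (flow_natN_G k) Cx)).
    have kt : k%:R ^+ 2 * t <= 1.
      apply: le_trans tm; rewrite ler_pM2r // ler_pXn2r ?nnegrE //.
      by rewrite ler_nat.
    have : k%:R ^+ 2 * t * pairing f (M *m v) <= 1 * pairing f (M *m v) by rewrite ler_pM2r.
    rewrite /g -!mulmxA -/x; lra.
  have : T k%:R = T l%:R.
    have := congr1 (fun K => invmx M *m K *m M) gkl.
    by rewrite /g !mulmxA (GK Gs) // !mul1mx -!mulmxA !(GK Gs) // !mulmx1.
  (* The flow translates [chi] by [k t] with [t > 0], which tells its powers apart. *)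
  move/(congr1 (fun K => pairing chi (K *m x))); rewrite !(pf_chi pf) -/t.
  move/addrI/(mulIf (lt0r_neq0 t0))/eqP; rewrite eqr_nat => /eqP e.
  by rewrite e ltnn in kl.
(* The power of the flow that brings [chi(x) / t] into the unit interval starting at [chi(o1)], over
   which the segment from [o1] to [o2] runs. *)
pose z := - Num.floor (pairing chi x / t - pairing chi o1).
have /andP[z1 z2] := floor_itv (pairing chi x / t - pairing chi o1).
pose x' := T z%:~R *m x.
pose M' := M *m T (- z%:~R).
have GM' : G M'.
  by apply: (GM Gs) => //; have := pf_G pf (- z); rewrite mulrNz.
have M'x' : M' *m x' = o.
  by rewrite /M' /x' -!mulmxA [X in M *m X]mulmxA (pf_D pf) addNr (pf_0 pf) mul1mx.
have M'v : M' *m v = M *m v by rewrite /M' -mulmxA (pf_v pf).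
have Cx' : C x' by apply: C_act => //; exact: (pf_G pf).
have px' : pairing psi x' = t by rewrite (pf_psi pf).
have cx' : pairing chi x' = pairing chi x + z%:~R * t by rewrite (pf_chi pf).
pose th := pairing chi x / t + z%:~R - pairing chi o1.
have zE : z%:~R = - (Num.floor (pairing chi x / t - pairing chi o1))%:~R :> R.
  by rewrite /z mulrNz.
have th0 : 0 <= th by rewrite /th zE; lra.
have th1 : th <= 1 by move: z2; rewrite intrD /th zE; lra.
pose y := (1 - th) *: o1 + th *: o2.
have tn0 : t != 0 by rewrite gt_eqF.
have [la yE] : exists la, y - t^-1 *: x' = la *: v.
  apply: (pf_ker pf); rewrite /y !pairingD pairingN !pairingZ.
    by rewrite po1 po2 px' mulVf //; ring.
  rewrite co2 cx' /th; field; exact: tn0.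
have fy : pairing f y = (1 - th) * pairing f o1 + th * pairing f o2.
  by rewrite pairingD !pairingZ.
have laL : la <= L.
  have := congr1 (pairing f) yE; rewrite pairingD pairingN !pairingZ fy => e.
  have := C_pos Cx' => cx; have : 0 < t^-1 * pairing f x' by rewrite mulr_gt0 // invr_gt0.
  rewrite /L ler_pdivlMr //; nra.
have fM'y : pairing f (M' *m y) <= N2.
  have -> : y = t^-1 *: x' + la *: v by rewrite -yE addrC subrK.
  rewrite mulmxDr -!scalemxAr M'x' M'v pairingD !pairingZ /N2.
  have tm : t^-1 <= m%:R ^+ 2.
    by rewrite -[t^-1]mul1r ler_pdivrMr // ltW.
  have h1 : t^-1 * pairing f o <= m%:R ^+ 2 * pairing f o by rewrite ler_pM2r.
  have L0 : 0 <= L by rewrite divr_ge0 // ltW // addr_gt0.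
  have h2 : la * pairing f (M *m v) <= L * pairing f (M *m v) by rewrite ler_pM2r.
  have h3 : L * pairing f (M *m v) <= L * N by apply: ler_wpM2l.
  lra.
move: fM'y; rewrite /y mulmxDr -!scalemxAr pairingD !pairingZ => fM'y.
have c1 := C_pos (C_act GM' Co1); have c2 := C_pos (C_act GM' Co2).
(* One of the weights [1 - th] and [th] is at least 1/2, whence the factor 2 in the bounds. *)
exists M' => //; have [le|lt] := lerP th (1 / 2); [left|right]; split=> //; nra.
Qed.

(* A multiplier other than 1 would give an infinite bounded sequence in the orbit. *)
Lemma parabolic_multiplier M (la : R) : C !=set0 -> G M -> 0 < la -> M *m v = la *: v -> la = 1.
Proof.
move=> C0.
have key K (mu : R) : G K -> 0 < mu -> mu < 1 -> K *m v <> mu *: v.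
  move=> KG mu0 mu1 Kv.
  have [m hm] := finite_pigeonhole (parabolic_orbit_finite (pairing f v) C0).
  have fv := fv_gt0.
  have [k _|k [l [kl lm e]]] := hm (fun k => mu ^+ k *: v).
    elim: k => [|k [L [GL LE Lle]]].
      by exists 1%:M; rewrite expr0 scale1r mul1mx; split=> //; exact: (G1 Gs).
    exists (L *m K); split.
    - exact: (GM Gs).
    - by rewrite -mulmxA Kv -scalemxAr -LE scalerA exprS.
    - rewrite exprS -scalerA pairingZ; apply: le_trans Lle.
      have := v_pos GL; rewrite -LE => p.
      by rewrite ler_piMl ?ltW.
  have /eqP : mu ^+ k * pairing f v = mu ^+ l * pairing f v by rewrite -!pairingZ e.
  rewrite (inj_eq (mulIf (lt0r_neq0 fv))) => /eqP e'.
  have : mu ^+ l < mu ^+ k by rewrite ltr_iXn2l.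
  by rewrite e' ltxx.
move=> MG la0 Mv; have [lt|gt|//] := ltrgtP la 1.
  by case: (key _ _ MG la0 lt).
case: (key (invmx M) la^-1 (GV Gs MG)); rewrite ?invr_gt0 ?invf_lt1 //.
by rewrite -{1}[v]scale1r -(mulVf (lt0r_neq0 la0)) -scalerA -Mv -scalemxAr (GKv Gs).
Qed.

End Orbit.
End Parabolic.

(** * The cone over a strictly convex domain *)

Section VectorTopology.
Variable R : realType.
Notation V := 'cV[R]_3.
Implicit Types x y u : V.

Lemma nbhs_colP x (W : set V) : nbhs x W <->
  exists2 e : R, 0 < e & forall y, (forall i, `|x i 0 - y i 0| < e) -> W y.
Proof.
split=> [/nbhs_ballP[e e0 he]|[e e0 he]].
  exists e => // y h; apply: he; split=> // i j.
  by rewrite ord1 -ball_normE; exact: h.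
apply/nbhs_ballP; exists e => // y [_ h]; apply: he => i.
by have := h i 0; rewrite -ball_normE.
Qed.

Lemma continuous_coordP (T : topologicalType) (F : T -> V) (x : T) :
  (forall i, {for x, continuous (fun z : T => F z i 0)}) -> {for x, continuous F}.
Proof.
move=> h W /nbhs_colP[e e0 he].
pose A i := [set z : T | `|F x i 0 - F z i 0| < e].
have hi i : nbhs x (A i).
  apply: (h i [set z | `|F x i 0 - z| < e]).
  by apply/nbhs_ballP; exists e => // z; rewrite -ball_normE.
have h3 : nbhs x (A i0 `&` (A i1 `&` A i2)) by apply: filterI => //; exact: filterI.
refine (@filterS _ (nbhs x) _ _ (F @^-1` W) _ h3) => z [h0 [h1 h2]].
by apply: he; exact: ord3P.
Qed.

Lemma continuous_entry i : continuous (fun x : V => x i 0).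
Proof. exact: coord_continuous. Qed.

Lemma continuous_mulmx (M : 'M[R]_3) : continuous (fun x : V => M *m x).
Proof.
move=> x; apply: continuous_coordP => i.
have -> : (fun y : V => (M *m y) i 0) = pairing (row i M).
  by apply/funext => y; rewrite /pairing -row_mul [in RHS]mxE.
exact: continuous_pairing.
Qed.

Lemma continuous_scale (s : R) : continuous (fun x : V => s *: x).
Proof.
move=> x; have -> : (fun y : V => s *: y) = (fun y : V => s%:M *m y).
  by apply/funext => y; rewrite mul_scalar_mx.
exact: continuous_mulmx.
Qed.

Lemma continuous_sqnorm : continuous (@sqnorm R).
Proof.
have -> : @sqnorm R = (fun x : V => x i0 0 * x i0 0 + x i1 0 * x i1 0 + x i2 0 * x i2 0).
  by apply/funext => x; rewrite /sqnorm sum3E !expr2.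
move=> x; have sq i := continuousM (@continuous_entry i x) (@continuous_entry i x).
exact: (continuousD (continuousD (sq i0) (sq i1)) (sq i2)).
Qed.

Lemma sqnorm_ge0 x : 0 <= sqnorm x.
Proof. by apply: sumr_ge0 => i _; exact: sqr_ge0. Qed.

Lemma sqnorm_eq0 x : (sqnorm x == 0) = (x == 0).
Proof.
apply/eqP/eqP => [|->]; last by rewrite /sqnorm sum3E !mxE; ring.
move=> /eqP; rewrite psumr_eq0 => [/allP h|i _]; last exact: sqr_ge0.
apply/matrixP => i j; rewrite ord1 mxE; apply/eqP; rewrite -sqrf_eq0.
by apply: h; exact: mem_index_enum.
Qed.

Lemma sqnormZ (s : R) x : sqnorm (s *: x) = s ^+ 2 * sqnorm x.
Proof. by rewrite /sqnorm mulr_sumr; apply: eq_bigr => i _; rewrite mxE exprMn. Qed.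

Lemma entry_le_sqnorm x i : `|x i 0| ^+ 2 <= sqnorm x.
Proof.
rewrite /sqnorm (bigD1 i) //= real_normK ?num_real // lerDl.
by apply: sumr_ge0 => j _; exact: sqr_ge0.
Qed.

Lemma sphere_neq0 x : sphere x -> x != 0.
Proof. by move=> h; rewrite -sqnorm_eq0 h oner_eq0. Qed.

Lemma sqrt_sqnorm_gt0 x : x != 0 -> 0 < Num.sqrt (sqnorm x).
Proof. by move=> x0; rewrite sqrtr_gt0 lt0r sqnorm_eq0 x0 sqnorm_ge0. Qed.

Lemma radialE x : x != 0 -> x = Num.sqrt (sqnorm x) *: radial x.
Proof. by move=> /sqrt_sqnorm_gt0 h; rewrite scalerA divff ?scale1r // gt_eqF. Qed.

Lemma continuous_radial x : x != 0 -> {for x, continuous (@radial R)}.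
Proof.
move=> x0; apply: continuous_coordP => i.
have -> : (fun y : V => radial y i 0) =
    (fun y => (Num.sqrt (sqnorm y))^-1) \* (fun y : V => y i 0).
  by apply/funext => y; rewrite /radial mxE.
apply: continuousM; last exact: continuous_entry.
apply: (@continuousV _ _ (fun y => Num.sqrt (sqnorm y))).
  by rewrite gt_eqF // sqrt_sqnorm_gt0.
apply: (@continuous_comp _ _ _ (@sqnorm R) (@Num.sqrt R)); first exact: continuous_sqnorm.
exact: sqrt_continuous.
Qed.

Lemma closure_image (F : V -> V) (A B : set V) x : {for x, continuous F} ->
  (forall y, A y -> B (F y)) -> closure A x -> closure B (F x).
Proof.
move=> cF AB cA W /cF nW; have [y [Ay Wy]] := cA _ nW.
by exists (F y); split => //; exact: AB.
Qed.

Lemma closure_pairing_ge (h : 'rV[R]_3) (A : set V) (k : R) x :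
  (forall y, A y -> k <= pairing h y) -> closure A x -> k <= pairing h x.
Proof.
move=> Ak cA; rewrite leNgt; apply/negP => lt.
have : nbhs x (pairing h @^-1` [set z | z < k]).
  apply: continuous_pairing; exact: (open_nbhs_nbhs (conj (@open_lt R k) lt)).
move=> /cA[y [Ay]] /=; apply/negP; rewrite -leNgt; exact: Ak.
Qed.

Lemma closure_sphere (A : set V) x : A `<=` @sphere R -> closure A x -> sphere x.
Proof.
move=> AS cA; apply/eqP; apply/negPn/negP => ne.
have ne' : (fun z : R => z != 1) (sqnorm x) by [].
have op : open [set z : R | z != 1].
  rewrite (_ : [set z : R | z != 1] = ~` [set 1]); last first.
    by apply/seteqP; split=> z /= /eqP.
  by by apply: closed_openC; exact: closed_eq.
have : nbhs x (@sqnorm R @^-1` [set z | z != 1]).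
  apply: continuous_sqnorm; exact: (open_nbhs_nbhs (conj op ne')).
by move=> /cA[y [/AS sy /=]]; rewrite sy eqxx.
Qed.

Lemma sphere_min (h : 'rV[R]_3) (A : set V) : A `<=` @sphere R -> A !=set0 ->
  exists2 x, closure A x & forall y, A y -> pairing h x <= pairing h y.
Proof.
move=> AS [a Aa].
(* Compactness of closed bounded sets is applied to row vectors and carried to columns by
   transposition. *)
pose tr (y : 'rV[R]_3) : V := y^T.
have ctr : continuous tr.
  move=> y; apply: continuous_coordP => i.
  have -> : (fun z => tr z i 0) = (fun z => z 0 i) by apply/funext => z; rewrite /tr mxE.
  exact: coord_continuous.
pose K := tr @^-1` (closure A).
have clK : closed K.
  by apply: closed_comp => [y _|]; [exact: ctr|exact: closed_closure].
have bK : bounded_set K.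
  exists 1; split=> [|M M1]; first exact: num_real.
  move=> y /= /(closure_sphere AS) sy.
  rewrite /Num.Def.normr /= mx_normrE; apply/bigmax_leP; split=> [|[i j] _ /=]; first lra.
  have := entry_le_sqnorm (tr y) j; rewrite sy /tr mxE ord1.
  by rewrite expr_le1 //; lra.
have K0 : K !=set0.
  exists a^T; rewrite /K /tr /= trmxK; exact: subset_closure.
have [|c cK cmin] := compact_EVT_min K0 (bounded_closed_compact bK clK) (f := pairing h \o tr).
  apply: continuous_subspaceT => y; apply: continuous_comp; first exact: ctr.
  exact: continuous_pairing.
exists (tr c); first by move: cK; rewrite inE.
move=> y Ay; have := cmin y^T; rewrite /= /tr trmxK; apply.
by rewrite inE /K /tr /= trmxK; exact: subset_closure.
Qed.

End VectorTopology.

Section Domain.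
Variables (R : realType) (Omega : set (RP2 R)) (Omp : set 'cV[R]_3).
Hypothesis hOmega : strictly_convex_domain Omega.
Hypothesis hlift : is_lift Omega Omp.
Notation V := 'cV[R]_3.
Notation nonzero := [set w : V | w != 0].
Implicit Types (x y u v w a b : V) (p q : RP2 R) (s t : R).

Lemma preimage_coneP A v : preimage_cone A v <-> v != 0 /\ forall p, hcoord p v -> A p.
Proof.
split=> [[p Ap pv]|[v0 h]].
  by split=> [|q qv]; [exact: hcoord_neq0 pv|rewrite (hcoord_inj qv pv)].
by have [p pv] := hcoord_ex v0; exists p => //; exact: h.
Qed.

Lemma preimage_cone_scale A v t : t != 0 -> preimage_cone A v -> preimage_cone A (t *: v).
Proof. by move=> t0 [p Ap pv]; exists p => //; exact: hcoord_scale. Qed.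

Lemma nbhs_nonzero (w : set_type nonzero) (W : set (set_type nonzero)) :
  nbhs w W -> exists2 U : set V, nbhs (val w) U &
    forall w' : set_type nonzero, U (val w') -> W w'.
Proof.
rewrite nbhsE => -[W' [[U oU <-] Uw] sW].
by exists U => [|w' Uw']; [exact: open_nbhs_nbhs|exact: sW].
Qed.

Lemma preimage_cone_open x : preimage_cone Omega x -> nbhs x (preimage_cone Omega).
Proof.
move=> [p Op [w wx wp]]; have [oO _ _] := hOmega.
have nO : nbhs (quotient_map (@proportional R) w) Omega.
  by rewrite wp; exact: (open_nbhs_nbhs (conj oO Op)).
have [U nU UO] := nbhs_nonzero (@quotient_map_continuous _ _ w _ nO).
rewrite wx in nU.
have n0 : nbhs x (fun y : V => y != 0).
  have x0 : x != 0 by apply: (@hcoord_neq0 _ p); exists w.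
  have [i xi] : exists i, x i 0 != 0.
    apply/existsP; apply: contraNT x0; rewrite negb_exists => /forallP h.
    by apply/eqP/matrixP => i j; rewrite ord1 mxE; apply/eqP; rewrite -[_ == _]negbK; exact: h.
  apply/nbhs_colP; exists `|x i 0|; first by rewrite normr_gt0.
  move=> y /(_ i) h; apply: contraTneq h => ->.
  by rewrite mxE subr0 ltxx.
have nn : nbhs x (U `&` (fun y : V => y != 0)) by exact: filterI.
refine (filterS _ nn) => y [Uy y0].
have [q [w' w'y w'q]] := hcoord_ex y0.
exists q; last by exists w'.
by rewrite -w'q; apply: UO; rewrite w'y.
Qed.

Lemma closure_preimage_cone x (A : set V) : A `<=` preimage_cone Omega -> x != 0 ->
  closure A x -> preimage_cone (closure Omega) x.
Proof.
move=> AO x0 cA; have [p [w wx wp]] := hcoord_ex x0.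
exists p; last by exists w.
move=> W; rewrite -wp => /(@quotient_map_continuous _ _ w)/nbhs_nonzero[U nU UW].
rewrite wx in nU; have [y [Ay Uy]] := cA _ nU.
have [q Oq [w' w'y w'q]] := AO _ Ay.
exists q; split=> //; rewrite -w'q; apply: UW; by rewrite w'y.
Qed.

Definition cone : set V := [set x | exists t u, [/\ 0 < t, Omp u & x = t *: u]].

Lemma Omp_cone : Omp `<=` cone.
Proof. by move=> u Ou; exists 1, u; rewrite scale1r. Qed.

Lemma cone_scale s x : 0 < s -> cone x -> cone (s *: x).
Proof.
by move=> s0 [t [u [t0 Ou ->]]]; exists (s * t), u; rewrite mulr_gt0 // scalerA.
Qed.

Lemma cone_preimage : cone `<=` preimage_cone Omega.
Proof.
have [_ OO _ _] := hlift; move=> _ [t [u [t0 Ou ->]]].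
by apply: preimage_cone_scale; [rewrite gt_eqF|exact: OO].
Qed.

Lemma cone_nonempty : cone !=set0.
Proof.
have [_ [p Op] _] := hOmega; have [_ _ _ /(_ p Op)[u [[Ou _] _]]] := hlift.
by exists u; exact: Omp_cone.
Qed.

(* The sign sg is needed because the functional of the affine chart may be negative on
   the chosen lift. *)
Lemma cone_functional : exists (f : 'rV[R]_3) (sg : R),
  [/\ [/\ sg != 0, (forall v, preimage_cone (closure Omega) v -> pairing f v != 0),
       convex_set (chart f Omega : set (convex_lmodType V)),
       convex_set (chart f (closure Omega) : set (convex_lmodType V)) &
       forall u v, u != v -> ~ segment u v `<=` chart f (boundary Omega)],
     sg ^+ 2 = 1 & forall u, Omp u -> 0 < sg * pairing f u].
Proof.
have [_ [p Op] [f [f0 h1 h2 h3]]] := hOmega.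
have [_ OO cO /(_ p Op)[u0 [[Ou0 _] _]]] := hlift.
have fO u : Omp u -> pairing f u != 0.
  move=> /OO[q Oq qu]; apply: f0; exists q => //; exact: subset_closure.
have cI : connected (pairing f @` Omp).
  apply: connected_continuous_connected => //.
  by apply: continuous_subspaceT; exact: continuous_pairing.
move/connected_intervalP: cI => cI.
have sep u u' : Omp u -> Omp u' -> pairing f u < 0 -> 0 < pairing f u' -> False.
  move=> Ou Ou' n p'; have : (pairing f @` Omp) 0.
    apply: (cI (pairing f u) (pairing f u')); [by exists u|by exists u'|].
    by rewrite !ltW.
  by case=> w Ow /eqP; apply/negP; exact: fO.
have := fO _ Ou0; rewrite neq_lt => /orP[n|p0].
  exists f, (-1); split; [by split; rewrite ?oppr_eq0 ?oner_eq0|by rewrite sqrrN expr1n|].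
  move=> u Ou; rewrite mulN1r oppr_gt0; have := fO _ Ou.
  by rewrite neq_lt => /orP[//|pu]; case: (sep _ _ Ou0 Ou n pu).
exists f, 1; split; [by split; rewrite ?oner_eq0|by rewrite expr1n|].
move=> u Ou; rewrite mul1r; have := fO _ Ou.
by rewrite neq_lt => /orP[nu|//]; case: (sep _ _ Ou Ou0 nu p0).
Qed.

Variables (f : 'rV[R]_3) (sg : R).
Hypothesis sg0 : sg != 0.
Hypothesis sg2 : sg ^+ 2 = 1.
Hypothesis f_neq0 : forall v, preimage_cone (closure Omega) v -> pairing f v != 0.
Hypothesis chart_convex : convex_set (chart f Omega : set (convex_lmodType V)).
Hypothesis chart_closure_convex : convex_set (chart f (closure Omega) : set (convex_lmodType V)).
Hypothesis chart_strict : forall u v, u != v -> ~ segment u v `<=` chart f (boundary Omega).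
Hypothesis f_Omp : forall u, Omp u -> 0 < sg * pairing f u.

Definition height : 'rV[R]_3 := sg *: f.

Lemma heightE x : pairing height x = sg * pairing f x.
Proof. by rewrite /pairing -scalemxAl mxE. Qed.

Lemma f_height x : pairing f x = sg * pairing height x.
Proof. by rewrite heightE mulrA -expr2 sg2 mul1r. Qed.

Lemma coneP x : cone x <-> preimage_cone Omega x /\ 0 < pairing height x.
Proof.
split=> [Cx|[[p Op px] fx]].
  split; first exact: cone_preimage.
  by case: Cx => t [u [t0 Ou ->]]; rewrite pairingZ mulr_gt0 // heightE f_Omp.
have [_ _ _ /(_ p Op)[u [[Ou pu] _]]] := hlift.
have [t t0 xE] := hcoord_prop pu px; exists t, u; split=> //.
have := f_Omp Ou; rewrite -heightE => fu.
by rewrite -(pmulr_lgt0 _ fu) -pairingZ -xE.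
Qed.

Lemma cone_pos x : cone x -> 0 < pairing height x.
Proof. by case/coneP. Qed.

Lemma cone_nbhs x : cone x -> nbhs x cone.
Proof.
move=> /coneP[Ox fx].
have n2 : nbhs x (pairing height @^-1` [set z | 0 < z]).
  apply: continuous_pairing; exact: (open_nbhs_nbhs (conj (@open_gt R 0) fx)).
have nn : nbhs x (preimage_cone Omega `&` (pairing height @^-1` [set z | 0 < z])).
  by apply: filterI => //; exact: preimage_cone_open.
by refine (filterS _ nn) => y [Oy fy]; apply/coneP.
Qed.

Lemma cone_line_open : line_open cone.
Proof.
move=> x /cone_nbhs/nbhs_colP[e e0 he] y.
pose n := 1 + (`|y i0 0| + `|y i1 0| + `|y i2 0|).
have yn i : `|y i 0| <= n.
  have := normr_ge0 (y i0 0); have := normr_ge0 (y i1 0); have := normr_ge0 (y i2 0).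
  by move: i; rewrite /n; apply: ord3P; lra.
have n0 : 0 < n by have := normr_ge0 (y i0 0); have := yn i0; rewrite /n; have := normr_ge0 (y i1 0); have := normr_ge0 (y i2 0); lra.
exists (e / n / 2); first by rewrite !divr_gt0.
move=> s hs; apply: he => i.
rewrite !mxE opprD addrA subrr add0r normrN normrM.
have : `|s| * `|y i 0| <= e / n / 2 * n by apply: ler_pM.
suff -> : e / n / 2 * n = e / 2 by move=> h; apply: le_lt_trans h _; lra.
by field; rewrite gt_eqF.
Qed.

(* Normalising by the height relates sums in the cone to convex combinations in the
   affine chart. *)
Lemma cone_add x y : cone x -> cone y -> cone (x + y).
Proof.
move=> Cx Cy; have fx := cone_pos Cx; have fy := cone_pos Cy.
have nrm z : cone z -> (sg * (pairing height z)^-1 *: z) \in chart f Omega.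
  move=> Cz; have fz := cone_pos Cz; rewrite inE; split.
    apply: preimage_cone_scale; last exact: cone_preimage.
    by rewrite mulf_neq0 // invr_eq0 gt_eqF.
  by rewrite pairingZ f_height mulrACA -expr2 sg2 mul1r mulVf // gt_eqF.
have h0 : 0 < pairing height x + pairing height y by rewrite addr_gt0.
pose la := pairing height x / (pairing height x + pairing height y).
have la0 : 0 <= la by rewrite divr_ge0 // ltW.
have la1 : la <= 1 by rewrite ler_pdivrMr // mul1r lerDl ltW.
have := chart_convex (Itv01 la0 la1) (nrm _ Cx) (nrm _ Cy).
rewrite inE => -[Oz _]; apply/coneP; split; last by rewrite pairingD.
have e : x + y = (sg * (pairing height x + pairing height y)) *:
   (la *: (sg * (pairing height x)^-1 *: x) + (1 - la) *: (sg * (pairing height y)^-1 *: y)).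
  have sg2' : sg * sg = 1 by rewrite -expr2.
  have e1 : (sg * (pairing height x + pairing height y)) * (la * (sg * (pairing height x)^-1)) = 1.
    rewrite mulrACA mulrCA mulrA; rewrite /la.
    transitivity (sg * sg); last by [].
    by field; rewrite !gt_eqF.
  have e2 : (sg * (pairing height x + pairing height y)) * ((1 - la) * (sg * (pairing height y)^-1)) = 1.
    rewrite /la; transitivity (sg * sg); last by [].
    by field; rewrite !gt_eqF.
  by rewrite scalerDr !scalerA -!mulrA !mulrA in e1 e2 *; rewrite e1 e2 !scale1r.
rewrite e; apply: preimage_cone_scale; last exact: Oz.
by rewrite mulf_neq0 // gt_eqF.
Qed.

(** Exchange [a] for a nearby [w] of the cone: [x + a - w] is close to [x], hence still in the open
    cone. *)
Lemma cone_closure_add x a : cone x -> closure cone a -> cone (x + a).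
Proof.
move=> Cx ca; have /nbhs_colP[e e0 he] := cone_nbhs Cx.
have : nbhs a [set w | cone (x + a - w)].
  apply/nbhs_colP; exists e => // w hw; apply: he => i.
  rewrite !mxE (_ : x i 0 - (x i 0 + a i 0 - w i 0) = - (a i 0 - w i 0)); last by ring.
  by rewrite normrN.
move=> /ca[w [Cw /= Cxw]].
have -> : x + a = (x + a - w) + w by rewrite subrK.
exact: cone_add.
Qed.

Lemma closure_Omp_cone : closure Omp `<=` closure cone.
Proof. apply: closureS; exact: Omp_cone. Qed.

Lemma Omp_sphere : Omp `<=` @sphere R. Proof. by case: hlift. Qed.

(** On the compact closure of the lift the functional attains its minimum, which is nonzero because
    the affine chart contains the closure of the domain. *)
Lemma closure_Omp_pos : exists2 k, 0 < k & forall u, closure Omp u -> k <= pairing height u.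
Proof.
have [_ [p Op] _] := hOmega; have [_ OO _ /(_ p Op)[u0 [[Ou0 _] _]]] := hlift.
have [x cx xmin] := sphere_min height Omp_sphere (ex_intro _ u0 Ou0).
have x0 := sphere_neq0 (closure_sphere Omp_sphere cx).
have xge : 0 <= pairing height x.
  apply: (closure_pairing_ge _ cx) => y Oy; by rewrite heightE ltW // f_Omp.
exists (pairing height x); last by move=> u; exact: closure_pairing_ge.
rewrite lt0r xge andbT heightE mulf_neq0 //; apply: f_neq0.
exact: (closure_preimage_cone OO x0 cx).
Qed.

Lemma cone_norm : exists K, forall x, cone x -> entries_le (K * pairing height x) x.
Proof.
have [k k0 hk] := closure_Omp_pos.
exists k^-1 => _ [t [u [t0 Ou ->]]] i j; rewrite ord1 mxE pairingZ normrM gtr0_norm //.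
have h1 : `|u i 0| <= 1.
  by have := entry_le_sqnorm u i; rewrite (Omp_sphere Ou) expr_le1.
have h2 := hk u (subset_closure Ou).
have h3 : 1 <= k^-1 * pairing height u by rewrite mulrC ler_pdivlMr // mul1r.
by rewrite mulrCA ler_pM2l //; exact: le_trans h1 h3.
Qed.

Lemma lightcone_pos a : lightcone Omp a -> 0 < pairing height a.
Proof.
move=> [t [u [t0 [cu _] ->]]]; rewrite pairingZ mulr_gt0 //.
by have [k k0 /(_ _ cu)] := closure_Omp_pos; exact: lt_le_trans.
Qed.

Lemma lightcone_closure a : lightcone Omp a -> closure cone a.
Proof.
move=> [t [u [t0 [cu _] ->]]].
apply: (@closure_image _ (fun x => t *: x) cone); first exact: continuous_scale.
  by move=> y; exact: cone_scale.
exact: closure_Omp_cone.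
Qed.

Lemma lightcone_notcone a : lightcone Omp a -> ~ cone a.
Proof.
move=> [t [u [t0 [cu nu] ->]]] Cu; apply: nu.
have : cone u.
  rewrite -[u]scale1r -(mulVf (lt0r_neq0 t0)) -scalerA; apply: cone_scale => //.
  by rewrite invr_gt0.
move=> [s [u' [s0 Ou' uE]]].
have := closure_sphere Omp_sphere cu; rewrite /sphere /= uE sqnormZ (Omp_sphere Ou') mulr1.
move=> /eqP; rewrite sqrp_eq1 ?ltW // => /eqP s1.
by rewrite s1 scale1r.
Qed.

Lemma lightcone_neq0 a : lightcone Omp a -> a != 0.
Proof.
move=> /lightcone_pos h; apply: contraTneq h => ->.
by rewrite pairingE !mxE !mulr0 !addr0 ltxx.
Qed.

Lemma lightcone_closure_Omega a : lightcone Omp a -> preimage_cone (closure Omega) a.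
Proof.
move=> La; apply: (closure_preimage_cone cone_preimage (lightcone_neq0 La)).
exact: lightcone_closure.
Qed.

Lemma lightcone_notOmega a : lightcone Omp a -> ~ preimage_cone Omega a.
Proof.
by move=> La Oa; apply: (lightcone_notcone La); apply/coneP; split=> //; exact: lightcone_pos.
Qed.

Lemma interior_Omega : Omega° = Omega.
Proof. by have [oO _ _] := hOmega; apply/interior_id. Qed.

Lemma lightcone_boundary p a : lightcone Omp a -> hcoord p a -> boundary Omega p.
Proof.
move=> La pa; have [_ h] := (preimage_coneP _ _).1 (lightcone_closure_Omega La).
split; first exact: h.
by rewrite interior_Omega => Op; apply: (lightcone_notOmega La); exists p.
Qed.

(** Strict convexity yields some point of the chart segment off the boundary, hence a vector
    [ca a + cb b] of the cone, but with weights that are not under control. A small multiple of it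
    is completed to [a + b] by positive multiples of [a] and [b]. *)
Lemma lightcone_add a b : lightcone Omp a -> lightcone Omp b ->
  (forall t, b <> t *: a) -> cone (a + b).
Proof.
move=> La Lb npr; have fa := lightcone_pos La; have fb := lightcone_pos Lb.
pose n z := sg * (pairing height z)^-1 *: z.
have nrm z : lightcone Omp z -> n z \in chart f (closure Omega).
  move=> Lz; have fz := lightcone_pos Lz; rewrite inE; split.
    apply: preimage_cone_scale; last exact: lightcone_closure_Omega.
    by rewrite mulf_neq0 // invr_eq0 gt_eqF.
  by rewrite pairingZ f_height mulrACA -expr2 sg2 mul1r mulVf // gt_eqF.
have nab : n a != n b.
  apply/eqP => e; apply: (npr (pairing height b * (pairing height a)^-1)).
  have h z : 0 < pairing height z -> z = (sg * pairing height z) *: n z.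
    by move=> fz; rewrite scalerA mulrACA -expr2 sg2 mul1r mulfV ?scale1r // gt_eqF.
  rewrite {1}(h b fb) -e /n scalerA; congr (_ *: _).
  by rewrite mulrACA -expr2 sg2 mul1r.
have := chart_strict nab => /existsNP[m /not_implyP[sm nm]].
case: sm => la /andP[la0 la1] mE.
have : m \in chart f (closure Omega).
  by rewrite -mE; exact: (chart_closure_convex (Itv01 la0 la1) (nrm _ La) (nrm _ Lb)).
rewrite inE => -[[p cp pm] fm].
have Op : Omega p.
  rewrite -interior_Omega; apply: contrapT => ni; apply: nm; split=> //.
  by exists p.
have Om : preimage_cone Omega m by exists p.
have Csm : cone (sg *: m).
  apply/coneP; split; first exact: preimage_cone_scale.
  by rewrite pairingZ heightE fm mulr1 -expr2 sg2.
pose ca := la * (pairing height a)^-1; pose cb := (1 - la) * (pairing height b)^-1.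
have smE : sg *: m = ca *: a + cb *: b.
  rewrite -mE /n scalerDr !scalerA /ca /cb; congr (_ *: _ + _ *: _).
    transitivity (sg ^+ 2 * (la * (pairing height a)^-1)); first by ring.
    by rewrite sg2 mul1r.
  transitivity (sg ^+ 2 * ((1 - la) * (pairing height b)^-1)); first by ring.
  by rewrite sg2 mul1r.
have ca0 : 0 <= ca by rewrite mulr_ge0 // invr_ge0 ltW.
have cb0 : 0 <= cb by rewrite mulr_ge0 ?invr_ge0 ?subr_ge0 // ltW.
(* Chosen so that [e * ca] and [e * cb] are both below 1. *)
pose e := (1 + ca + cb)^-1.
have e0 : 0 < e by rewrite invr_gt0; lra.
have eE : (1 + ca + cb) * e = 1 by rewrite mulfV // gt_eqF //; lra.
have ext x c s : cone x -> lightcone Omp c -> 0 < s -> cone (x + s *: c).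
  move=> Cx Lc s0; apply: cone_closure_add => //; apply: lightcone_closure.
  by case: Lc => t [u [t0 cu ->]]; exists (s * t), u; rewrite mulr_gt0 // scalerA.
have -> : a + b = (e *: (sg *: m) + (1 - e * ca) *: a) + (1 - e * cb) *: b.
  by rewrite smE; vring.
have eca : 0 < 1 - e * ca by nra.
have ecb : 0 < 1 - e * cb by nra.
by apply: (ext) => //; apply: ext => //; exact: cone_scale.
Qed.

Section Action.
Variable G : set 'M[R]_3.
Hypothesis Gs : subgroup_SL3 G.
Hypothesis G_lift : preserves_lift G Omp.

Lemma mulG_neq0 M x : G M -> x != 0 -> M *m x != 0.
Proof.
move=> MG; apply: contraNneq => e; by rewrite -(GKv Gs x MG) e mulmx0.
Qed.

Lemma cone_act M x : G M -> cone x -> cone (M *m x).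
Proof.
move=> MG [t [u [t0 Ou ->]]].
have u0 := mulG_neq0 MG (sphere_neq0 (Omp_sphere Ou)).
exists (t * Num.sqrt (sqnorm (M *m u))), (radial (M *m u)); split.
- by rewrite mulr_gt0 // sqrt_sqnorm_gt0.
- exact: G_lift.
- by rewrite -scalerA -radialE // scalemxAr.
Qed.

Lemma lightcone_act M a : G M -> lightcone Omp a -> lightcone Omp (M *m a).
Proof.
move=> MG La; have nC : ~ cone (M *m a).
  by move/(cone_act (GV Gs MG)); rewrite (GKv Gs) //; exact: lightcone_notcone.
case: La nC => [t [u [t0 [cu nu] ->]]] nC.
have u0 := mulG_neq0 MG (sphere_neq0 (closure_sphere Omp_sphere cu)).
exists (t * Num.sqrt (sqnorm (M *m u))), (radial (M *m u)).
have E : M *m (t *: u) = (t * Num.sqrt (sqnorm (M *m u))) *: radial (M *m u).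
  by rewrite -scalerA -radialE // scalemxAr.
split=> //; first by rewrite mulr_gt0 // sqrt_sqnorm_gt0.
have cF : {for u, continuous (fun x => radial (M *m x))}.
  apply: (@continuous_comp _ _ _ (fun x => M *m x) (@radial R)); first exact: continuous_mulmx.
  exact: continuous_radial.
split; first exact: (closure_image cF (fun y Oy => G_lift MG Oy) cu).
move=> Or; apply: nC; rewrite E; apply: cone_scale; last exact: Omp_cone.
by rewrite mulr_gt0 // sqrt_sqnorm_gt0.
Qed.

End Action.
End Domain.

(** * The orbit of the light-cone representatives *)

Section LightconeOrbit.
Variables (R : realType) (Omega : set (RP2 R)) (G : set 'M[R]_3).
Variables (Omp C : set 'cV[R]_3) (f : 'rV[R]_3) (v : set (RP2 R) -> 'cV[R]_3).
Hypothesis Gs : subgroup_SL3 G.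
Hypothesis C_open : line_open C.
Hypothesis C_add : forall x y, C x -> C y -> C (x + y).
Hypothesis C_scale : forall s x, 0 < s -> C x -> C (s *: x).
Hypothesis C_pos : forall x, C x -> 0 < pairing f x.
Hypothesis C_act : forall M x, G M -> C x -> C (M *m x).
Hypothesis C_free : forall M x, G M -> C x -> M *m x = x -> M = 1%:M.
Hypothesis C_nonempty : C !=set0.
Hypothesis orbits_finite : forall o (N : R), C o ->
  finite_set [set M | G M /\ pairing f (M *m o) <= N].
Hypothesis L_pos : forall a, lightcone Omp a -> 0 < pairing f a.
Hypothesis L_notC : forall a, lightcone Omp a -> ~ C a.
Hypothesis L_act : forall M a, G M -> lightcone Omp a -> lightcone Omp (M *m a).
Hypothesis L_ext : forall x a, C x -> lightcone Omp a -> C (x + a).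
Hypothesis L_add : forall a b, lightcone Omp a -> lightcone Omp b ->
  (forall t, b <> t *: a) -> C (a + b).
Hypothesis hv : lightcone_choice G Omega Omp v.
Implicit Types (a b x : 'cV[R]_3) (p q : RP2 R) (c : set (RP2 R)) (M N : 'M[R]_3).

Let B := lightcone_orbit G Omega v.

Lemma orbit_moves M p q : G M -> moves M p q -> Defs.orbit G p = Defs.orbit G q.
Proof.
move=> MG [u pu qMu]; rewrite eqEsubset; split=> r [N GN [w pw rNw]].
  exists (N *m invmx M); first by apply: (GM Gs) => //; exact: (GV Gs).
  have [t t0 wE] := hcoord_prop pw pu.
  exists (M *m u) => //; rewrite -mulmxA (GKv Gs) // wE -scalemxAr.
  exact: hcoord_scale.
exists (N *m M); first exact: (GM Gs).
have [t t0 wE] := hcoord_prop pw qMu.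
exists u => //; rewrite -mulmxA wE -scalemxAr; exact: hcoord_scale.
Qed.

Lemma lightcone_orbit_act M b : G M -> B b -> B (M *m b).
Proof.
move=> MG [N [c [GN cc ->]]]; exists (M *m N), c; split=> //; first exact: (GM Gs).
by rewrite mulmxA.
Qed.

Lemma lightcone_orbit_lightcone b : B b -> lightcone Omp b.
Proof. by move=> [N [c [GN cc ->]]]; apply: L_act => //; have [] := hv cc. Qed.

(** A cusp provides a parabolic element at some point of its orbit only; conjugation moves it to
    [b]. *)
Lemma lightcone_orbit_flow b : B b -> exists T psi chi, parabolic_flow G b T psi chi.
Proof.
move=> Bb; have := Bb; move=> [M [c [MG cc bE]]].
have [Lv [p cp pv]] := hv cc; move: cc cp => [p0 [_ [N [GN pN [w1 pw1 pNw1]]]] <-] [K KG [w0 pw0 pKw0]].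
have [i i0 w1E] := hcoord_prop pw0 pw1; have [j j0 NwE] := hcoord_prop pw0 pNw1.
have [l l0 vE] := hcoord_prop pKw0 pv.
have Nw0 : N *m w0 = (i^-1 * j) *: w0.
  by rewrite -scalerA -NwE w1E -scalemxAr scalerA mulVf // scale1r.
have GMK : G (M *m K) by exact: (GM Gs).
have bMK : b = l *: (M *m K *m w0) by rewrite bE vE -scalemxAr mulmxA.
move: (M *m K) GMK bMK => Q GQ bQ.
apply: (@parabolic_flow_ex _ G (Q *m N *m invmx Q) b (i^-1 * j)) => //.
- by apply: (GM Gs); [exact: (GM Gs)|exact: (GV Gs)].
- exact: (parabolic_conj Gs).
- have := L_pos (lightcone_orbit_lightcone Bb); apply: contraTneq => ->.
  by rewrite pairingE !mxE !mulr0 !addr0 ltxx.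
- rewrite bQ -scalemxAr -(mulmxA (Q *m N)) (GKv Gs) // -(mulmxA Q) Nw0 -scalemxAr.
  by rewrite !scalerA mulrC.
Qed.

Lemma lightcone_orbit_pos b : B b -> forall M, G M -> 0 < pairing f (M *m b).
Proof.
by move=> Bb M MG; apply/L_pos/lightcone_orbit_lightcone/lightcone_orbit_act.
Qed.

Lemma lightcone_orbit_finite b (N : R) : B b ->
  finite_set [set w | exists M, [/\ G M, w = M *m b & pairing f w <= N]].
Proof.
move=> Bb; have [T [psi [chi pf]]] := lightcone_orbit_flow Bb.
exact: (parabolic_orbit_finite Gs C_open C_add C_scale C_pos C_act (lightcone_orbit_pos Bb) pf).
Qed.

(** Proportional vectors come from the same cusp, so some group element rescales [v c], and by
    [parabolic_multiplier] the factor is 1. Strict convexity can then be applied to any two distinct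
    vectors of the orbit. *)
Lemma lightcone_orbit_prop a b t : B a -> B b -> b = t *: a -> a = b.
Proof.
move=> Ba Bb ba.
have La := lightcone_orbit_lightcone Ba; have Lb := lightcone_orbit_lightcone Bb.
have t0 : 0 < t.
  by have := L_pos Lb; rewrite ba pairingZ pmulr_lgt0 //; exact: L_pos.
have tn0 : t != 0 by rewrite gt_eqF.
move: (Ba) (Bb) => [M [c [MG cc aE]]] [M' [c' [GM' cc' bE]]].
pose K := invmx M' *m M.
have KG : G K by apply: (GM Gs) => //; exact: (GV Gs).
have vK : v c' = t *: (K *m v c).
  by rewrite -[v c'](GKv Gs _ GM') -bE ba aE /K -scalemxAr mulmxA.
have [Lv [p cp pv]] := hv cc; have [Lv' [p' cp' pv']] := hv cc'.
have mv : moves K p p'.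
  exists (v c) => //; rewrite vK in pv'.
  rewrite -[K *m v c]scale1r -(mulVf tn0) -scalerA.
  by apply: hcoord_scale; rewrite ?invr_eq0.
have ccE : c = c'.
  have orbE d q : cusps G Omega d -> d q -> d = Defs.orbit G q.
    by move=> [q0 _ <-] [L GL mL]; exact: (orbit_moves GL mL).
  by rewrite (orbE _ _ cc cp) (orbE _ _ cc' cp'); exact: (orbit_moves KG mv).
subst c'.
have Bv : B (v c) by exists 1%:M, c; rewrite mul1mx; split=> //; exact: (G1 Gs).
have [T [psi [chi pf]]] := lightcone_orbit_flow Bv.
have Kv : K *m v c = t^-1 *: v c by rewrite {2}vK scalerA mulVf // scale1r.
have t1 : t^-1 = 1.
  apply: (parabolic_multiplier Gs C_open C_add C_scale C_pos C_act (lightcone_orbit_pos Bv) pf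
    orbits_finite C_nonempty KG _ Kv).
  by rewrite invr_gt0.
by rewrite ba -[t]invrK t1 invr1 scale1r.
Qed.

Lemma lightcone_orbit_cone_system : cone_system G C f B.
Proof.
split=> //.
- by move=> b /lightcone_orbit_lightcone; exact: L_pos.
- by move=> b /lightcone_orbit_lightcone; exact: L_notC.
- by move=> x b Cx /lightcone_orbit_lightcone; exact: L_ext.
- move=> a b Ba Bb ab; apply: L_add; try exact: lightcone_orbit_lightcone.
  by move=> t e; apply: ab; exact: (lightcone_orbit_prop Ba Bb e).
- exact: lightcone_orbit_act.
- move=> b Bb; have [T [psi [chi pf]]] := lightcone_orbit_flow Bb.
  exists psi; split; first exact: (pf_psiv pf).
  exact: (psi_gt0 Gs C_open C_add C_pos C_act (lightcone_orbit_pos Bb) pf).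
Qed.

End LightconeOrbit.

Theorem theorem8 (R : realType) (Omega : set (RP2 R)) (Gamma : set 'M[R]_3)
    (Omp : set 'cV[R]_3) (g k : nat) (v : set (RP2 R) -> 'cV[R]_3)
    (A : set (set (surface Gamma Omega)))
  (hOmega : strictly_convex_domain Omega)
  (hGamma : subgroup_SL3 Gamma)
  (hdiscrete : discrete_subset Gamma)
  (hfg : finitely_generated Gamma)
  (hpreserves : preserves Gamma Omega)
  (hfree : acts_freely Gamma Omega)
  (hlift : is_lift Omega Omp)
  (hpreserves_lift : preserves_lift Gamma Omp)
  (hvolume : finite_volume Gamma Omega Omp)
  (hsurface : homeomorphic_to_punctured_surface R (surface Gamma Omega) g k)
  (hk : (1 <= k)%N)
  (hchi : 2%:Z - (2 * g)%:Z - k%:Z < 0)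
  (hv : lightcone_choice Gamma Omega Omp v)
  (hA : straight_ideal_triangulation Omp A) :
  edge_flipping_algorithm_terminates Gamma
    (induced_polyhedron Omp (lightcone_orbit Gamma Omega v) A).
Proof.
have [A_fin _ _ _] := hA.
have [f [sg [[sg0 f_neq0 cO cclO strict] sg2 f_Omp]]] := cone_functional hOmega hlift.
pose C := cone Omp; pose h := height f sg.
pose B := lightcone_orbit Gamma Omega v.
have C_open : line_open C by exact: (cone_line_open hOmega hlift f_Omp).
have C_add : forall x y, C x -> C y -> C (x + y).
  by move=> x y; exact: (cone_add hlift sg0 sg2 cO f_Omp).
have C_scale : forall s x, 0 < s -> C x -> C (s *: x) by move=> s x; exact: cone_scale.
have C_pos : forall x, C x -> 0 < pairing h x by move=> x; exact: (cone_pos hlift f_Omp).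
have C_act : forall M x, Gamma M -> C x -> C (M *m x).
  by move=> M x; exact: (cone_act hlift hGamma hpreserves_lift).
have C_Omega : forall x, C x -> exists2 p, Omega p & hcoord p x.
  by move=> x; exact: (cone_preimage hlift).
have C_free : forall M x, Gamma M -> C x -> M *m x = x -> M = 1%:M.
  move=> M x MG /C_Omega[p Op px] Mx; apply: (hfree _ _ MG Op).
  by exists x => //; rewrite Mx.
have L_pos a : lightcone Omp a -> 0 < pairing h a.
  exact: (lightcone_pos hOmega hlift sg0 f_neq0 f_Omp).
have C_nonempty : C !=set0 by exact: (cone_nonempty hOmega hlift).
have orbits_finite (o : 'cV[R]_3) (N : R) : C o ->
    finite_set [set M | Gamma M /\ pairing h (M *m o) <= N].
  apply: (interior_orbit_finite hGamma hdiscrete C_open C_pos C_act).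
  exact: (cone_norm hOmega hlift sg0 f_neq0 f_Omp).
have L_act : forall M a, Gamma M -> lightcone Omp a -> lightcone Omp (M *m a).
  by move=> M a; exact: (lightcone_act hlift hGamma hpreserves_lift).
have CS : cone_system Gamma C h B.
  apply: (@lightcone_orbit_cone_system _ _ _ Omp) => //.
  - by move=> a; exact: (lightcone_notcone hlift).
  - move=> x a Cx La; apply: (cone_closure_add hOmega hlift sg0 sg2 cO f_Omp) => //.
    exact: (lightcone_closure La).
  - by move=> a b; exact: (lightcone_add hOmega hlift sg0 sg2 f_neq0 cO cclO strict f_Omp).
have B_lc b : B b -> lightcone Omp b by exact: (lightcone_orbit_lightcone L_act hv).
have B_bd p b : B b -> hcoord p b -> boundary Omega p.
  by move=> /B_lc; exact: (lightcone_boundary hOmega hlift sg0 f_neq0 f_Omp).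
pose P := induced_polyhedron Omp B A.
have tP : triangulation Gamma B P.
  exact: (induced_triangulation A CS hpreserves C_Omega B_lc B_bd L_pos).
have finP : finite_set (face_classes Gamma P).
  exact: (induced_classes_finite CS hpreserves C_Omega B_lc A_fin).
(* The termination theorem requires bounded parts of the vertex set to be finite. The vertices of
   [P] form finitely many orbits, as there are finitely many face classes, and each orbit is handled
   by [lightcone_orbit_finite]. *)
pose B0 := [set b | B b /\ exists2 F, P F & F b].
have B0_act M b : Gamma M -> B0 b -> B0 (M *m b).
  move=> MG [Bb [F PF Fb]]; split; first exact: (cs_Bact CS).
  by exists (act M F); [exact: (tr_act tP)|exists b].
have CS0 : cone_system Gamma C h B0.
  by apply: (cone_system_sub _ B0_act CS) => b [].
have tP0 : triangulation Gamma B0 P.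
  split; [|exact: (tr_act tP)|exact: (tr_disj tP)].
  move=> F PF; have [a [b [c [[Ba Bb Bc] nn FE]]]] := tr_face tP PF.
  exists a, b, c; split=> //; rewrite FE in PF.
  split; split=> //; exists [set a; b; c] => //; [by left; left|by left; right|by right].
apply: (edge_flipping_terminates CS0 tP0 finP) => N.
apply: (sub_finite_set (B := \bigcup_(kap in face_classes Gamma P)
  \bigcup_(w in [set w | get kap w /\ B w])
    [set z | exists M, [/\ Gamma M, z = M *m w & pairing h z <= N]])).
  move=> b [[Bb [F PF Fb]] bN]; exists (class_of Gamma F); first by exists F.
  have : class_of Gamma F (get (class_of Gamma F)).
    by apply: getPex; exists F; exact: (class_of_refl hGamma).
  move=> /class_ofP[M MG ->]; exists (M *m b).
    by split; [exists b|exact: (cs_Bact CS)].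
  by exists (invmx M); split=> //; [exact: (GV hGamma)|rewrite (GKv hGamma)].
apply: bigcup_finite => // _ [F PF <-]; apply: bigcup_finite => [|w [_ Bw]].
  have : class_of Gamma F (get (class_of Gamma F)).
    by apply: getPex; exists F; exact: (class_of_refl hGamma).
  move=> /class_ofP[M MG ->].
  have [a [b [c [_ _ ->]]]] := tr_face tP PF.
  apply: (sub_finite_set (B := [set M *m a; M *m b; M *m c])); last exact: finite_set3.
  by move=> w [+ _]; rewrite act_set3.
exact: (lightcone_orbit_finite hGamma C_open C_add C_scale C_pos C_act C_nonempty orbits_finite L_pos L_act hv).
Qed.
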